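(* Let $X\subset A^{\mathbb N}$ be a subshift on a finite alphabet $A$, with language $\mathcal L$, and let $\varphi\in C(X)$. Suppose there exist collections of words $\mathcal C^p,\mathcal G,\mathcal C^s\subset\mathcal L$ such that $\mathcal C^p\mathcal G\mathcal C^s=\mathcal L$ and the following conditions hold: (I) $\mathcal G(M)$ has (S)-specification for every $M\in\mathbb N$; (II) $\varphi$ has the Bowen property on $\mathcal G$; (III) $\displaystyle\sum_{n\ge1}\Lambda_n(\mathcal C^p\cup\mathcal C^s,\varphi)\,e^{-nP(\varphi)}<\infty$. Then $\varphi$ has a unique equilibrium state $\mu_\varphi$, which satisfies the following weak Gibbs property: there exist constants $K'>0$ and $K_M>0$ (for each $M$) such that for every $M$, every $n\in\mathbb N$ and every $w\in\mathcal G(M)_n$, $$K_M\le\frac{\mu_\varphi([w])}{e^{-nP(\varphi)+\varphi_n(w)}}\le K'.$$ If (S)-specification is replaced with (Per)-specification in condition (I), then moreover $$\mu_\varphi=\lim_{n\to\infty}\frac{1}{\sum_{x\in \mathrm{Per}_n} e^{S_n\varphi(x)}}\sum_{x\in \mathrm{Per}_n} e^{S_n\varphi(x)}\delta_x$$ in the weak* topology, where $\mathrm{Per}_n=\{x\in X:\sigma^n(x)=x\}$.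
   Context: A subshift is a closed $\sigma$-invariant $X\subset A^{\mathbb N}$, with shift $\sigma(x)_n=x_{n+1}$. Its language $\mathcal L$ is the set of finite words (including the empty word) appearing in $X$; $\mathcal L_n$ is the set of words of length $n$, $|w|$ is the length of $w$, and $[w]=\{x\in X: x_1\cdots x_{|w|}=w\}$. For $\mathcal D\subset\mathcal L$, $\mathcal D_n=\mathcal D\cap\mathcal L_n$. For collections $\mathcal C,\mathcal D$ of words, $\mathcal C\mathcal D=\{vw\in\mathcal L: v\in\mathcal C,w\in\mathcal D\}$ (similarly for three collections). Given $\mathcal C^p,\mathcal G,\mathcal C^s$, for $M\in\mathbb N$, $$\mathcal G(M)=\{uvw\in\mathcal L:u\in\mathcal C^p,\ v\in\mathcal G,\ w\in\mathcal C^s,\ |u|\le M,\ |w|\le M\}.$$ For $\varphi\in C(X)$: $S_n\varphi(x)=\sum_{k=0}^{n-1}\varphi(\sigma^kx)$, $\varphi_n(w)=\sup_{x\in[w]}S_n\varphi(x)$ for $w\in\mathcal L_n$, $\Lambda_n(\mathcal D,\varphi)=\sum_{w\in\mathcal D_n}e^{\varphi_n(w)}$, and $P(\varphi)=\limsup_n\frac1n\log\Lambda_n(\mathcal L,\varphi)$ (topological pressure). An equilibrium state for $\varphi$ is a $\sigma$-invariant Borel probability measure attaining $\sup_\mu\{h(\mu)+\int\varphi\,d\mu\}=P(\varphi)$. Bowen property on $\mathcal G\subset\mathcal L$: $\sup_n\sup\{|S_n\varphi(x)-S_n\varphi(y)|: x,y\in[w],w\in\mathcal G_n\}<\infty$.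 (S)-specification on $\mathcal H\subset\mathcal L$: there is $t\in\mathbb N$ (gap size, which may depend on $\mathcal H$) such that for all $m\in\mathbb N$ and $w^1,\dots,w^m\in\mathcal H$ there are $v^1,\dots,v^{m-1}\in\mathcal L$, each of length exactly $t$, with $x:=w^1v^1w^2v^2\cdots v^{m-1}w^m\in\mathcal L$. (Per)-specification on $\mathcal H$: (S)-specification holds and in addition the cylinder $[x]$ contains a periodic point of period exactly $|x|+t$ (i.e. a point fixed by $\sigma^{|x|+t}$). *)

(* Defs.v *)
From HB Require Import structures.
From mathcomp Require Import all_boot all_order all_algebra.
From mathcomp Require Import all_classical all_reals all_analysis.

Set Implicit Arguments.
Unset Strict Implicit.
Unset Printing Implicit Defensive.

Import Order.TTheory GRing.Theory Num.Theory.
Import numFieldNormedType.Exports.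

Local Open Scope classical_set_scope.
Local Open Scope ring_scope.

(* Measurable types are pointed in the library, so the alphabet comes with a
   point; this loses nothing, since subshifts are nonempty below. *)
#[short(type="alphabetType")]
HB.structure Definition Alphabet := {A of Finite A & Pointed A}.

Definition fullshift (A : alphabetType) : Type :=
  prod_topology (fun _ : nat => discrete_topology A).

HB.instance Definition _ (A : alphabetType) := Pointed.on (fullshift A).
HB.instance Definition _ (A : alphabetType) := Topological.on (fullshift A).
HB.instance Definition _ (A : alphabetType) := Uniform.on (fullshift A).

Definition borel_shift (A : alphabetType) :=
  g_sigma_algebraType (@open (fullshift A)).

Section Subshifts.
Variable A : alphabetType.
Implicit Types (x y : fullshift A) (u v w : seq A).

(* Sequences are indexed from 0, so that x_1 ... x_n is mkseq x n. *)
Definition sigma x : fullshift A := fun n => x n.+1.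

Definition subshift (X : set (fullshift A)) :=
  [/\ X !=set0, closed X & sigma @` X `<=` X].

Variable X : set (fullshift A).

Definition language : set (seq A) :=
  [set w | exists x k, X x /\ mkseq (iter k sigma x) (size w) = w].

Definition cylinder w : set (fullshift A) :=
  [set x | X x /\ mkseq x (size w) = w].

Definition of_length (D : set (seq A)) (n : nat) : set (seq A) :=
  [set w | D w /\ size w = n].

Definition concat3 (C D E : set (seq A)) : set (seq A) :=
  [set z | language z /\
    exists u v w, [/\ C u, D v, E w & z = u ++ v ++ w]].

Definition enlarge (Cp G Cs : set (seq A)) (M : nat) : set (seq A) :=
  concat3 [set u | Cp u /\ (size u <= M)%N] G
          [set w | Cs w /\ (size w <= M)%N].

(* For vs = [:: v1; ...] and ws = [:: w2; ...] of the same size, this is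
   w1 v1 w2 v2 ... v(m-1) wm with m = (size ws).+1. *)
Definition glue (w1 : seq A) (vs ws : seq (seq A)) : seq A :=
  w1 ++ flatten [seq p.1 ++ p.2 | p <- zip vs ws].

Definition gluing (t : nat) (w1 : seq A) (vs ws : seq (seq A)) :=
  [/\ size vs = size ws,
      forall v, v \in vs -> language v /\ size v = t
    & language (glue w1 vs ws)].

Definition S_specification (H : set (seq A)) :=
  exists t : nat, forall (w1 : seq A) (ws : seq (seq A)),
    H w1 -> (forall w, w \in ws -> H w) ->
    exists vs, gluing t w1 vs ws.

Definition Per_specification (H : set (seq A)) :=
  exists t : nat, forall (w1 : seq A) (ws : seq (seq A)),
    H w1 -> (forall w, w \in ws -> H w) ->
    exists vs, gluing t w1 vs ws /\
      exists y, cylinder (glue w1 vs ws) y /\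
        iter (size (glue w1 vs ws) + t) sigma y = y.

Definition Per (n : nat) : set (fullshift A) :=
  [set x | X x /\ iter n sigma x = x].

End Subshifts.

Section Thermodynamics.
Variables (R : realType) (A : alphabetType) (X : set (fullshift A)).
Variable phi : fullshift A -> R.
Implicit Types mu : probability (borel_shift A) R.

Definition birkhoff (n : nat) (x : fullshift A) : R :=
  \sum_(k < n) phi (iter k (@sigma A) x).

Definition word_sup (w : seq A) : R :=
  sup [set birkhoff (size w) x | x in cylinder X w].

Definition Lambda (D : set (seq A)) (n : nat) : R :=
  \sum_(w : n.-tuple A | tval w \in D) expR (word_sup w).

(* limn_sup takes values in R; the sequence is bounded for a subshift X and phi
   continuous on X. *)
Definition pressure : R :=
  limn_sup (fun n => n%:R^-1 * ln (Lambda (language X) n)).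

Definition Bowen_property (G : set (seq A)) :=
  exists V : R, forall n w x y, of_length G n w ->
    cylinder X w x -> cylinder X w y ->
    `|birkhoff n x - birkhoff n y| <= V.

(* A probability measure on X is one on the full shift giving mass 1 to X. *)
Definition invariant_probability : set (probability (borel_shift A) R) :=
  [set mu | mu X = 1%E /\
    forall B : set (borel_shift A), measurable B -> mu (@sigma A @^-1` B) = mu B].

(* A map xi to 'I_k stands for the partition into its fibres; the cell of w
   is the element of the joined partition with itinerary w. *)
Definition measurable_partition k (xi : borel_shift A -> 'I_k) :=
  forall j, measurable (xi @^-1` [set j]).

Definition join_cell k (xi : borel_shift A -> 'I_k) n (w : n.-tuple 'I_k) :
    set (borel_shift A) :=
  [set x | forall i : 'I_n, xi (iter i (@sigma A) x) = tnth w i].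

(* 0 * ln 0 = 0 here. *)
Definition partition_entropy mu k (xi : borel_shift A -> 'I_k) (n : nat) : R :=
  - \sum_(w : n.-tuple 'I_k)
      fine (mu (join_cell xi w)) * ln (fine (mu (join_cell xi w))).

(* The limit exists for invariant mu, by subadditivity. *)
Definition entropy_rate mu k (xi : borel_shift A -> 'I_k) : R :=
  limn (fun n => n%:R^-1 * partition_entropy mu xi n : R).

(* Kolmogorov--Sinai entropy *)
Definition entropy mu : \bar R :=
  ereal_sup [set h | exists k (xi : borel_shift A -> 'I_k),
    measurable_partition xi /\ h = (entropy_rate mu xi)%:E].

Definition free_energy mu : \bar R :=
  (entropy mu + \int[mu]_(x in X) (phi x)%:E)%E.

Definition equilibrium_state mu :=
  [/\ invariant_probability mu,
      free_energy mu = ereal_sup [set free_energy nu | nu in invariant_probability]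
    & ereal_sup [set free_energy nu | nu in invariant_probability]
        = pressure%:E].

Definition weak_Gibbs (GM : nat -> set (seq A)) mu :=
  exists (K' : R) (K : nat -> R),
    [/\ 0 < K', forall M, 0 < K M
      & forall M n w, of_length (GM M) n w ->
          K M <= fine (mu (cylinder X w))
                 / expR (- n%:R * pressure + word_sup w) <= K'].

(* Per X n is finite for 0 < n; n = 0 and an empty Per X n give junk values. *)
Definition periodic_measure (n : nat) (B : set (borel_shift A)) : \bar R :=
  (((\sum_(x \in Per X n) expR (birkhoff n x))^-1)%:E *
   \sum_(x \in Per X n)
     ((expR (birkhoff n x))%:E * @dirac _ (borel_shift A) x R B))%E.

Definition weak_star_cvg (nu : nat -> set (borel_shift A) -> \bar R) mu :=
  forall f : fullshift A -> R, {within X, continuous f} ->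
    (fun n => \int[nu n]_(x in X) (f x)%:E)%E @ \oo
      --> (\int[mu]_(x in X) (f x)%:E)%E.

End Thermodynamics.

(* Main.v *)
Require Import Defs.
From HB Require Import structures.
From mathcomp Require Import all_boot all_order all_algebra.
From mathcomp Require Import all_classical all_reals all_analysis.
From mathcomp Require Import ring lra zify.

(** Let [P] be the pressure and write [g L w] for the weight [expR (word_sup w)]
    of a word [w] of the language, so that the partition function [Lambda] is a
    sum of weights, [wsum n (g L)]. By subadditivity it is at least
    [expR (n P)]. Everything follows from the converse bounds.

    Counting. Gluing many words of [G] bounds the partition function of [G] by
    a constant times [expR (n P)] ([Lambda_G_le]); as the weights of the prefixes
    and suffixes are summable, the same holds for the whole language
    ([Lambda_le]), and the words outside [GM M], the set [enlarge Cp G Cs M],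
    carry a fraction that tends to 0 uniformly in [n] ([Lambda_enlargeC_le]). So
    there are enough words in some [GM N] to fill the space around two given
    words of [GM M] when these are glued at prescribed places ([glue_two]).

    Existence. Draw a word of length [n] with probability proportional to its
    weight and average over the places in it: a limit of these frequencies is an
    invariant measure [mu] with the upper Gibbs bound for all words and a gluing
    inequality for words of [GM M] ([Gibbs_measure]). Gluing to the empty word
    gives the lower Gibbs bound. Measures are built from cylinder masses, by an
    extension theorem ([measure_of_consistent]), and limits are taken along
    ultrafilters ([limit_state]), which replaces weak-star compactness.

    Variational principle. The entropy of an invariant measure is computed by
    the partition into letters ([entropy_generator]). All the inequalities
    between entropies and sums of weights are then instances of the Gibbs
    inequality: no invariant measure has free energy above [P]
    ([free_energy_le]), and the upper Gibbs bound forces equality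
    ([free_energy_Gibbs]).

    Uniqueness. By the Gibbs inequality again, an equilibrium state [nu] gives
    little mass to sets of words of small total weight; with the lower Gibbs
    bound, [nu] is absolutely continuous with respect to [mu]
    ([equilibrium_dominated]). The gluing inequality shows that two sets of
    positive [mu]-measure meet after some iterate ([mixing]). Two Hahn
    decompositions then exclude [nu <> mu] ([dominated_invariant_eq]): a set
    where [nu >= c mu], with [c > 1], would meet a preimage of one where
    [nu <= mu].

    Periodic points. Specification with periodic points makes the sum over
    [Per X n] comparable to [expR (n P)] ([loop_sum_ge]). Hence the weighted
    averages over [Per X n] satisfy the upper Gibbs bound in the limit, so that
    each of their limits is an equilibrium state and equals [mu]
    ([loop_mass_cvg]). *)

Set Implicit Arguments.
Unset Strict Implicit.
Unset Printing Implicit Defensive.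

Import Order.TTheory GRing.Theory Num.Theory.
Import numFieldNormedType.Exports.

Local Open Scope classical_set_scope.
Local Open Scope ring_scope.

(** * Sums over words *)

Section WordSums.
Variables (R : realType) (A : finType).
Implicit Types (F H : seq A -> R) (u v w : seq A).

Definition wsum n F : R := \sum_(w : n.-tuple A) F w.

Lemma eq_wsum n F H : (forall w, size w = n -> F w = H w) ->
  wsum n F = wsum n H.
Proof. by move=> FH; apply: eq_bigr => w _; rewrite FH ?size_tuple. Qed.

Lemma le_wsum n F H : (forall w, size w = n -> F w <= H w) ->
  wsum n F <= wsum n H.
Proof. by move=> FH; apply: ler_sum => w _; rewrite FH ?size_tuple. Qed.

Lemma wsum_ge0 n F : (forall w, 0 <= F w) -> 0 <= wsum n F.
Proof. by move=> F0; apply: sumr_ge0. Qed.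

Lemma wsumD n F H : wsum n (fun w => F w + H w) = wsum n F + wsum n H.
Proof. exact: big_split. Qed.

Lemma wsumN n F : wsum n (fun w => - F w) = - wsum n F.
Proof. exact: sumrN. Qed.

Lemma wsumZ n (r : R) F : wsum n (fun w => r * F w) = r * wsum n F.
Proof. by rewrite /wsum -mulr_sumr. Qed.

Lemma wsumZr n (r : R) F : wsum n (fun w => F w * r) = wsum n F * r.
Proof. by rewrite /wsum -mulr_suml. Qed.

Lemma wsum_sum n (I : finType) (P : pred I) (F : I -> seq A -> R) :
  wsum n (fun w => \sum_(i | P i) F i w) = \sum_(i | P i) wsum n (F i).
Proof. exact: exchange_big. Qed.

Lemma wsum_split n F w : size w = n ->
  wsum n F = F w + wsum n (fun v => if v == w then 0 else F v).
Proof.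
move=> wn; rewrite /wsum; have ws : size w == n by rewrite wn.
rewrite (bigD1 (Tuple ws)) //=; congr (_ + _).
rewrite [RHS](bigD1 (Tuple ws)) //= eqxx add0r; apply: eq_bigr => v vw.
by rewrite ifN //; apply: contra vw => /eqP vw; apply/eqP/val_inj.
Qed.

Lemma le_term_wsum n F w : (forall v, 0 <= F v) -> size w = n ->
  F w <= wsum n F.
Proof.
move=> F0 /wsum_split ->; rewrite lerDl; apply: wsum_ge0 => v.
by case: ifP.
Qed.

Lemma wsum0 F : wsum 0 F = F [::].
Proof.
rewrite /wsum (bigD1 [tuple]) //= big1 ?addr0 // => w /eqP[].
exact: tuple0.
Qed.

Lemma wsumS n F : wsum n.+1 F = \sum_(a : A) wsum n (fun w => F (a :: w)).
Proof.
rewrite /wsum pair_bigA /=.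
rewrite (reindex (fun p : A * n.-tuple A => [tuple of p.1 :: p.2])) //=.
exists (fun w : n.+1.-tuple A => (thead w, [tuple of behead w])) => [[a w] _|w _] /=.
  by rewrite theadE; congr pair; apply: val_inj.
by rewrite [RHS]tuple_eta; apply: val_inj.
Qed.

Lemma wsum1 F : wsum 1 F = \sum_(a : A) F [:: a].
Proof. by rewrite wsumS; apply: eq_bigr => a _; rewrite wsum0. Qed.

Lemma wsum_cat n m F :
  wsum (n + m) F = wsum n (fun u => wsum m (fun v => F (u ++ v))).
Proof.
elim: n F => [|n IHn] F; first by rewrite wsum0.
by rewrite addSn !wsumS; apply: eq_bigr => a _; rewrite IHn.
Qed.

End WordSums.

Lemma exchange_wsum (R : realType) (A A' : finType) n m
    (F : seq A -> seq A' -> R) :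
  wsum n (fun u => wsum m (F u)) = wsum m (fun v => wsum n (F^~ v)).
Proof. exact: exchange_big. Qed.

(** * Gibbs inequality *)

(** Summing the tangent inequality [ln y <= y - 1] at [y = q i / p i], with
    weights [p i]. *)
Lemma Gibbs_inequality (R : realType) (I : finType) (p q : I -> R) :
  (forall i, 0 <= p i) -> (forall i, 0 <= q i) ->
  (forall i, 0 < p i -> 0 < q i) -> \sum_i q i <= \sum_i p i ->
  \sum_i p i * ln (q i) <= \sum_i p i * ln (p i).
Proof.
move=> p0 q0 pq qs; rewrite -subr_le0 -sumrB.
apply: (@le_trans _ _ (\sum_i (q i - p i))); last by rewrite sumrB subr_le0.
apply: ler_sum => i _; have := p0 i; rewrite le_eqVlt => /predU1P[<-|pi0].
  by rewrite !mul0r !subr0.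
have qi0 := pq _ pi0.
rewrite -mulrBr -ln_div ?posrE // -ler_pdivlMl //.
rewrite mulrBr mulVf ?gt_eqF // mulrC.
have := @le_ln1Dx R (q i / p i - 1).
rewrite addrCA subrr addr0 [(p i)^-1 * _]mulrC; apply.
by rewrite ltrBrDl subrr divr_gt0.
Qed.

(** * Fekete's lemma *)

Lemma invn_cvg0 (R : realType) : (fun n : nat => n%:R^-1 : R) @ \oo --> (0 : R).
Proof.
apply/cvgr0Pnorm_le => e e0; near=> n.
have n0 : (0 : R) < n%:R by rewrite ltr0n; near: n; exact: nbhs_infty_gt.
rewrite ger0_norm ?invr_ge0 ?ler0n // invf_ple ?posrE //.
by near: n; exact: nbhs_infty_ger.
Unshelve. all: by end_near. Qed.

Section Fekete.
Variables (R : realType) (a : nat -> R) (c : R).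
Hypothesis a_sub : forall n m, a (n + m)%N <= a n + a m.
Hypothesis a_low : forall n, c * n%:R <= a n.

Let avg n := n%:R^-1 * a n.
Let l := inf [set avg n | n in [set n | (0 < n)%N]].

Let avg_low n : (0 < n)%N -> c <= avg n.
Proof. by move=> n0; rewrite /avg mulrC ler_pdivlMr ?ltr0n. Qed.

Let has_inf_avg : has_inf [set avg n | n in [set n | (0 < n)%N]].
Proof.
split; first by exists (avg 1), 1%N.
by exists c => _ [n n0 <-]; exact: avg_low.
Qed.

Let sub_mul m q r : a (q * m + r)%N <= a m *+ q + a r.
Proof.
elim: q => [|q IH]; first by rewrite mulr0n add0r.
rewrite mulSn -addnA (le_trans (a_sub _ _)) // mulrS -addrA lerD2l; exact: IH.
Qed.

(** The limit is the infimum [l] of the averages: writing [n = q m + r] with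
    [a m / m] close to [l], subadditivity bounds [a n / n] by nearly [a m / m]. *)
Lemma Fekete : exists2 l : R, (fun n => n%:R^-1 * a n : R) @ \oo --> l &
  forall n, l * n%:R <= a n.
Proof.
have la n : (0 < n)%N -> l <= avg n.
  by move=> n0; apply: ge_inf; [case: has_inf_avg|exists n].
exists l; last first.
  case=> [|n]; last by rewrite -ler_pdivlMr ?ltr0n // mulrC; exact: la.
  by rewrite mulr0; have := a_sub 0 0; rewrite addn0; lra.
apply/cvgrPdist_le => e e0.
have [_ [m m0 <-] me] := inf_adherent (divr_gt0 e0 (ltr0n _ 2)) has_inf_avg.
rewrite -/l in me.
(* An upper bound for what the remainder [r] can add. *)
pose B := \sum_(r < m) `|a r| + m%:R * `|l|.
have B0 : 0 <= B by rewrite addr_ge0 ?sumr_ge0 ?mulr_ge0.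
near=> n.
have n0 : (0 < n)%N by near: n; exact: nbhs_infty_gt.
have Bn : B <= e / 2 * n%:R.
  rewrite mulrC -ler_pdivrMr ?divr_gt0 //.
  by near: n; exact: nbhs_infty_ger.
rewrite distrC ger0_norm ?subr_ge0 ?la // lerBlDr.
rewrite mulrC ler_pdivrMr ?ltr0n // (divn_eq n m).
apply: (le_trans (sub_mul _ _ _)).
set q := (n %/ m)%N; set r := (n %% m)%N.
have rm : (r < m)%N by rewrite ltn_mod.
have ar : a r <= \sum_(r < m) `|a r|.
  rewrite (bigD1 (Ordinal rm)) //=; apply: (le_trans (ler_norm _)).
  by rewrite lerDl sumr_ge0.
have am : a m <= m%:R * (l + e / 2).
  by move: me; rewrite /avg mulrC ltr_pdivrMr ?ltr0n // mulrC => /ltW.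
have qm : (q%:R * m%:R : R) <= n%:R by rewrite -natrM ler_nat leq_divM.
have nE : n%:R = q%:R * m%:R + r%:R :> R by rewrite -natrM -natrD -divn_eq.
rewrite -[a m *+ q]mulr_natl natrD natrM.
have h1 : q%:R * a m <= q%:R * (m%:R * (l + e / 2)) by rewrite ler_wpM2l.
have h2 : - (r%:R * l) <= m%:R * `|l|.
  apply: (@le_trans _ _ (r%:R * `|l|)).
    by rewrite -mulrN ler_wpM2l // ler_normr lexx orbT.
  by rewrite ler_wpM2r // ler_nat ltnW.
rewrite nE in Bn.
have e2 : e * r%:R / 2 >= 0 by rewrite divr_ge0 ?mulr_ge0 // ltW.
rewrite /B in Bn.
have qmr : 0 <= e / 2 * r%:R by rewrite mulr_ge0 // ltW // divr_gt0.
nra.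
Unshelve. all: by end_near. Qed.

End Fekete.

(** * Cylinders and the topology of the full shift *)

Section Cylinders.
Variable A : alphabetType.
Implicit Types (x y : fullshift A) (u v w : seq A).

Definition cyl w : set (fullshift A) := [set x | mkseq x (size w) = w].

Definition ext w : fullshift A := nth point w.

(** The sets with this property for some [n] are the clopen ones. *)
Definition determined (n : nat) (C : set (fullshift A)) :=
  forall x y, mkseq x n = mkseq y n -> C x -> C y.

Lemma eq_mkseqP x y n : mkseq x n = mkseq y n <-> forall i, (i < n)%N -> x i = y i.
Proof.
split=> [xy i ni|xy].
  by have := congr1 (nth point ^~ i) xy; rewrite !nth_mkseq.
apply: (@eq_from_nth _ point); rewrite !size_mkseq // => i ni.
by rewrite !nth_mkseq // xy.
Qed.

Lemma iter_sigmaE k x i : iter k (@sigma A) x i = x (k + i)%N.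
Proof. by elim: k i => //= k IH i; rewrite /sigma IH addnS. Qed.

Lemma mkseq_cat x n m :
  mkseq x (n + m) = mkseq x n ++ mkseq (iter n (@sigma A) x) m.
Proof.
apply: (@eq_from_nth _ point) => [|i]; first by rewrite size_cat !size_mkseq.
rewrite size_mkseq => inm; rewrite nth_cat size_mkseq nth_mkseq //.
case: ltnP => ni; first by rewrite nth_mkseq.
by rewrite nth_mkseq ?iter_sigmaE ?subnKC // ltn_subLR.
Qed.

Lemma mkseq_take x n m : (n <= m)%N -> take n (mkseq x m) = mkseq x n.
Proof.
by move=> /subnKC <-; rewrite mkseq_cat take_cat size_mkseq ltnn subnn take0 cats0.
Qed.

Lemma mkseq_sub x y n m : (n <= m)%N -> mkseq x m = mkseq y m ->
  mkseq x n = mkseq y n.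
Proof. by move=> nm /(congr1 (take n)); rewrite !mkseq_take. Qed.

Lemma mkseq_ext w : mkseq (ext w) (size w) = w.
Proof. exact: mkseq_nth. Qed.

Lemma mkseq_ext_n w n : size w = n -> mkseq (ext w) n = w.
Proof. by move=> <-; exact: mkseq_ext. Qed.

Lemma cyl_cat u v x : cyl (u ++ v) x <-> cyl u x /\ cyl v (iter (size u) (@sigma A) x).
Proof.
rewrite /cyl /= size_cat mkseq_cat; split=> [/eqP|[-> ->//]].
by rewrite eqseq_cat ?size_mkseq // => /andP[/eqP -> /eqP ->].
Qed.

Lemma cyl_cons a w x : cyl (a :: w) x <-> x 0%N = a /\ cyl w (sigma x).
Proof.
rewrite -cat1s cyl_cat /=; split=> -[h1 h2]; split => //; first by case: h1.
by rewrite /cyl /= /mkseq /= h1.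
Qed.

Lemma cyl_mkseq x n : cyl (mkseq x n) x.
Proof. by rewrite /cyl /= size_mkseq. Qed.

Lemma determinedW n m C : (n <= m)%N -> determined n C -> determined m C.
Proof. by move=> nm Cn x y /(mkseq_sub nm); exact: Cn. Qed.

Lemma determined_ext n C x : determined n C -> C x <-> C (ext (mkseq x n)).
Proof. by move=> Cn; split; apply: Cn; rewrite mkseq_ext_n ?size_mkseq. Qed.

Lemma determined_cyl w : determined (size w) (cyl w).
Proof. by move=> x y xy; rewrite /cyl /= xy. Qed.

Lemma determinedC n C : determined n C -> determined n (~` C).
Proof. by move=> Cn x y xy; apply: contra_not; exact: Cn. Qed.

Lemma determinedU n C D : determined n C -> determined n D ->
  determined n (C `|` D).
Proof. by move=> Cn Dn x y xy [/(Cn _ _ xy)|/(Dn _ _ xy)]; [left|right]. Qed.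

Lemma determinedI n C D : determined n C -> determined n D ->
  determined n (C `&` D).
Proof. by move=> Cn Dn x y xy [/(Cn _ _ xy) ? /(Dn _ _ xy)]. Qed.

Lemma determined_preimage k n C : determined n C ->
  determined (k + n) (iter k (@sigma A) @^-1` C).
Proof.
move=> Cn x y; rewrite !mkseq_cat => /eqP.
by rewrite eqseq_cat ?size_mkseq // => /andP[_ /eqP]; exact: Cn.
Qed.

Lemma near_mkseq x n : \forall y \near x, mkseq y n = mkseq x n.
Proof.
suff h : \forall y \near x, forall i, (i < n)%N -> y i = x i.
  by apply: filterS h => y; rewrite eq_mkseqP.
elim: n => [|n IH]; first exact: filterE.
have hn : \forall y \near x, y n = x n.
  have := @proj_continuous nat (fun _ => discrete_topology A) n x.
  move=> cn; have /cn : nbhs (proj n x) [set a : discrete_topology A | a = x n].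
    apply: open_nbhs_nbhs; split => //.
    exact: discrete_open.
  by [].
near=> y => i; rewrite ltnS leq_eqVlt => /predU1P[->|].
  by near: y.
by move: i; near: y.
Unshelve. all: by end_near. Qed.

Lemma determined_open n C : determined n C -> open C.
Proof.
move=> Cn; rewrite openE => x Cx; rewrite /interior.
by apply: filterS (near_mkseq x n) => y /esym xy; exact: Cn xy Cx.
Qed.

Lemma determined_closed n C : determined n C -> closed C.
Proof. by move=> /determinedC /determined_open; rewrite openC. Qed.

Lemma compact_fullshift : compact [set: fullshift A].
Proof.
have := @tychonoff nat (fun _ => discrete_topology A) (fun _ => setT).
rewrite (_ : [set f | forall i, setT (f i)] = setT); last by apply/seteqP; split.
by apply=> i; apply: finite_compact; exact: (@finite_finset A setT).
Qed.

(** Koenig's lemma: the sets of the [x] with [P n x] form an increasing cover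
    of the compact [X] by clopen sets. *)
Lemma compact_prefix (X : set (fullshift A)) (P : nat -> fullshift A -> Prop) :
  closed X -> (forall n x y, mkseq x n = mkseq y n -> P n x -> P n y) ->
  (forall n x, P n x -> P n.+1 x) ->
  (forall x, X x -> exists n, P n x) -> exists n, forall x, X x -> P n x.
Proof.
move=> clX Pdet PS Pex.
have Pmono n m x : (n <= m)%N -> P n x -> P m x.
  by move=> /subnKC <-; elim: (m - n)%N => [|k IH]; rewrite ?addn0 // addnS => /IH /PS.
have cX : compact X by apply: subclosed_compact clX compact_fullshift _.
have /compact_near_coveringP/(_ nat \oo P _) cov := cX.
have /cov : forall x, X x -> \forall x' \near x & i \near \oo, P i x'.
  move=> x /Pex[n Pn].
  exists ([set y | mkseq y n = mkseq x n], [set i | (n <= i)%N]) => /=.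
    by split; [exact: near_mkseq|exact: nbhs_infty_ge].
  by move=> [y i] /= [yx ni]; apply: Pmono ni _; apply: Pdet Pn.
by move=> [N _ /(_ N (leqnn N)) h]; exists N.
Qed.

(** The complement of an open set containing [x] is compact, and none of its
    points has all prefixes in common with [x]. *)
Lemma nbhs_cyl x (U : set (fullshift A)) : nbhs x U ->
  exists n, forall y, mkseq y n = mkseq x n -> U y.
Proof.
move=> xU.
have [V [oV Vx] VU] : exists2 V, open V /\ V x & V `<=` U.
  by move: xU; rewrite nbhsE => -[V [? ?] ?]; exists V.
have [||||n nU] := @compact_prefix (~` V) (fun n y => mkseq y n <> mkseq x n).
- exact: open_closedC.
- by move=> n y z ->.
- by move=> n y yx; apply: contra_not yx; exact: mkseq_sub.
- move=> y Vy; apply: contrapT => /forallNP h; apply: Vy.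
  suff -> : y = x by [].
  apply/funext => i; have /contrapT/eq_mkseqP := h i.+1; exact.
exists n => y yx; apply: VU; apply: contrapT => /nU; exact.
Qed.

Lemma sigma_continuous : continuous (@sigma A).
Proof.
move=> x U /nbhs_cyl[n nU]; apply: filterS (near_mkseq x n.+1) => y.
by rewrite -add1n !mkseq_cat => -[_ h]; exact: nU.
Qed.

Lemma open_bigcup_cyl (U : set (fullshift A)) : open U ->
  U = \bigcup_n [set x | forall y, mkseq y n = mkseq x n -> U y].
Proof.
rewrite openE => oU; apply/seteqP; split=> [x /oU /nbhs_cyl[n nU]|x [n _ nU]].
  by exists n.
exact: nU.
Qed.

(** Heine's theorem: a closed [X] is compact, and having a common prefix of
    length [n] is the typical entourage. *)
Lemma unif_continuous (R : realType) (X : set (fullshift A))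
    (f : fullshift A -> R) (e : R) :
  closed X -> {within X, continuous f} -> 0 < e ->
  exists n, forall x y, X x -> X y -> mkseq x n = mkseq y n -> `|f x - f y| <= e.
Proof.
move=> clX fc e0.
pose P n x := forall y z, X y -> X z -> mkseq y n = mkseq x n ->
  mkseq z n = mkseq x n -> `|f y - f z| <= e.
have [||||n nP] := @compact_prefix X P => //.
- by move=> n x y xy Px u v Xu Xv uy vy; apply: Px; rewrite // xy.
- move=> n x Px u v Xu Xv ux vx; apply: Px => //.
    by apply: mkseq_sub ux.
  by apply: mkseq_sub vx.
- move=> x Xx.
  have e2 : 0 < e / 2 by rewrite divr_gt0.
  have /subspace_continuousP/(_ x Xx)/cvgrPdist_le/(_ _ e2) h := fc.
  have [n hn] := nbhs_cyl h; exists n => u v Xu Xv ux vx.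
  have hu := hn u ux Xu; have hv := hn v vx Xv.
  rewrite (_ : f u - f v = (f x - f v) - (f x - f u)); last by ring.
  rewrite (le_trans (ler_normB _ _)) // (splitr e) lerD //.
by exists n => x y Xx Xy xy; apply: (nP x) => //.
Qed.

Lemma step_approximation (R : realType) (X : set (fullshift A))
    (f : fullshift A -> R) (e : R) : closed X -> {within X, continuous f} -> 0 < e ->
  exists n (a : seq A -> R), forall x, X x -> `|f x - a (mkseq x n)| <= e.
Proof.
move=> clX fc e0; have [n hn] := unif_continuous clX fc e0.
exists n, (fun u => f (xget (ext u) [set x | X x /\ cyl u x])) => x Xx.
have [Xy yx] : [set y | X y /\ cyl (mkseq x n) y]
    (xget (ext (mkseq x n)) [set y | X y /\ cyl (mkseq x n) y]).
  by apply: xgetPex; exists x; split => //; exact: cyl_mkseq.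
by apply: hn => //; move: yx; rewrite /cyl /= size_mkseq.
Qed.

Lemma bounded_continuous (R : realType) (X : set (fullshift A))
    (f : fullshift A -> R) : closed X -> {within X, continuous f} ->
  exists B : R, forall x, X x -> `|f x| <= B.
Proof.
move=> clX fc; have [n [a fa]] := step_approximation clX fc ltr01.
exists (wsum n (fun w => `|a w|) + 1) => x Xx.
have := @le_term_wsum _ _ n (fun w => `|a w|) (mkseq x n) (fun _ => normr_ge0 _).
rewrite size_mkseq => /(_ erefl); have := fa x Xx.
have := ler_normD (f x - a (mkseq x n)) (a (mkseq x n)); rewrite subrK; lra.
Qed.

End Cylinders.

(** * Borel measures on the full shift *)

Section BorelSets.
Variables (R : realType) (A : alphabetType).
Implicit Types (B C D : set (borel_shift A)).

Lemma open_measurable_shift (U : set (fullshift A)) :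
  open U -> measurable (U : set (borel_shift A)).
Proof. by move=> oU; apply: sub_sigma_algebra. Qed.

Lemma closed_measurable_shift (U : set (fullshift A)) :
  closed U -> measurable (U : set (borel_shift A)).
Proof.
move=> cU; rewrite -[X in measurable X]setCK; apply: measurableC.
by apply: open_measurable_shift; exact: closed_openC.
Qed.

Lemma determined_measurable n (C : set (fullshift A)) :
  determined n C -> measurable (C : set (borel_shift A)).
Proof. by move=> /determined_open /open_measurable_shift. Qed.

Lemma measurable_cyl (w : seq A) : measurable (cyl w : set (borel_shift A)).
Proof. exact: determined_measurable (@determined_cyl A w). Qed.
Hint Resolve measurable_cyl : core.

Lemma measurable_sigma : measurable_fun setT (@sigma A : borel_shift A -> borel_shift A).
Proof.
apply: (@measurability _ _ (borel_shift A) (borel_shift A) setT _ (@open (fullshift A))) => //.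
move=> _ [U oU <-]; rewrite setTI; apply: open_measurable_shift.
by apply: open_comp oU => x _; exact: sigma_continuous.
Qed.

Lemma measurable_iter_sigma k :
  measurable_fun setT (iter k (@sigma A) : borel_shift A -> borel_shift A).
Proof.
elim: k => [|k IH]; first exact: measurable_id.
have := measurableT_comp measurable_sigma IH; exact.
Qed.

Section Approximation.
Variable mu : {measure set (borel_shift A) -> \bar R}.
Hypothesis mu_fin : (mu setT < +oo)%E.

Let approx B := forall e : R, 0 < e -> exists n C,
  determined n C /\ (mu (B `+` C) < e%:E)%E.

Let mu_le B C : measurable B -> measurable C -> B `<=` C -> (mu B <= mu C)%E.
Proof. by move=> mB mC BC; apply: le_measure; rewrite ?inE. Qed.

Let msd B C : measurable B -> measurable C -> measurable (B `+` C).
Proof. by move=> mB mC; apply: measurableU; apply: measurableD. Qed.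

Let approxC B : approx B -> approx (~` B).
Proof.
move=> aB e /aB [n [C [Cn h]]]; exists n, (~` C); split; first exact: determinedC.
suff -> : ~` B `+` ~` C = B `+` C by [].
by rewrite /setY !setDE !setCK [X in X `|` _]setIC [X in _ `|` X]setIC setUC.
Qed.

Let approxU B D : measurable B -> measurable D -> approx B -> approx D ->
  approx (B `|` D).
Proof.
move=> mB mD aB aD e e0; have e2 : 0 < e / 2 by rewrite divr_gt0.
have [n [C [Cn hC]]] := aB _ e2; have [m [E [Em hE]]] := aD _ e2.
exists (maxn n m), (C `|` E); split.
  by apply: determinedU; [apply: determinedW Cn|apply: determinedW Em];
    rewrite ?leq_maxl ?leq_maxr.
have mC := determined_measurable Cn; have mE := determined_measurable Em.
apply: (@le_lt_trans _ _ (mu ((B `+` C) `|` (D `+` E)))).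
  apply: mu_le; [by apply: msd; apply: measurableU|by apply: measurableU; apply: msd|].
  move=> x [[[Bx|Dx] /not_orP[nC nE]]|[[Cx|Ex] /not_orP[nB nD]]].
  - by left; left.
  - by right; left.
  - by left; right.
  - by right; right.
apply: (le_lt_trans (measureU2 _ _ _)); [exact: msd|exact: msd|].
by rewrite (splitr e) EFinD; exact: lteD.
Qed.

Let approx_bigcup (F : nat -> set (borel_shift A)) :
  (forall i, measurable (F i)) -> (forall i, F i `<=` F i.+1) ->
  (forall i, approx (F i)) -> approx (\bigcup_i F i).
Proof.
move=> mF FS aF e e0; have e2 : 0 < e / 2 by rewrite divr_gt0.
set D := \bigcup_i F i.
have mD : measurable D by apply: bigcup_measurable.
have FD i : F i `<=` D by move=> x; exists i.
have c0 : mu \o (fun i => D `\` F i) @ \oo --> mu set0.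
  have <- : \bigcap_i (D `\` F i) = set0.
    apply/seteqP; split=> // x h; have [[i _ Fx] _] := h 0%N I.
    by have [_ ] := h i I.
  apply: nonincreasing_cvg_mu.
  - by apply: le_lt_trans mu_fin; apply: mu_le => //; exact: measurableD.
  - by move=> i; exact: measurableD.
  - by apply: bigcap_measurable => [|i _]; [exists 0%N|exact: measurableD].
  - apply/nonincreasing_seqP => i; apply/subsetPset.
    by apply: setDS; exact: FS.
rewrite measure0 in c0.
have [N _ /(_ N (leqnn N)) hN] : \forall i \near \oo, (mu (D `\` F i) < (e / 2)%:E)%E.
  have := c0 [set y | (y < (e / 2)%:E)%E]; apply.
  apply: open_nbhs_nbhs; split; last by rewrite /= lte_fin.
  exact: open_ereal_lt_ereal.
have [n [C [Cn hC]]] := aF N _ e2.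
have mC := determined_measurable Cn.
exists n, C; split => //.
apply: (@le_lt_trans _ _ (mu ((D `\` F N) `|` (F N `+` C)))).
  apply: mu_le; [exact: msd|apply: measurableU; [exact: measurableD|exact: msd]|].
  move=> x [[Dx nCx]|[Cx nDx]].
    have [Fx|nFx] := pselect (F N x); first by right; left.
    by left.
  by right; right; split=> // /FD.
apply: (le_lt_trans (measureU2 _ _ _)); [exact: measurableD|exact: msd|].
by rewrite (splitr e) EFinD; exact: lteD.
Qed.

(** The measurable sets that are approximable form a sigma-algebra, and open
    sets are increasing unions of clopen ones. *)
Lemma clopen_approximation B (e : R) : measurable B -> 0 < e -> exists n C,
  determined n C /\ (mu (B `+` C) < e%:E)%E.
Proof.
move=> mB; move: e; suff : (measurable B /\ approx B) by case.
have approx_det n C : determined n C -> approx C.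
  by move=> Cn e e0; exists n, C; rewrite setYK measure0 lte_fin.
move: B mB; apply: smallest_sub; last first.
  move=> U oU; split; first exact: open_measurable_shift.
  have Un n : determined n [set x | forall y, mkseq y n = mkseq x n -> U y].
    by move=> x y xy h z zy; apply: h; rewrite zy.
  rewrite (open_bigcup_cyl oU); apply: approx_bigcup => [i|i x h y yx|i].
  - exact: determined_measurable (Un i).
  - by apply: h; apply: mkseq_sub yx.
  - exact: approx_det (Un i).
split.
- split => //; apply: (@approx_det 0%N) => x y _; exact.
- by move=> B [mB aB]; rewrite setTD; split; [exact: measurableC|exact: approxC].
- move=> F mF; split; first by apply: bigcup_measurable => i _; case: (mF i).
  rewrite -bigcup_bigsetU_bigcup.
  have mS n : measurable (\big[setU/set0]_(i < n) F i : set (borel_shift A)).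
    by apply: bigsetU_measurable => i _; case: (mF i).
  apply: approx_bigcup => [i|i|i] //.
    by rewrite [X in _ `<=` X]big_ord_recr /=; exact: subsetUl.
  elim: i.+1 => [|n IH].
    by rewrite big_ord0; apply: (@approx_det 0%N) => x y _; exact.
  rewrite big_ord_recr /=; have [mFn aFn] := mF n.
  exact: (approxU (mS n) mFn IH aFn).
Qed.

End Approximation.

Definition cylinder_mass (mu : {measure set (borel_shift A) -> \bar R}) (w : seq A) : R :=
  fine (mu (cyl w)).

Section Mass.
Variable mu : probability (borel_shift A) R.
Local Notation m := (cylinder_mass mu).

Lemma cylinder_massE w : mu (cyl w) = (m w)%:E.
Proof. by rewrite /cylinder_mass fineK // fin_num_measure. Qed.

Lemma cylinder_mass_ge0 w : 0 <= m w.
Proof. exact: fine_ge0. Qed.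

Lemma measure_sub_setU B C D : measurable B -> measurable C -> measurable D ->
  B `<=` C `|` D -> fine (mu B) <= fine (mu C) + fine (mu D).
Proof.
move=> mB mC mD BCD; rewrite -fineD ?fin_num_measure //.
rewrite fine_le ?fin_numD ?fin_num_measure //.
apply: (@le_trans _ _ (mu (C `|` D))); last exact: measureU2.
by apply: le_measure; rewrite ?inE //; exact: measurableU.
Qed.

(** Stated with [fine] because all later computations with masses take place
    in [R]. *)
Lemma measure_fibers (J : finType) (xi : borel_shift A -> J) B :
  (forall j, measurable (xi @^-1` [set j])) -> measurable B ->
  fine (mu B) = \sum_j fine (mu (B `&` xi @^-1` [set j])).
Proof.
move=> mxi mB.
have mI j : measurable (B `&` xi @^-1` [set j]) by exact: measurableI.
apply: EFin_inj; rewrite fineK ?fin_num_measure // -sumEFin.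
under eq_bigr do rewrite fineK ?fin_num_measure //.
transitivity (mu (\bigcup_(j in [set: J]) (B `&` xi @^-1` [set j]))).
  by congr (mu _); apply/seteqP; split=> [x Bx|x [j _ [Bx _]]//]; exists (xi x).
rewrite measure_fin_bigcup //.
- rewrite (fsbigE (index_enum J)) ?index_enum_uniq //.
    by apply: eq_bigl => i; rewrite in_setT.
  by move=> i _; rewrite mem_index_enum.
- exact: finite_finset.
- by move=> i j _ _ [x [[_ <-] [_ <-]]].
Qed.

Lemma measure_cyl_fibers n B : measurable B ->
  fine (mu B) = wsum n (fun w => fine (mu (B `&` cyl w))).
Proof.
move=> mB; pose xi x : n.-tuple A := [tuple of mkseq x n].
have xiE (w : n.-tuple A) : xi @^-1` [set w] = cyl w.
  apply/seteqP; split=> x; rewrite /cyl /= size_tuple; first by move=> <-.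
  by move=> xw; apply/val_inj.
rewrite (@measure_fibers _ xi) //; last by move=> w; rewrite xiE.
by apply: eq_bigr => w _; rewrite xiE.
Qed.

Lemma measure_determined n C : determined n C ->
  fine (mu C) = wsum n (fun w => if `[< C (ext w) >] then m w else 0).
Proof.
move=> Cn; rewrite (measure_cyl_fibers n); last exact: determined_measurable Cn.
apply: eq_wsum => w wn; case: asboolP => Cw.
  congr (fine (mu _)); apply/seteqP; split=> [x []//|x xw]; split => //.
  by apply: Cn Cw; rewrite mkseq_ext_n // -wn; exact/esym/xw.
rewrite (_ : _ `&` _ = set0) ?measure0 //; apply/seteqP; split=> // x [Cx xw].
by apply: Cw; apply: Cn Cx; rewrite mkseq_ext_n // -wn; exact: xw.
Qed.

Lemma wsum_cylinder_mass n : wsum n m = 1.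
Proof.
transitivity (fine (mu setT)); last by rewrite probability_setT.
rewrite (@measure_determined n setT) //.
by apply: eq_wsum => w _; rewrite asboolT.
Qed.

Lemma cylinder_mass_cat w n : wsum n (fun v => m (w ++ v)) = m w.
Proof.
rewrite [RHS](@measure_determined (size w + n)%N); last first.
  by apply: determinedW (@determined_cyl A w); exact: leq_addr.
rewrite wsum_cat (wsum_split _ (erefl (size w))) [X in _ + X]big1 => [|u _]; last first.
  case: eqP => // uw; apply: big1 => v _; rewrite asboolF // => h; apply: uw.
  have /cyl_cat[+ _] : cyl (u ++ v) (ext (u ++ v)) := mkseq_ext _.
  by rewrite /cyl /= size_tuple => hu; exact: etrans (esym hu) h.
rewrite addr0; apply: eq_wsum => v vn; rewrite asboolT //.
by have := mkseq_ext (w ++ v); rewrite -/(cyl (w ++ v) _) => /cyl_cat[].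
Qed.

End Mass.

Section Invariance.
Variable mu : probability (borel_shift A) R.
Hypothesis mu_inv : forall B, measurable B -> mu (@sigma A @^-1` B) = mu B.
Local Notation m := (cylinder_mass mu).

Lemma invariant_iter k B : measurable B -> mu (iter k (@sigma A) @^-1` B) = mu B.
Proof.
move=> mB; elim: k => [|k IH] //; rewrite -IH -[RHS]mu_inv; last first.
  by have := measurable_iter_sigma k measurableT mB; rewrite setTI.
by congr (mu _); apply/funext => x; rewrite /preimage /mkset iterSr.
Qed.

End Invariance.

(** Approximating with respect to [mu + nu] serves both measures at once. *)
Lemma measure_ext_cyl (mu nu : probability (borel_shift A) R) :
  (forall w, mu (cyl w) = nu (cyl w)) ->
  forall B, measurable B -> mu B = nu B.
Proof.
move=> mn B mB.
have mn' n C : determined n C -> mu C = nu C.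
  move=> Cn; have mC := determined_measurable Cn.
  rewrite -[LHS]fineK ?fin_num_measure // -[RHS]fineK ?fin_num_measure //.
  congr (_%:E); rewrite !(measure_determined _ Cn).
  apply: eq_wsum => w _; case: ifP => // _; congr fine; exact: mn.
have fin : (measure_add mu nu setT < +oo)%E.
  rewrite measure_addE; apply: lte_add_pinfty.
    by rewrite ltey_eq fin_num_measure.
  by rewrite ltey_eq fin_num_measure.
apply/eqP; rewrite -[mu B]fineK ?fin_num_measure // -[nu B]fineK ?fin_num_measure //.
rewrite eqe -subr_eq0 -normr_le0; apply/ler_addgt0Pl => e e0; rewrite addr0.
have [n [C [Cn]]] := clopen_approximation fin mB e0.
have mC := determined_measurable Cn.
have mBC : measurable (B `+` C) by apply: measurableU; apply: measurableD.
move=> hBC.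
have {}hBC : (mu (B `+` C) + nu (B `+` C) < e%:E)%E by rewrite -measure_addE.
have dif (la : probability (borel_shift A) R) :
    `|fine (la B) - fine (la C)| <= fine (la (B `+` C)).
  have h D E : measurable D -> measurable E ->
      fine (la D) <= fine (la E) + fine (la (D `+` E)).
    move=> mD mE; apply: measure_sub_setU => //.
      by apply: measurableU; apply: measurableD.
    by move=> x Dx; have [Ex|nEx] := pselect (E x); [by left|by right; left].
  rewrite ler_norml; have := h _ _ mB mC; have := h _ _ mC mB.
  by rewrite [C `+` B]setYC; lra.
move: hBC; rewrite -[mu _]fineK ?fin_num_measure // -[nu _]fineK ?fin_num_measure //.
rewrite -EFinD lte_fin.
have := dif mu; have := dif nu; rewrite (mn' _ _ Cn).
rewrite !ler_norml; lra.
Qed.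

End BorelSets.

Section Extension.
Variables (R : realType) (A : alphabetType).

(** An alias of the full shift whose measurable sets are the clopen ones only;
    they form a ring of sets, the domain of the content to be extended. *)
Definition clopen_shift := fullshift A.
Implicit Types C D : set clopen_shift.

HB.instance Definition _ := Pointed.on clopen_shift.

Definition clopen C := exists n, determined n C.

Let clopen0 : clopen set0.
Proof. by exists 0%N. Qed.

Let clopenU : setU_closed clopen.
Proof.
move=> C D [n Cn] [m Dm]; exists (maxn n m).
by apply: determinedU; [apply: determinedW Cn|apply: determinedW Dm];
  rewrite ?leq_maxl ?leq_maxr.
Qed.

Let clopenD : setD_closed clopen.
Proof.
move=> C D [n Cn] [m Dm]; exists (maxn n m); rewrite setDE.
by apply: determinedI; [apply: determinedW Cn|
  apply: determinedC; apply: determinedW Dm]; rewrite ?leq_maxl ?leq_maxr.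
Qed.

HB.instance Definition _ := @isRingOfSets.Build default_measure_display
  clopen_shift clopen clopen0 clopenU clopenD.

Definition consistent (m : seq A -> R) :=
  forall w, \sum_(a : A) m (w ++ [:: a]) = m w.

Lemma consistent_cat (m : seq A -> R) w n : consistent m ->
  wsum n (fun v => m (w ++ v)) = m w.
Proof.
move=> mS; elim: n => [|n IH]; first by rewrite wsum0 cats0.
rewrite -addn1 wsum_cat -[RHS]IH; apply: eq_wsum => v _.
by rewrite wsum1 -mS; apply: eq_bigr => a _; rewrite catA.
Qed.

Section Content.
Variable m : seq A -> R.
Hypotheses (m_ge0 : forall w, 0 <= m w) (m_cons : consistent m).

Let cmass n C : R := wsum n (fun w => if `[< C (ext w) >] then m w else 0).

Let cmass_widen n k C : determined n C -> cmass (n + k) C = cmass n C.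
Proof.
move=> Cn; rewrite /cmass wsum_cat; apply: eq_wsum => u un.
have Cu v : `[< C (ext (u ++ v)) >] = `[< C (ext u) >].
  have e : mkseq (ext (u ++ v)) n = mkseq (ext u) n.
    have /cyl_cat[+ _] : cyl (u ++ v) (ext (u ++ v)) := mkseq_ext _.
    by rewrite /cyl /= un (mkseq_ext_n un).
  by apply/asboolP/asboolP; apply: Cn.
under eq_wsum do rewrite Cu.
by case: asboolP => _; rewrite ?(consistent_cat _ _ m_cons) // /wsum big1.
Qed.

(** By [cmass_widen] the value does not depend on the choice of [n]. *)
Definition clopen_content C : R := cmass (xget 0%N [set n | determined n C]) C.

Let clopen_contentE n C : determined n C -> clopen_content C = cmass n C.
Proof.
move=> Cn; rewrite /clopen_content.
have : determined (xget 0%N [set n | determined n C]) C.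
  by apply: (@xgetPex _ 0%N [set n | determined n C]); exists n.
set k := xget _ _ => Ck.
by rewrite -(cmass_widen n Ck) addnC cmass_widen.
Qed.

Let content_ge0 C : 0 <= clopen_content C.
Proof. by apply: wsum_ge0 => w; case: ifP. Qed.

Let content0 : clopen_content set0 = 0.
Proof.
rewrite (@clopen_contentE 0%N) // /cmass wsum0; case: asboolP => //.
Qed.

Let contentU C D : clopen C -> clopen D -> C `&` D = set0 ->
  clopen_content (C `|` D) = clopen_content C + clopen_content D.
Proof.
move=> [n Cn] [k Dk] CD.
have {}Cn : determined (maxn n k) C by apply: determinedW Cn; exact: leq_maxl.
have {}Dk : determined (maxn n k) D by apply: determinedW Dk; exact: leq_maxr.
rewrite (clopen_contentE Cn) (clopen_contentE Dk).
rewrite (clopen_contentE (determinedU Cn Dk)) /cmass -wsumD.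
apply: eq_wsum => w _.
case: (asboolP (C _)) => Cw; case: (asboolP (D _)) => Dw.
- by have : set0 (ext w) by rewrite -CD.
- by rewrite asboolT ?addr0 //; left.
- by rewrite asboolT ?add0r //; right.
- by rewrite asboolF ?addr0 // => -[].
Qed.

Let clopen_bigsetU (F : nat -> set clopen_shift) n :
  (forall i, clopen (F i)) -> clopen (\big[setU/set0]_(i < n) F i).
Proof. by move=> cF; elim/big_ind : _ => //= i _; exact: cF. Qed.

Let content_bigsetU (F : nat -> set clopen_shift) n :
  (forall i, clopen (F i)) -> trivIset setT F ->
  clopen_content (\big[setU/set0]_(i < n) F i) = \sum_(i < n) clopen_content (F i).
Proof.
move=> cF tF; elim: n => [|n IH]; first by rewrite !big_ord0 content0.
rewrite !big_ord_recr /= contentU ?IH //; first exact: clopen_bigsetU.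
apply/seteqP; split=> // x [+ Fnx]; rewrite -bigcup_mkord => -[i /= ni Fix].
have ein : i = n by apply: tF => //; exists x.
by rewrite ein ltnn in ni.
Qed.

(** A countable union of disjoint clopen sets that is clopen, hence compact,
    is a finite union. *)
Let content_sigma_additive :
  semi_sigma_additive ((fun C => (clopen_content C)%:E) : set clopen_shift -> \bar R).
Proof.
move=> F cF tF [n Un].
have [||||N hN] := @compact_prefix A (\bigcup_k F k)
    (fun N x => forall y, mkseq y N = mkseq x N -> (\big[setU/set0]_(i < N) F i) y).
- exact: determined_closed Un.
- by move=> N x y xy h z zy; apply: h; rewrite zy.
- move=> N x h y yx; rewrite big_ord_recr /=; left.
  by apply: h; exact: mkseq_sub yx.
- move=> x [i _ Fix]; have [k Fk] := cF i.
  exists (maxn i.+1 k) => y yx; rewrite -bigcup_mkord; exists i.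
    by rewrite /= leq_max leqnn.
  by apply: Fk Fix; apply/esym/(mkseq_sub _ yx); exact: leq_maxr.
apply: cvg_near_cst; near=> M.
rewrite sumEFin big_mkord -content_bigsetU //; congr (clopen_content _)%:E.
rewrite -bigcup_mkord; apply/seteqP; split=> [x [i _ Fx]|x]; first by exists i.
move=> /hN/(_ x erefl); rewrite -bigcup_mkord => -[i /= iN Fx]; exists i => //=.
by apply: leq_trans iN _; near: M; exact: nbhs_infty_ge.
Unshelve. all: by end_near. Qed.

Definition content_measure (C : set clopen_shift) : \bar R := (clopen_content C)%:E.

Lemma content_measure_axioms :
  [/\ content_measure set0 = 0%E, forall C, (0 <= content_measure C)%E,
   semi_sigma_additive content_measure & forall w, content_measure (cyl w) = (m w)%:E].
Proof.
split=> [|C||w].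
- by rewrite /content_measure content0.
- by rewrite lee_fin.
- exact: content_sigma_additive.
- rewrite /content_measure (clopen_contentE (@determined_cyl A w)) /cmass.
  rewrite (wsum_split _ (erefl (size w))) asboolT; last exact: mkseq_ext.
  rewrite [X in _ + X]big1 ?addr0 // => u _.
  case: eqP => // uw; rewrite asboolF // => h; apply: uw.
  exact: etrans (esym (mkseq_ext_n (size_tuple u))) h.
Qed.

End Content.

(** Kolmogorov's extension theorem for finite alphabets: the content extends,
    by Caratheodory's construction, to the sigma-algebra that clopen sets
    generate, and that one contains the open sets. *)
Lemma measure_of_consistent (m : seq A -> R) : (forall w, 0 <= m w) ->
  consistent m -> m [::] = 1 ->
  exists mu : probability (borel_shift A) R, forall w, mu (cyl w) = (m w)%:E.
Proof.
move=> m0 mS m1; have [f0 fge0 fsig fcyl] := content_measure_axioms m0 mS.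
pose f := content_measure m.
pose mu0 : {measure set clopen_shift -> \bar R} := HB.pack f
  (@isMeasure.Build _ _ R f f0 fge0 fsig).
pose g : set (borel_shift A) -> \bar R := measure_extension mu0.
have sub (B : set (borel_shift A)) : measurable B ->
    <<s @measurable _ clopen_shift >> B.
  move: B; apply: smallest_sub; first exact: smallest_sigma_algebra.
  move=> U oU; rewrite (open_bigcup_cyl oU).
  apply: sigma_algebra_bigcup => n; apply: sub_sigma_algebra.
  by exists n => x y xy h z zy; apply: h; rewrite zy.
have gs : semi_sigma_additive g.
  move=> F mF tF mUF; apply: (@measure_semi_sigma_additive _ _ _ (measure_extension mu0)) => //.
    by move=> i; exact: sub.
  exact: sub.
have gE w : g (cyl w) = (m w)%:E.
  rewrite /g /measure_extension measurable_mu_extE //.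
    exact: fcyl.
  by exists (size w); exact: determined_cyl.
have gT : g setT = 1%E.
  rewrite (_ : setT = cyl [::]) ?gE ?m1 //.
  by apply/seteqP; split.
have g0 : g set0 = 0%E by exact: measure0.
have gge0 B : (0 <= g B)%E by exact: measure_ge0.
pose mu1 : {measure set (borel_shift A) -> \bar R} := HB.pack g
  (@isMeasure.Build _ _ R g g0 gge0 gs).
pose mu : probability (borel_shift A) R := HB.pack (Measure.sort mu1)
  (Measure_isProbability.Build _ (borel_shift A) R mu1 gT).
by exists mu.
Qed.

End Extension.
#[export] Hint Resolve measurable_cyl : core.

(** * Sums over tuples of words *)

Section TupleSums.
Variables (R : realType) (A : finType).
Implicit Types (F : seq (seq A) -> R).

(** Recursive, for inductions on [k] that split off the first word. *)
Fixpoint block_sum n k F : R :=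
  if k is k'.+1 then wsum n (fun w => block_sum n k' (fun ws => F (w :: ws)))
  else F [::].

Definition block n k (ws : seq (seq A)) :=
  size ws = k /\ forall w, w \in ws -> size w = n.

Lemma block_cons n k w ws : size w = n -> block n k ws -> block n k.+1 (w :: ws).
Proof.
by move=> wn [sk h]; split; [rewrite /= sk|move=> v; rewrite inE => /predU1P[->|/h]].
Qed.

Lemma le_block_sum n k F H : (forall ws, block n k ws -> F ws <= H ws) ->
  block_sum n k F <= block_sum n k H.
Proof.
elim: k F H => [|k IH] F H FH /=; first by apply: FH.
apply: le_wsum => w wn; apply: IH => ws wsb; apply: FH; exact: block_cons.
Qed.

Lemma block_sum_ge0 n k F : (forall ws, 0 <= F ws) -> 0 <= block_sum n k F.
Proof. by elim: k F => [|k IH] F F0 //=; apply: wsum_ge0 => w; exact: IH. Qed.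

Lemma le_term_block_sum n k F ws : (forall ws, 0 <= F ws) -> block n k ws ->
  F ws <= block_sum n k F.
Proof.
elim: k F ws => [|k IH] F ws F0 [sk h]; first by move/size0nil : sk => ->.
case: ws sk h => // w ws [sk] h.
apply: (@le_trans _ _ (block_sum n k (fun ws => F (w :: ws)))).
  apply: (IH (fun ws => F (w :: ws))) => //; split => // v vs.
  by apply: h; rewrite inE vs orbT.
apply: (@le_term_wsum _ _ n (fun w => block_sum n k (fun ws => F (w :: ws)))).
  by move=> v; exact: block_sum_ge0.
by apply: h; rewrite mem_head.
Qed.

Lemma block_sumZ n k F (r : R) : block_sum n k (fun ws => r * F ws) = r * block_sum n k F.
Proof.
elim: k F => //= k IH F; rewrite -wsumZ; apply: eq_wsum => w _; exact: IH.
Qed.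

Lemma block_sum_prod n k (g : seq A -> R) :
  block_sum n k (fun ws => \prod_(w <- ws) g w) = wsum n g ^+ k.
Proof.
elim: k => [|k IH] /=; first by rewrite big_nil.
rewrite exprS -IH -wsumZr; apply: eq_wsum => w _.
rewrite -block_sumZ; congr block_sum; apply/funext => ws; by rewrite big_cons.
Qed.

Lemma wsum_block_sum n t k (F : seq A -> seq (seq A) -> R) :
  wsum n (fun w => block_sum t k (F w)) = block_sum t k (fun vs => wsum n (F^~ vs)).
Proof.
elim: k F => //= k IH F; rewrite exchange_wsum; apply: eq_wsum => v _.
exact: (IH (fun w vs => F w (v :: vs))).
Qed.

(** A word of length [k (t + n)] is a gap of length [t] and a word of length
    [n], [k] times over: the shape of the words that [Defs.glue] produces. *)
Lemma wsum_interleave t n k (h : seq A -> R) :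
  wsum (k * (t + n)) h = block_sum n k (fun ws => block_sum t k (fun vs =>
    h (flatten [seq p.1 ++ p.2 | p <- zip vs ws]))).
Proof.
elim: k h => [|k IH] h; first by rewrite mul0n wsum0.
rewrite mulSn -addnA wsum_cat /=.
under eq_wsum do rewrite wsum_cat.
rewrite exchange_wsum; apply: eq_wsum => w _.
under eq_wsum do rewrite IH.
rewrite wsum_block_sum; congr block_sum; apply/funext => ws.
apply: eq_wsum => v _; congr block_sum; apply/funext => vs /=.
by rewrite catA.
Qed.

End TupleSums.

(** * Weights of words *)

Section Weights.
Variables (R : realType) (A : alphabetType) (X : set (fullshift A)).
Variables (phi : fullshift A -> R) (B : R).
Hypothesis subshiftX : subshift X.
Hypothesis phiB : forall x, X x -> `|phi x| <= B.
Implicit Types (x y : fullshift A) (u v w : seq A) (D : set (seq A)).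

Local Notation L := (language X).
Local Notation S := (birkhoff phi).

Lemma X_iter k x : X x -> X (iter k (@sigma A) x).
Proof.
move=> Xx; elim: k => //= k IH; case: subshiftX => _ _; apply.
by exists (iter k (@sigma A) x).
Qed.

Lemma languageP w : L w <-> exists x, X x /\ cyl w x.
Proof.
split=> [[x [k [Xx xw]]]|[x [Xx xw]]]; last by exists x, 0%N.
by exists (iter k (@sigma A) x); split; [exact: X_iter|].
Qed.

Lemma language_mkseq x n : X x -> L (mkseq x n).
Proof. by move=> Xx; apply/languageP; exists x; split => //; exact: cyl_mkseq. Qed.

Lemma language_cat u v : L (u ++ v) -> L u /\ L v.
Proof.
move=> /languageP[x [Xx /cyl_cat[xu xv]]]; split; apply/languageP.
  by exists x.
by exists (iter (size u) (@sigma A) x); split => //; exact: X_iter.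
Qed.

Lemma language_nil : L [::].
Proof. by case: subshiftX => -[x Xx] _ _; apply/languageP; exists x. Qed.

Lemma birkhoffD n m x : S (n + m) x = S n x + S m (iter n (@sigma A) x).
Proof.
rewrite /birkhoff big_split_ord /=; congr (_ + _); apply: eq_bigr => i _.
by rewrite addnC iterD.
Qed.

Lemma birkhoff_bound n x : X x -> `|S n x| <= n%:R * B.
Proof.
move=> Xx; rewrite /birkhoff; apply: (le_trans (ler_norm_sum _ _ _)).
apply: (@le_trans _ _ (\sum_(i < n) B)).
  by apply: ler_sum => i _; apply: phiB; exact: X_iter.
by rewrite sumr_const card_ord mulr_natl.
Qed.

Lemma B_ge0 : 0 <= B.
Proof. by case: subshiftX => -[x /phiB h] _ _; apply: le_trans h. Qed.

Lemma has_sup_word w : L w -> has_sup [set S (size w) x | x in cylinder X w].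
Proof.
move=> /languageP[x [Xx xw]]; split; first by exists (S (size w) x), x.
exists ((size w)%:R * B) => _ [y [Xy _] <-].
by apply: le_trans (ler_norm _) (birkhoff_bound _ Xy).
Qed.

Lemma le_word_sup w x : X x -> cyl w x -> S (size w) x <= word_sup X phi w.
Proof.
move=> Xx xw; apply: sup_ubound; last by exists x.
by have [] := has_sup_word (proj2 (languageP w) (ex_intro _ x (conj Xx xw))).
Qed.

Lemma word_sup_le w r : L w -> (forall x, X x -> cyl w x -> S (size w) x <= r) ->
  word_sup X phi w <= r.
Proof.
move=> Lw h; apply: ge_sup; first by case: (has_sup_word Lw).
by move=> _ [x [Xx xw] <-]; exact: h.
Qed.

Lemma word_sup_bound w : L w -> `|word_sup X phi w| <= (size w)%:R * B.
Proof.
move=> Lw; rewrite ler_norml; apply/andP; split.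
  have /languageP[x [Xx xw]] := Lw; apply: le_trans (le_word_sup Xx xw).
  by have := birkhoff_bound (size w) Xx; rewrite ler_norml => /andP[].
apply: word_sup_le => // x Xx _.
by have := birkhoff_bound (size w) Xx; rewrite ler_norml => /andP[].
Qed.

Lemma word_sup_nil : word_sup X phi [::] = 0.
Proof.
by apply/eqP; rewrite -normr_le0; have := word_sup_bound language_nil; rewrite mul0r.
Qed.

Lemma word_sup_cat u v : L (u ++ v) ->
  word_sup X phi (u ++ v) <= word_sup X phi u + word_sup X phi v.
Proof.
move=> Luv; apply: word_sup_le => // x Xx /cyl_cat[xu xv].
rewrite size_cat birkhoffD lerD //; first exact: le_word_sup.
by apply: le_word_sup => //; exact: X_iter.
Qed.

(** The term of [w] in [Lambda X phi D], extended by 0 to all words. *)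
Definition weight D w : R := if w \in D then expR (word_sup X phi w) else 0.

Lemma weight_ge0 D w : 0 <= weight D w.
Proof. by rewrite /weight; case: ifP => // _; exact: expR_ge0. Qed.
Hint Resolve weight_ge0 : core.

Lemma LambdaE D n : Lambda X phi D n = wsum n (weight D).
Proof. by rewrite /Lambda big_mkcond. Qed.

Lemma weightE D w : D w -> weight D w = expR (word_sup X phi w).
Proof. by move=> Dw; rewrite /weight mem_set. Qed.

Lemma weight0 D w : ~ D w -> weight D w = 0.
Proof. by move=> Dw; rewrite /weight memNset. Qed.

Lemma weight_cat u v : weight L (u ++ v) <= weight L u * weight L v.
Proof.
have [Luv|Luv] := pselect (L (u ++ v)); last by rewrite weight0 // mulr_ge0.
have [Lu Lv] := language_cat Luv.
by rewrite !weightE // -expRD ler_expR; exact: word_sup_cat.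
Qed.

Local Notation Lam := (fun n => wsum n (weight L)).

Lemma Lam_sub n m : Lam (n + m)%N <= Lam n * Lam m.
Proof.
rewrite /= wsum_cat -wsumZr; apply: le_wsum => u _; rewrite -wsumZ.
by apply: le_wsum => v _; exact: weight_cat.
Qed.

Lemma Lam_low n : expR (- (B * n%:R)) <= Lam n.
Proof.
case: subshiftX => -[x Xx] _ _.
have sx : size (mkseq x n) = n by rewrite size_mkseq.
apply: le_trans (le_term_wsum (weight_ge0 L) sx).
have Lx := language_mkseq n Xx.
rewrite weightE // ler_expR; have := word_sup_bound Lx; rewrite sx mulrC.
by rewrite ler_norml => /andP[].
Qed.

Lemma Lam_gt0 n : 0 < Lam n.
Proof. exact: lt_le_trans (expR_gt0 _) (Lam_low n). Qed.

Local Notation P := (pressure X phi).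

(** By Fekete's lemma the upper limit in the pressure is a limit and an
    infimum. *)
Lemma pressure_limit : (fun n => n%:R^-1 * ln (Lam n) : R) @ \oo --> P /\
  forall n, P * n%:R <= ln (Lam n).
Proof.
have [||l lc ll] := @Fekete R (fun n => ln (Lam n)) (- B).
- move=> n m; rewrite -lnM ?posrE ?Lam_gt0 // ler_ln ?posrE ?mulr_gt0 ?Lam_gt0 //.
  exact: Lam_sub.
- move=> n; rewrite -[X in X <= _]expRK ler_ln ?posrE ?expR_gt0 ?Lam_gt0 //.
  by rewrite mulNr; exact: Lam_low.
suff -> : P = l by [].
rewrite /pressure; under eq_fun do rewrite LambdaE.
by have [_ ->] := cvg_limn_inf_sup lc.
Qed.

Lemma expR_pressure_le n : expR (n%:R * P) <= Lam n.
Proof.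
have [_ h] := pressure_limit.
by rewrite -[leRHS]lnK ?posrE ?Lam_gt0 // ler_expR mulrC.
Qed.

End Weights.
#[export] Hint Extern 0 (is_true (0 <= weight _ _ _ _)) => solve [exact: weight_ge0] : core.

Local Notation glue := Defs.glue.

(** * Gluing words *)

Section Gluing.
Variables (R : realType) (A : alphabetType) (X : set (fullshift A)).
Variables (phi : fullshift A -> R) (B : R).
Hypothesis subshiftX : subshift X.
Hypothesis phiB : forall x, X x -> `|phi x| <= B.
Implicit Types (x y : fullshift A) (u v w : seq A) (D H : set (seq A)).

Local Notation L := (language X).
Local Notation S := (birkhoff phi).
Local Notation Phi := (word_sup X phi).
Local Notation g := (weight X phi).
Local Notation P := (pressure X phi).
Local Notation Lam := (fun n => wsum n (g L)).

(** The Bowen property of [H], with the constant [V]. *)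
Definition variation_le H (V : R) := forall w x y, H w ->
  cylinder X w x -> cylinder X w y -> `|S (size w) x - S (size w) y| <= V.

Lemma variation_le_sup H V w x : H `<=` L -> variation_le H V -> H w ->
  X x -> cyl w x -> Phi w <= S (size w) x + V.
Proof.
move=> HL HV Hw Xx xw; apply: (word_sup_le subshiftX phiB) => [|y Xy yw].
  exact: HL.
have := HV w y x Hw (conj Xy yw) (conj Xx xw).
by have := ler_norm (S (size w) y - S (size w) x); lra.
Qed.

Variables (H : set (seq A)) (V : R) (t : nat).
Hypotheses (HL : H `<=` L) (HV : variation_le H V).

Let K := V + t%:R * B.

Lemma glue_cons w1 v vs w ws :
  glue w1 (v :: vs) (w :: ws) = w1 ++ v ++ glue w vs ws.
Proof. by rewrite /glue /= -!catA. Qed.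

(** Along a glued word the Birkhoff sum is the sum over its pieces: each word
    contributes its supremum up to [V], each gap at least [- t B]. *)
Lemma glue_birkhoff w1 vs ws x : size vs = size ws ->
  (forall v, v \in vs -> size v = t) -> H w1 -> (forall w, w \in ws -> H w) ->
  X x -> cyl (glue w1 vs ws) x ->
  Phi w1 + \sum_(w <- ws) Phi w <=
    S (size (glue w1 vs ws)) x + V + K * (size ws)%:R.
Proof.
elim: ws w1 vs x => [|w ws IH] w1 [|v vs] x //=.
  move=> _ _ Hw1 _ Xx; rewrite /glue /= cats0 big_nil addr0 mulr0 addr0.
  by move=> xw1; exact: (variation_le_sup HL HV Hw1 Xx xw1).
move=> [svs] tv Hw1 Hws Xx; rewrite glue_cons => /cyl_cat[xw1 /cyl_cat[xv xg]].
have vt : size v = t by apply: tv; rewrite mem_head.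
have Hw : H w by apply: Hws; rewrite mem_head.
have Xx1 := X_iter subshiftX (size w1) Xx.
have Xx2 := X_iter subshiftX (size v) Xx1.
have tv' v' : v' \in vs -> size v' = t by move=> h; apply: tv; rewrite inE h orbT.
have Hws' w' : w' \in ws -> H w' by move=> h; apply: Hws; rewrite inE h orbT.
have IHx := IH w vs _ svs tv' Hw Hws' Xx2 xg.
have h1 := variation_le_sup HL HV Hw1 Xx xw1.
have h2 := birkhoff_bound subshiftX phiB t Xx1.
rewrite ler_norml in h2; case/andP: h2 => h2 _.
rewrite big_cons !size_cat !birkhoffD vt in IHx *.
by rewrite -natr1 mulrDr mulr1 {2}/K; lra.
Qed.

Lemma glue_weight w1 vs ws : size vs = size ws ->
  (forall v, v \in vs -> size v = t) -> H w1 -> (forall w, w \in ws -> H w) ->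
  L (glue w1 vs ws) ->
  g L w1 * \prod_(w <- ws) g L w <=
    expR (V + K * (size ws)%:R) * g L (glue w1 vs ws).
Proof.
move=> svs tv Hw1 Hws Lg.
have Lws w : w \in ws -> L w by move=> /Hws/HL.
have -> : \prod_(w <- ws) g L w = expR (\sum_(w <- ws) Phi w).
  rewrite big_seq [in RHS]big_seq (big_morph _ (@expRD R) (@expR0 R)).
  by apply: eq_bigr => w /Lws Lw; rewrite weightE.
rewrite !weightE //; last exact: HL.
rewrite -!expRD ler_expR.
have /(languageP subshiftX)[x [Xx xg]] := Lg.
have h := glue_birkhoff svs tv Hw1 Hws Xx xg.
have h' := le_word_sup subshiftX phiB Xx xg.
lra.
Qed.

End Gluing.

(** * Counting *)

Section Counting.
Variables (R : realType) (A : alphabetType) (X : set (fullshift A)).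
Variables (phi : fullshift A -> R) (B : R) (Cp G Cs : set (seq A)).
Hypothesis subshiftX : subshift X.
Hypothesis phiB : forall x, X x -> `|phi x| <= B.
Hypothesis CpL : Cp `<=` language X.
Hypothesis GL : G `<=` language X.
Hypothesis CsL : Cs `<=` language X.
Hypothesis decomposition : concat3 X Cp G Cs = language X.
Hypothesis specification : forall M, S_specification X (enlarge X Cp G Cs M).
Hypothesis bowen : Bowen_property X phi G.
Hypothesis summable : (\sum_(1 <= n <oo)
       (Lambda X phi (Cp `|` Cs) n * expR (- n%:R * pressure X phi))%:E
       < +oo)%E.
Implicit Types (x y : fullshift A) (u v w : seq A) (D H : set (seq A)).

Local Notation L := (language X).
Local Notation S := (birkhoff phi).
Local Notation Phi := (word_sup X phi).
Local Notation g := (weight X phi).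
Local Notation P := (pressure X phi).
Local Notation Lam := (fun n => wsum n (g L)).
Local Notation GM := (enlarge X Cp G Cs).

Lemma decompose w : L w -> exists u v z, [/\ Cp u, G v, Cs z & w = u ++ v ++ z].
Proof. by rewrite -decomposition => -[_]. Qed.

(** The empty word has to be decomposed too. *)
Lemma nil_Cp_G_Cs : [/\ Cp [::], G [::] & Cs [::]].
Proof.
have [u [v [z [Cu Gv Cz]]]] := decompose (language_nil subshiftX).
by case: u Cu => //; case: v Gv => //; case: z Cz.
Qed.

Lemma enlarge_language M : GM M `<=` L.
Proof. by move=> w []. Qed.

Lemma enlarge_mono M N : (M <= N)%N -> GM M `<=` GM N.
Proof.
move=> MN w [Lw [u [v [z [[Cu uM] Gv [Cz zM] e]]]]]; split=> //.
by exists u, v, z; split=> //; split=> //; apply: leq_trans MN.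
Qed.

Lemma G_enlarge M : G `<=` GM M.
Proof.
move=> w Gw; have [h1 _ h3] := nil_Cp_G_Cs; split; first exact: GL.
by exists [::], w, [::]; split => //; rewrite cats0.
Qed.

Lemma enlarge_nil M : GM M [::].
Proof. by apply: G_enlarge; case: nil_Cp_G_Cs. Qed.

(** On the at most [M] symbols of the prefix, and on those of the suffix, two
    Birkhoff sums differ by at most [2 M B]. *)
Lemma Bowen_enlarge : exists V, 0 <= V /\
  forall M, variation_le X phi (GM M) (V + 4 * M%:R * B).
Proof.
have [V hV] := bowen; exists (`|V|); split; first exact: normr_ge0.
move=> M w x y [_ [u [v [z [[_ uM] Gv [_ zM] ->]]]]].
move=> [Xx /cyl_cat[xu /cyl_cat[xv xz]]] [Xy /cyl_cat[yu /cyl_cat[yv yz]]].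
have B0 := B_ge0 subshiftX phiB.
have bnd n x' : X x' -> (n <= M)%N -> - (M%:R * B) <= S n x' <= M%:R * B.
  move=> Xx' nM; rewrite -ler_norml; apply: (le_trans (birkhoff_bound subshiftX phiB n Xx')).
  by rewrite ler_wpM2r // ler_nat.
rewrite !size_cat !birkhoffD.
have Xx1 := X_iter subshiftX (size u) Xx; have Xy1 := X_iter subshiftX (size u) Xy.
have Xx2 := X_iter subshiftX (size v) Xx1; have Xy2 := X_iter subshiftX (size v) Xy1.
have /andP[h1 h1'] := bnd _ _ Xx uM; have /andP[h2 h2'] := bnd _ _ Xy uM.
have /andP[h3 h3'] := bnd _ _ Xx2 zM; have /andP[h4 h4'] := bnd _ _ Xy2 zM.
have := hV _ v _ _ (conj Gv erefl) (conj Xx1 xv) (conj Xy1 yv).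
have := ler_norm V; rewrite !ler_norml => ? /andP[? ?]; apply/andP; split; lra.
Qed.

(** [k]-fold gluing of words of [G] of length [n] shows that
    [(Lambda G n)^k] is at most a constant to the [k] times [Lambda L N], with
    [N] about [k (n + t)]; then [k] goes to infinity. *)
Lemma Lambda_G_le : exists D : R, 0 < D /\ forall n, wsum n (g G) <= D * expR (n%:R * P).
Proof.
have [V [V0 HV]] := Bowen_enlarge; have {}HV := HV 0%N.
rewrite mulr0 mul0r addr0 in HV.
have [t spec] := specification 0.
pose K := V + t%:R * B.
have B0 := B_ge0 subshiftX phiB.
have K0 : 0 <= K by rewrite addr_ge0 ?mulr_ge0.
have [plim plow] := pressure_limit subshiftX phiB.
have glue_k n k : wsum n (g G) ^+ k.+1 <=
    expR K ^+ k.+1 * Lam (n + k * (t + n))%N.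
  rewrite exprS -block_sum_prod wsum_cat -wsumZr -wsumZ; apply: le_wsum => w1 w1n.
  rewrite wsum_interleave -!block_sumZ; apply: le_block_sum => ws [sk wsn].
  have [Gw1|nGw1] := pselect (G w1); last first.
    rewrite (weight0 _ _ nGw1) mul0r mulr_ge0 ?exprn_ge0 ?expR_ge0 //.
    by apply: block_sum_ge0 => vs; exact: weight_ge0.
  have [Gws|nGws] := pselect (forall w, w \in ws -> G w); last first.
    have -> : \prod_(w <- ws) g G w = 0.
      apply: contrapT => /eqP; rewrite prodf_seq_neq0 => /allP h; apply: nGws => w /h.
      by move=> /= h'; apply: contrapT => nG; rewrite weight0 // eqxx in h'.
    rewrite mulr0 mulr_ge0 ?exprn_ge0 ?expR_ge0 //.
    by apply: block_sum_ge0 => vs; exact: weight_ge0.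
  have Hws w : w \in ws -> GM 0 w by move=> /Gws; exact: G_enlarge.
  have [vs [svs tvs Lg]] := spec w1 ws (G_enlarge 0 Gw1) Hws.
  have vt v : v \in vs -> size v = t by move=> /tvs[].
  have := glue_weight subshiftX phiB (@enlarge_language 0) HV svs vt
    (G_enlarge 0 Gw1) Hws Lg.
  rewrite -/K sk => h.
  have -> : g G w1 * \prod_(w <- ws) g G w = g L w1 * \prod_(w <- ws) g L w.
    rewrite !weightE //; last exact: GL.
    congr (_ * _); rewrite big_seq [RHS]big_seq; apply: eq_bigr => w /Gws Gw.
    by rewrite !weightE //; exact: GL.
  apply: (le_trans h); apply: ler_pM; rewrite ?expR_ge0 ?weight_ge0 //.
    by rewrite -expRM_natr ler_expR -natr1 mulrDr mulr1 addrC lerD2l /K lerDl mulr_ge0.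
  have bvs : block t k vs by split; rewrite ?svs.
  exact: (@le_term_block_sum _ _ t k (fun vs => g L (glue w1 vs ws)) vs _ bvs).
have main n : (0 < n)%N -> wsum n (g G) <= expR (K + t%:R * P) * expR (n%:R * P).
  move=> n0; have [s0|s0] := leP (wsum n (g G)) 0.
    by apply: (le_trans s0); rewrite mulr_ge0 ?expR_ge0.
  rewrite -[leLHS]lnK ?posrE // -expRD ler_expR -addrA -mulrDl -natrD addnC.
  set a := ln _; rewrite leNgt; apply/negP => Ka.
  (* Each of the [k + 1] words would gain [d] over the growth rate [P], twice
     the [e * T] that the limit allows for: a contradiction for large [k]. *)
  pose d := a - K - (n + t)%:R * P; have d0 : 0 < d by rewrite /d; lra.
  pose T : R := (n + t)%:R; have T0 : 0 < T by rewrite ltr0n addn_gt0 n0.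
  pose e := d / (2 * T); have e0 : 0 < e by rewrite divr_gt0 // mulr_gt0.
  have /cvgrPdist_le/(_ _ e0)[N _ hN] := plim.
  have [k [Nk]] := filter_ex (filterI (nbhs_infty_ge N)
    (nbhs_infty_gtr (2 * t%:R * `|P + e| / d))).
  rewrite /= ltr_pdivrMr // => kbig.
  have NkN : (N <= n + k * (t + n))%N.
    apply: (leq_trans Nk); rewrite (leq_trans _ (leq_addl _ _)) //.
    by rewrite leq_pmulr // addn_gt0 n0 orbT.
  have Npos : (0 : R) < (n + k * (t + n))%:R by rewrite ltr0n addn_gt0 n0.
  have := hN _ NkN; rewrite ler_norml => /andP[+ _].
  rewrite lerNl opprB lerBlDr mulrC ler_pdivrMr // => lamN.
  have := glue_k n k; rewrite -ler_ln ?posrE ?exprn_gt0 ?mulr_gt0 ?exprn_gt0 ?expR_gt0 //; last first.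
    exact: (Lam_gt0 subshiftX phiB).
  rewrite lnM ?posrE ?exprn_gt0 ?expR_gt0 //; last exact: (Lam_gt0 subshiftX phiB).
  rewrite lnXn // lnXn ?expR_gt0 // expRK -/a -[a *+ _]mulr_natl -[K *+ _]mulr_natl => hk.
  have NkE : (n + k * (t + n))%:R = k.+1%:R * T - t%:R :> R.
    by rewrite /T !natrD natrM natrD -natr1; ring.
  rewrite NkE in lamN.
  have eT : e * T = d / 2 by rewrite /e invfM mulrA mulfVK // gt_eqF.
  have aE : a = d + K + T * P by rewrite /d /T; ring.
  have nP : - (t%:R * (P + e)) <= t%:R * `|P + e|.
    by rewrite -mulrN ler_wpM2l // ler_normr lexx orbT.
  have kd : 0 < d * 1 by rewrite mulr1.
  have : k.+1%:R * a <= k.+1%:R * K + (e + P) * (k.+1%:R * T - t%:R) by lra.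
  rewrite aE (_ : (e + P) * (k.+1%:R * T - t%:R) =
    k.+1%:R * (e * T) + k.+1%:R * (T * P) - t%:R * (P + e)); last by ring.
  rewrite eT -natr1; lra.
exists (Num.max (expR (K + t%:R * P)) 1); split; first by rewrite lt_max ltr01 orbT.
case=> [|n].
  rewrite wsum0 mul0r expR0 mulr1 weightE; last by case: nil_Cp_G_Cs.
  by rewrite (word_sup_nil subshiftX phiB) expR0 le_max lexx orbT.
apply: (le_trans (main _ (ltn0Sn n))); rewrite ler_wpM2r ?expR_ge0 //.
by rewrite le_max lexx.
Qed.

Local Notation C := (Cp `|` Cs).

(** The terms of the summable series, with the term of index 0 added. *)
Definition core_mass i : R := wsum i (g C) * expR (- i%:R * P).

Lemma core_mass_ge0 i : 0 <= core_mass i.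
Proof. by rewrite mulr_ge0 ?expR_ge0 // wsum_ge0. Qed.
Hint Resolve core_mass_ge0 : core.

(** The summability hypothesis, with the empty word added. *)
Lemma core_mass_bounded : exists2 Sm : R, 0 < Sm & forall N, \sum_(i < N) core_mass i <= Sm.
Proof.
have c0 : core_mass 0 = 1.
  rewrite /core_mass wsum0 oppr0 mul0r expR0 mulr1 weightE.
    by rewrite (word_sup_nil subshiftX phiB) expR0.
  by left; case: nil_Cp_G_Cs.
move: summable; set s := (X in (X < _)%E) => sfin.
have s0 : (0 <= s)%E.
  by apply: nneseries_ge0 => n _ _; rewrite lee_fin mulr_ge0 ?expR_ge0 // LambdaE wsum_ge0.
have sE : s = (fine s)%:E by rewrite fineK // ge0_fin_numE.
exists (1 + fine s) => [|N]; first by rewrite ltr_wpDr ?fine_ge0.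
case: N => [|N]; first by rewrite big_ord0 addr_ge0 ?fine_ge0.
rewrite big_ord_recl c0 lerD2l -lee_fin -sE.
have := @nneseries_lim_ge R (fun n => (core_mass n)%:E) predT 1 N.+1.
rewrite sumEFin big_add1 big_mkord => h.
apply: (le_trans (h _)); first by move=> n _ _; rewrite lee_fin.
by rewrite /s; under [leRHS]eq_eseriesr do rewrite LambdaE.
Qed.

Lemma core_mass_tail (e : R) : 0 < e ->
  exists M, forall N, \sum_(i < N | (M < i)%N) core_mass i <= e.
Proof.
move=> e0; have [Sm Sm0 hS] := core_mass_bounded.
pose U := range (fun N => \sum_(i < N) core_mass i).
have supU : has_sup U.
  split; first by exists (\sum_(i < 0) core_mass i), 0%N.
  by exists Sm => _ [N _ <-].
have [_ [M _ <-] hM] := sup_adherent e0 supU.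
exists M => N; pose K := maxn N M.+1.
have le_sup : \sum_(i < K) core_mass i <= sup U.
  by apply: sup_ubound; [case: supU|exists K].
have h1 : \sum_(i < M) core_mass i <= \sum_(i < K | ~~ (M < i)%N) core_mass i.
  rewrite (big_ord_widen_cond K xpredT core_mass) ?leq_max ?leqnSn ?orbT //.
  rewrite big_mkcond [leRHS]big_mkcond; apply: ler_sum => i _ /=.
  by rewrite -leqNgt; case: ltnP => [/ltnW ->|_] //; case: ifP.
have h2 : \sum_(i < N | (M < i)%N) core_mass i <= \sum_(i < K | (M < i)%N) core_mass i.
  rewrite (big_ord_widen_cond K (fun i => (M < i)%N) core_mass) ?leq_maxl //.
  rewrite big_mkcond [leRHS]big_mkcond; apply: ler_sum => i _ /=.
  by case: ltnP => //= _; case: ifP.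
rewrite (bigID (fun i : 'I_K => (M < i)%N)) /= in le_sup.
lra.
Qed.

(** The bound for [g L w] that results from cutting [w] at [i] and [i + j]. *)
Let term i j w := g C (take i w) * g G (take j (drop i w)) * g C (drop (i + j) w).

Let term_ge0 i j w : 0 <= term i j w.
Proof. by rewrite !mulr_ge0 ?weight_ge0. Qed.

Let wsum_term i j k : wsum (i + (j + k)) (term i j) =
  wsum i (g C) * wsum j (g G) * wsum k (g C).
Proof.
rewrite wsum_cat -!wsumZr; apply: eq_wsum => u ui; rewrite wsum_cat.
rewrite -[g C u * wsum j _]wsumZ -wsumZr; apply: eq_wsum => v vj; rewrite -wsumZ; apply: eq_wsum => z _.
rewrite /term take_size_cat // drop_size_cat // take_size_cat //.
by rewrite catA drop_size_cat // size_cat ui vj.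
Qed.

(** Sum over the lengths [i] and [k] of the prefix and of the suffix; the words
    of [G] in the middle are counted by [Lambda_G_le], and the factors [expR]
    recombine. The predicate [Q] will be either trivial or require that one of
    the two lengths be large. *)
Lemma Lambda_decomposed : exists2 D : R, 0 < D &
  forall (E : set (seq A)) (Q : nat -> nat -> bool) n, E `<=` L ->
  (forall w, E w -> exists u v z,
    [/\ Cp u, G v, Cs z, w = u ++ v ++ z & Q (size u) (size z)]) ->
  wsum n (g E) <=
    D * expR (n%:R * P) * \sum_(i < n.+1) \sum_(k < n.+1 | Q i k) core_mass i * core_mass k.
Proof.
have [D [D0 hD]] := Lambda_G_le; exists D => // E Q n EL dec.
pose F (i k : nat) w := if (i + k <= n)%N then term i (n - i - k) w else 0.
have F0 i k w : 0 <= F i k w by rewrite /F; case: ifP => // _; exact: term_ge0.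
have pointwise w : size w = n ->
    g E w <= \sum_(i < n.+1) \sum_(k < n.+1 | Q i k) F i k w.
  move=> wn; have [Ew|nEw] := pselect (E w); last first.
    by rewrite (weight0 _ _ nEw); do 2!apply: sumr_ge0 => ? _.
  have [u [v [z [Cu Gv Cz wE Qik]]]] := dec _ Ew.
  have szE : (size u + (size v + size z) = n)%N by rewrite -wn wE !size_cat.
  have ui : (size u < n.+1)%N by rewrite -szE; lia.
  have zk : (size z < n.+1)%N by rewrite -szE; lia.
  rewrite (bigD1 (Ordinal ui)) //= (bigD1 (Ordinal zk)) //= -addrA.
  apply: (@le_trans _ _ (F (size u) (size z) w)); last first.
    by rewrite lerDl addr_ge0 //; do ?[apply: sumr_ge0 => ? _] => //.
  rewrite /F ifT; last by rewrite -szE; lia.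
  rewrite (_ : (n - size u - size z = size v)%N); last by rewrite -szE; lia.
  rewrite /term wE take_size_cat // drop_size_cat // take_size_cat //.
  rewrite [X in drop _ X]catA drop_size_cat ?size_cat //.
  have Lw : L (u ++ v ++ z) by rewrite -wE; exact: EL.
  have Lu := CpL Cu; have Lz := CsL Cz; have Lv := GL Gv.
  have -> : g E (u ++ v ++ z) = g L (u ++ v ++ z) by rewrite !weightE // -wE.
  have -> : g C u = g L u by rewrite !weightE //; left.
  have -> : g C z = g L z by rewrite !weightE //; right.
  have -> : g G v = g L v by rewrite !weightE.
  apply: (le_trans (weight_cat subshiftX phiB _ _)).
  by rewrite -mulrA ler_wpM2l ?weight_ge0 //; exact: (weight_cat subshiftX phiB).
apply: (le_trans (le_wsum pointwise)).
rewrite wsum_sum mulr_sumr; apply: ler_sum => i _.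
rewrite wsum_sum mulr_sumr; apply: ler_sum => k _.
rewrite /F; case: leqP => ik; last first.
  apply: (@le_trans _ _ 0); first by rewrite /wsum big1.
  apply: mulr_ge0; first by rewrite mulr_ge0 ?expR_ge0 // ltW.
  by apply: mulr_ge0; exact: core_mass_ge0.
have {1}-> : n = (i + ((n - i - k) + k))%N by lia.
rewrite wsum_term /core_mass.
set j := (n - i - k)%N.
have -> : n%:R = i%:R + j%:R + k%:R :> R by rewrite -!natrD; congr (_%:R); rewrite /j; lia.
have := hD j => hj.
apply: (@le_trans _ _ (wsum i (g C) * (D * expR (j%:R * P)) * wsum k (g C))).
  by rewrite ler_wpM2r ?wsum_ge0 // ler_wpM2l ?wsum_ge0.
rewrite le_eqVlt; apply/orP; left; apply/eqP.
rewrite !mulrDl !expRD !mulNr !expRN.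
by field; rewrite !gt_eqF ?expR_gt0.
Qed.

Lemma Lambda_le : exists2 K : R, 0 < K & forall n, Lam n <= K * expR (n%:R * P).
Proof.
have [D D0 /(_ L (fun _ _ => true)) hD] := Lambda_decomposed.
have decL w : L w -> exists u v z,
    [/\ Cp u, G v, Cs z, w = u ++ v ++ z & true].
  by move=> /decompose[u [v [z [? ? ? ?]]]]; exists u, v, z.
have [Sm Sm0 hS] := core_mass_bounded.
exists (D * (Sm * Sm)) => [|n]; first by rewrite !mulr_gt0.
apply: (le_trans (hD n (fun=> id) decL)); rewrite mulrAC ler_wpM2r ?expR_ge0 // (ler_wpM2l (ltW D0)) //.
under eq_bigr do rewrite -mulr_sumr.
rewrite -mulr_suml; apply: ler_pM; rewrite ?sumr_ge0 //.
Qed.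

(** A word outside [GM M] has a prefix in [Cp] or a suffix in [Cs] that is longer
    than [M], and such words are counted by a tail of the summable series. *)
Lemma Lambda_enlargeC_le (e : R) : 0 < e -> exists M, forall n,
  wsum n (g (L `\` GM M)) <= e * expR (n%:R * P).
Proof.
move=> e0.
have [Sm Sm0 hS] := core_mass_bounded.
have [D D0 hD] := Lambda_decomposed.
have e'0 : 0 < e / (2 * D * Sm) by rewrite divr_gt0 // !mulr_gt0.
have [M hM] := core_mass_tail e'0; exists M => n {e'0}.
have decM w : (L `\` GM M) w -> exists u v z, [/\ Cp u, G v, Cs z,
    w = u ++ v ++ z & ((M < size u) || (M < size z))%N].
  move=> [Lw nGw]; have [u [v [z [Cu Gv Cz wE]]]] := decompose Lw.
  exists u, v, z; split => //; rewrite !ltnNge -negb_and; apply/negP => /andP[uM zM].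
  by apply: nGw; split=> //; exists u, v, z.
have LL : L `\` GM M `<=` L by move=> w [].
apply: (le_trans (hD _ (fun i k => (M < i) || (M < k))%N n LL decM)).
rewrite mulrAC ler_wpM2r ?expR_ge0 //.
apply: (@le_trans _ _ (D * (\sum_(i < n.+1 | (M < i)%N) \sum_(k < n.+1) core_mass i * core_mass k +
   \sum_(i < n.+1) \sum_(k < n.+1 | (M < k)%N) core_mass i * core_mass k))).
  apply: ler_wpM2l; first exact: ltW.
  rewrite [X in _ <= X + _]big_mkcond -big_split /=.
  apply: ler_sum => i _; case: ltnP => Mi /=.
    by rewrite lerDl sumr_ge0 // => k _; rewrite mulr_ge0.
  by rewrite add0r.
under eq_bigr do rewrite -mulr_sumr.
under [X in _ + X]eq_bigr do rewrite -mulr_sumr.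
rewrite -!mulr_suml.
set a := \sum_(i < n.+1 | _) _; set b := \sum_(i < n.+1) _.
have ha : a <= e / (2 * D * Sm) := hM _.
have hb : b <= Sm := hS _.
have a0 : 0 <= a by apply: sumr_ge0.
have b0 : 0 <= b by apply: sumr_ge0.
apply: (@le_trans _ _ (D * (2 * (e / (2 * D * Sm) * Sm)))).
  apply: ler_wpM2l; first exact: ltW.
  rewrite mulr2n mulrDl mul1r lerD //.
    by apply: ler_pM.
  by rewrite mulrC; apply: ler_pM.
rewrite le_eqVlt; apply/orP; left; apply/eqP; field.
by rewrite !gt_eqF.
Qed.

Lemma Lambda_enlarge_ge M : exists2 N, (M <= N)%N & forall n,
  expR (n%:R * P) / 2 <= wsum n (g (GM N)).
Proof.
have h2 : (0 : R) < 2^-1 by rewrite invr_gt0.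
have [N hN] := Lambda_enlargeC_le h2; exists (maxn M N) => [|n]; first exact: leq_maxl.
have h := hN n; have h' := expR_pressure_le subshiftX phiB n.
have : wsum n (g L) <= wsum n (g (GM (maxn M N))) + wsum n (g (L `\` GM N)).
  rewrite -wsumD; apply: le_wsum => w _.
  have [Gw|nGw] := pselect (GM (maxn M N) w).
    by rewrite (weightE _ _ Gw) (weightE _ _ (enlarge_language Gw)) lerDl.
  have [Lw|nLw] := pselect (L w); last by rewrite (weight0 _ _ nLw) addr_ge0.
  rewrite (weight0 _ _ nGw) add0r !weightE //; split=> // Gw; apply: nGw.
  by apply: enlarge_mono Gw; exact: leq_maxr.
lra.
Qed.

(** The free places are filled with words of some [GM N], with [N] so large that
    these carry half of the partition function. The bound says that [u] and [v]
    at prescribed places in a long word are, up to a constant, at least as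
    frequent as independence would make them. *)
Lemma glue_two M : exists t (c : R), 0 < c /\ forall u v i j l,
  GM M u -> GM M v ->
  c * g L u * g L v * expR ((i + j + l)%:R * P) <=
  wsum (i + t) (fun a => wsum (t + (j + t)) (fun b => wsum (t + l) (fun d =>
    g L (a ++ u ++ b ++ v ++ d)))).
Proof.
have [N MN hN] := Lambda_enlarge_ge M.
have [t spec] := specification N.
have [V [V0 HV]] := Bowen_enlarge; have {}HV := HV N.
set V' := V + _ in HV.
(* Five words and four gaps are glued: hence [Kc], and the words in the three
   free places bring a factor [1 / 2] each. *)
pose Kc := expR (V' + (V' + t%:R * B) * 4%:R).
exists t, (Kc^-1 / 8); split; first by rewrite divr_gt0 // invr_gt0 expR_gt0.
move=> u v i j l /(enlarge_mono MN) Gu /(enlarge_mono MN) Gv.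
have glue4 a b d : g (GM N) a * g (GM N) b * g (GM N) d * (g L u * g L v) <=
    Kc * wsum t (fun v1 => wsum t (fun v2 => wsum t (fun v3 => wsum t (fun v4 =>
      g L (a ++ v1 ++ u ++ v2 ++ b ++ v3 ++ v ++ v4 ++ d))))).
  have RHS0 : 0 <= Kc * wsum t (fun v1 => wsum t (fun v2 => wsum t (fun v3 => wsum t (fun v4 =>
      g L (a ++ v1 ++ u ++ v2 ++ b ++ v3 ++ v ++ v4 ++ d))))).
    by rewrite mulr_ge0 ?expR_ge0 //; do 4!apply: wsum_ge0 => ?.
  have [Ga|nGa] := pselect (GM N a); last by rewrite (weight0 _ _ nGa) !mul0r.
  have [Gb|nGb] := pselect (GM N b); last by rewrite (weight0 _ _ nGb) mulr0 !mul0r.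
  have [Gd|nGd] := pselect (GM N d); last by rewrite (weight0 _ _ nGd) mulr0 !mul0r.
  have Hws w : w \in [:: u; b; v; d] -> GM N w.
    by rewrite !inE => /or4P[]/eqP ->.
  have [vs [svs tvs Lg]] := spec a [:: u; b; v; d] Ga Hws.
  have vt w : w \in vs -> size w = t by move=> /tvs[].
  have := glue_weight subshiftX phiB (@enlarge_language N) HV svs vt Ga Hws Lg.
  have -> : g (GM N) a = g L a by rewrite !weightE //; exact: enlarge_language Ga.
  have -> : g (GM N) b = g L b by rewrite !weightE //; exact: enlarge_language Gb.
  have -> : g (GM N) d = g L d by rewrite !weightE //; exact: enlarge_language Gd.
  case: vs svs vt {tvs Lg} => [|v1 [|v2 [|v3 [|v4 [|? ?]]]]] //= _ vt.
  rewrite !big_cons big_nil mulr1 /Defs.glue /= cats0 -!catA -/Kc => h.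
  rewrite (_ : g L a * g L b * g L d * (g L u * g L v) =
    g L a * (g L u * (g L b * (g L v * g L d)))); last by ring.
  apply: (le_trans h); rewrite ler_wpM2l ?expR_ge0 //.
  have [s1 s2 s3 s4] : [/\ size v1 = t, size v2 = t, size v3 = t & size v4 = t].
    by split; apply: vt; rewrite !inE eqxx ?orbT.
  pose F1 w1 := wsum t (fun w2 => wsum t (fun w3 => wsum t (fun w4 =>
      g L (a ++ w1 ++ u ++ w2 ++ b ++ w3 ++ v ++ w4 ++ d)))).
  pose F2 w2 := wsum t (fun w3 => wsum t (fun w4 =>
      g L (a ++ v1 ++ u ++ w2 ++ b ++ w3 ++ v ++ w4 ++ d))).
  pose F3 w3 := wsum t (fun w4 => g L (a ++ v1 ++ u ++ v2 ++ b ++ w3 ++ v ++ w4 ++ d)).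
  pose F4 w4 := g L (a ++ v1 ++ u ++ v2 ++ b ++ v3 ++ v ++ w4 ++ d).
  have i1 : F1 v1 <= wsum t F1 by apply: le_term_wsum => // ?; do 3!apply: wsum_ge0 => ?.
  have i2 : F2 v2 <= wsum t F2 by apply: le_term_wsum => // ?; do 2!apply: wsum_ge0 => ?.
  have i3 : F3 v3 <= wsum t F3 by apply: le_term_wsum => // ?; apply: wsum_ge0 => ?.
  have i4 : F4 v4 <= wsum t F4 by apply: le_term_wsum => // z; exact: weight_ge0.
  exact: le_trans i4 (le_trans i3 (le_trans i2 i1)).
have ge8 : expR ((i + j + l)%:R * P) / 8 <=
    wsum i (g (GM N)) * wsum j (g (GM N)) * wsum l (g (GM N)).
  rewrite (_ : _ / 8 = expR (i%:R * P) / 2 * (expR (j%:R * P) / 2) * (expR (l%:R * P) / 2)).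
    by do 2?[apply: ler_pM]; rewrite ?mulr_ge0 ?expR_ge0 ?invr_ge0.
  by rewrite !natrD !mulrDl !expRD; field.
rewrite (_ : Kc^-1 / 8 * _ * _ * _ = Kc^-1 * (expR ((i + j + l)%:R * P) / 8 * (g L u * g L v)));
  last by ring.
rewrite ler_pdivrMl ?expR_gt0 //.
apply: (le_trans (ler_wpM2r _ ge8)); first by rewrite mulr_ge0.
pose H a b d v1 v2 v3 v4 := g L (a ++ v1 ++ u ++ v2 ++ b ++ v3 ++ v ++ v4 ++ d).
have -> : wsum (i + t) (fun a => wsum (t + (j + t)) (fun b => wsum (t + l) (fun d =>
    g L (a ++ u ++ b ++ v ++ d)))) =
  wsum i (fun a => wsum j (fun b => wsum l (fun d => wsum t (fun v1 => wsum t (fun v2 =>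
    wsum t (fun v3 => wsum t (H a b d v1 v2 v3))))))).
  rewrite wsum_cat; apply: eq_wsum => a _.
  transitivity (wsum j (fun b => wsum t (fun v1 => wsum t (fun v2 =>
      wsum t (fun v3 => wsum t (fun v4 => wsum l (fun d => H a b d v1 v2 v3 v4))))))).
    rewrite [RHS]exchange_wsum; apply: eq_wsum => v1 _; rewrite [RHS]exchange_wsum.
    rewrite wsum_cat; apply: eq_wsum => v2 _; rewrite wsum_cat; apply: eq_wsum => b _.
    apply: eq_wsum => v3 _; rewrite wsum_cat; apply: eq_wsum => v4 _.
    by apply: eq_wsum => d _; rewrite /H -!catA.
  apply: eq_wsum => b _; do 4![rewrite [RHS]exchange_wsum; apply: eq_wsum => ? _].
  by [].
rewrite -!mulrA -wsumZr -wsumZ; apply: le_wsum => a _.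
rewrite mulrCA -wsumZr -wsumZ; apply: le_wsum => b _.
rewrite [leLHS](_ : _ = wsum l (g (GM N)) *
  (g (GM N) b * g (GM N) a * (g L u * g L v))); last by ring.
rewrite -wsumZr -wsumZ; apply: le_wsum => d _.
apply: le_trans (glue4 a b d); rewrite le_eqVlt; apply/orP; left; apply/eqP; ring.
Qed.

End Counting.

(** * Limits of approximately invariant functions of words *)

Section Ultralimits.
Variables (R : realType).

(** Bounded intervals are compact. *)
Lemma ultra_cvg (U : set_system nat) (f : nat -> R) (c : R) :
  UltraFilter U -> (forall n, `|f n| <= c) -> exists l : R, f @ U --> l.
Proof.
move=> UF fc; have PU : ProperFilter U by exact: ultra_proper.
have Fc : (f @ U) `[- c, c]%classic.
  have UT : U setT by exact: filterT.
  suff : U (f @^-1` `[- c, c]%classic) by [].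
  apply: filterS UT => n _.
  by have := fc n; rewrite ler_norml /= in_itv.
have [l [_ ll]] := @segment_compact R (- c) c (f @ U) _ Fc.
exists l => B lB; have [//|UnB] := in_ultra_setVsetC (f @^-1` B) UF.
by have [x []] := ll (~` B) B UnB lB.
Qed.

End Ultralimits.

Section InvariantStates.
Variables (R : realType) (A : alphabetType) (X : set (fullshift A)).
Hypothesis subshiftX : subshift X.
Implicit Types (u v w : seq A).

Lemma measurable_subshift : measurable (X : set (borel_shift A)).
Proof. by apply: closed_measurable_shift; case: subshiftX. Qed.

(** The complement of [X] is the countable union of the cylinders of words
    outside the language. *)
Lemma mass_supported (mu : probability (borel_shift A) R) :
  (forall w, ~ language X w -> cylinder_mass mu w = 0) -> mu X = 1%E.
Proof.
move=> muL; have mX := measurable_subshift.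
suff h : mu (~` X) = 0%E.
  rewrite -[X in mu X]setCK probability_setC ?h ?sube0 //; exact: measurableC.
have -> : ~` X = \bigcup_n [set x | ~ language X (mkseq x n)].
  apply/seteqP; split=> [x nXx|x [n _ nL] Xx]; last first.
    by apply: nL; exact: language_mkseq.
  have oX : open (~` X) by apply: closed_openC; case: subshiftX.
  move: oX; rewrite openE => /(_ x nXx)/nbhs_cyl[n hn]; exists n => //=.
  move=> /(languageP subshiftX)[y [Xy]]; rewrite /cyl /= size_mkseq => yx.
  exact: hn yx Xy.
have dn n : determined n [set x | ~ language X (mkseq x n)].
  by move=> x y /= ->.
apply/negligibleP.
  by apply: bigcup_measurable => n _; exact: determined_measurable (dn n).
apply: negligible_bigcup => n; apply/negligibleP.
  exact: determined_measurable (dn n).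
have md := determined_measurable (dn n).
rewrite -[LHS]fineK ?fin_num_measure // (measure_determined _ (dn n)).
rewrite /wsum big1 // => w _; case: asboolP => //=.
by rewrite mkseq_ext_n ?size_tuple // => /muL.
Qed.

Lemma invariant_of_mass (mu : probability (borel_shift A) R) :
  (forall w, \sum_(a : A) cylinder_mass mu (a :: w) = cylinder_mass mu w) ->
  forall B : set (borel_shift A), measurable B -> mu (@sigma A @^-1` B) = mu B.
Proof.
move=> inv.
pose s : {mfun borel_shift A >-> borel_shift A} := mfun_Sub (mem_set (@measurable_sigma A)).
pose nu : probability (borel_shift A) R := distribution mu s.
suff h : forall B : set (borel_shift A), measurable B -> nu B = mu B by [].
apply: measure_ext_cyl => w.
transitivity ((cylinder_mass mu w)%:E); last by rewrite cylinder_massE.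
rewrite -inv -sumEFin.
have -> : nu (cyl w) = mu (@sigma A @^-1` cyl w) by [].
have mw : measurable (@sigma A @^-1` cyl w : set (borel_shift A)).
  apply: (@determined_measurable A (1 + size w)).
  exact: (@determined_preimage A 1 (size w) _ (@determined_cyl A w)).
rewrite -[LHS]fineK ?fin_num_measure // (measure_cyl_fibers _ 1 mw) wsum1 -sumEFin.
apply: eq_bigr => a _; congr (fine (mu _))%:E; apply/seteqP; split=> x.
  move=> [/= xw]; rewrite /cyl /= => -[xa]; apply/cyl_cons; split => //.
by move=> /cyl_cons[xa xw]; split => //=; rewrite /cyl /= /mkseq /= xa.
Qed.

(** Limits along an ultrafilter play the part of weak-star limits of
    subsequences: they exist for every word at once, and the two sums over a
    letter say that the limit is consistent and invariant. *)
Lemma limit_state (U : set_system nat) (m_ : nat -> seq A -> R) :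
  UltraFilter U -> (\oo `<=` U) ->
  (forall n u, 0 <= m_ n u <= 1) ->
  (\forall n \near \oo, m_ n [::] = 1) ->
  (forall u, (fun n => \sum_(a : A) m_ n (u ++ [:: a]) - m_ n u) @ \oo --> (0 : R)) ->
  (forall u, (fun n => \sum_(a : A) m_ n (a :: u) - m_ n u) @ \oo --> (0 : R)) ->
  (forall u, ~ language X u -> \forall n \near \oo, m_ n u = 0) ->
  exists mu : probability (borel_shift A) R,
    invariant_probability X mu /\
    forall u, (fun n => m_ n u) @ U --> cylinder_mass mu u.
Proof.
move=> UF ooU m01 m1 mR mL mX.
have PU : ProperFilter U by exact: ultra_proper.
have [m mlim] : exists m : seq A -> R, forall u, (fun n => m_ n u) @ U --> m u.
  have ex u : exists l : R, (fun n => m_ n u) @ U --> l.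
    apply: (@ultra_cvg _ _ _ 1) => // n.
    by have /andP[h0 h1] := m01 n u; rewrite ger0_norm.
  by exists (fun u => projT1 (cid (ex u))) => u; exact: (projT2 (cid (ex u))).
have sum_lim (h : A -> seq A) u :
    (fun n => \sum_(a : A) m_ n (h a) - m_ n u) @ \oo --> (0 : R) ->
    \sum_(a : A) m (h a) = m u.
  move=> /(cvg_trans (cvg_app _ ooU)) h0; apply/eqP; rewrite -subr_eq0; apply/eqP.
  apply: (cvg_unique _ _ h0) => //.
  apply: cvgB; last exact: mlim.
  apply: cvg_big; [exact: add_continuous|by move=> a _; exact: mlim].
have eq_lim u r : (\forall n \near \oo, m_ n u = r) -> m u = r.
  move=> /ooU h; apply: (cvg_unique _ (mlim u)) => //.
  exact: cvg_near_cst.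
have m_ge0 u : 0 <= m u.
  apply: (cvgr_to_ge (mlim u)); apply: filterS filterT => n _.
  by have /andP[] := m01 n u.
have [|||mu muE] := @measure_of_consistent R A m => //.
- by move=> u; exact: sum_lim.
- exact: eq_lim.
have massE u : cylinder_mass mu u = m u by rewrite -[m u]/(fine (m u)%:E) -muE.
exists mu; split; last by move=> u; rewrite massE; exact: mlim.
split.
  by apply: mass_supported => w /mX /eq_lim; rewrite massE.
apply: invariant_of_mass => w; under eq_bigr do rewrite massE.
by rewrite massE; exact: sum_lim (mL w).
Qed.

End InvariantStates.

(** * The Gibbs measure *)

Section GibbsMeasure.
Variables (R : realType) (A : alphabetType) (X : set (fullshift A)).
Variables (phi : fullshift A -> R) (B K : R).
Hypothesis subshiftX : subshift X.
Hypothesis phiB : forall x, X x -> `|phi x| <= B.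
Implicit Types (u v w : seq A).

Local Notation L := (language X).
Local Notation g := (weight X phi).
Local Notation P := (pressure X phi).
Local Notation Lam := (fun n => wsum n (g L)).

Hypothesis K_gt0 : 0 < K.
Hypothesis Lam_le : forall n, Lam n <= K * expR (n%:R * P).

Let Lam_ge n : expR (n%:R * P) <= wsum n (g L).
Proof. exact: (expR_pressure_le subshiftX phiB). Qed.

Let Lam0 n : 0 < wsum n (g L).
Proof. exact: (Lam_gt0 subshiftX phiB). Qed.

(** The chance that a word of length [n], drawn with probability proportional
    to its weight, has [u] at place [k]; the value 0 where [u] does not fit
    changes averages over [k] by [O(1/n)] only. *)
Definition frequency n k u : R :=
  if (k + size u <= n)%N then
    wsum k (fun a => wsum (n - k - size u) (fun d => g L (a ++ u ++ d))) / wsum n (g L)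
  else 0.

(** Averaging over places makes the limits invariant. *)
Definition mean_frequency n u : R := n%:R^-1 * \sum_(k < n) frequency n k u.

Lemma frequency_ge0 n k u : 0 <= frequency n k u.
Proof.
rewrite /frequency; case: ifP => // _; rewrite divr_ge0 ?(ltW (Lam0 _)) //.
by apply: wsum_ge0 => a; apply: wsum_ge0 => d.
Qed.

Lemma frequency_le1 n k u : frequency n k u <= 1.
Proof.
rewrite /frequency; case: leqP => // kun; rewrite ler_pdivrMr ?Lam0 // mul1r.
rewrite [X in _ <= wsum X _](_ : n = (k + (size u + (n - k - size u)))%N); last by lia.
rewrite wsum_cat; apply: le_wsum => a _; rewrite wsum_cat.
apply: (@le_term_wsum _ _ _ (fun u' => wsum (n - k - size u) (fun d => g L (a ++ u' ++ d)))) => //.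
by move=> u'; exact: wsum_ge0.
Qed.

(** The weight of [a u d] is at most the product of the weights, and the sums
    over [a] and [d] are bounded by [Lam_le]. *)
Lemma frequency_le n k u :
  frequency n k u <= K ^+ 2 * expR (- (size u)%:R * P) * g L u.
Proof.
have rhs0 : 0 <= K ^+ 2 * expR (- (size u)%:R * P) * g L u.
  by rewrite !mulr_ge0 ?expR_ge0 ?exprn_ge0 // ltW.
rewrite /frequency; case: leqP => // kun; set r := (n - k - size u)%N.
rewrite ler_pdivrMr ?Lam0 //.
apply: (@le_trans _ _ (wsum k (g L) * g L u * wsum r (g L))).
  rewrite -!wsumZr; apply: le_wsum => a _; rewrite -wsumZ; apply: le_wsum => d _.
  apply: (le_trans (weight_cat subshiftX phiB _ _)).
  rewrite -mulrA ler_wpM2l //; exact: (weight_cat subshiftX phiB).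
apply: (@le_trans _ _ (K * expR (k%:R * P) * g L u * (K * expR (r%:R * P)))).
  apply: ler_pM => //; rewrite ?mulr_ge0 ?wsum_ge0 //.
  by rewrite ler_wpM2r.
apply: (@le_trans _ _ (K ^+ 2 * expR (- (size u)%:R * P) * g L u * expR (n%:R * P))); last first.
  by rewrite ler_wpM2l.
have -> : n%:R = k%:R + (size u)%:R + r%:R :> R.
  by rewrite -!natrD; congr (_%:R); rewrite /r; lia.
rewrite le_eqVlt; apply/orP; left; apply/eqP.
rewrite !mulrDl !expRD mulNr expRN; field.
by rewrite gt_eqF ?expR_gt0.
Qed.

Lemma frequency_rcons n k u : (k + size u < n)%N ->
  \sum_(a : A) frequency n k (u ++ [:: a]) = frequency n k u.
Proof.
move=> kun; rewrite /frequency (ltnW kun).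
under eq_bigr => a _.
  rewrite size_cat /= addn1 ifT; last by lia.
  rewrite (_ : (n - k - (size u).+1)%N = (n - k - size u).-1); last by lia.
  over.
rewrite -mulr_suml; congr (_ / _); rewrite -wsum_sum; apply: eq_wsum => b _.
rewrite -[in RHS](@prednK (n - k - size u)); last by lia.
rewrite wsumS; apply: eq_bigr => a _; apply: eq_wsum => d _.
by rewrite -!catA.
Qed.

Lemma frequency_cons n k u :
  \sum_(a : A) frequency n k (a :: u) = frequency n k.+1 u.
Proof.
rewrite /frequency /= addSnnS; case: leqP => kun; last by rewrite big1.
rewrite -mulr_suml; congr (_ / _); rewrite -wsum_sum -[k.+1]addn1 wsum_cat.
apply: eq_wsum => b _; rewrite wsum1; apply: eq_bigr => a _.
rewrite (_ : (n - k - (size u).+1 = n - (k + 1) - size u)%N); last by lia.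
by apply: eq_wsum => d _; rewrite -catA.
Qed.

Lemma mean_frequency_bounds n u : 0 <= mean_frequency n u <= 1.
Proof.
rewrite /mean_frequency mulr_ge0 ?invr_ge0 ?sumr_ge0 //=; last first.
  by move=> k _; exact: frequency_ge0.
case: n => [|n]; first by rewrite big_ord0 mulr0.
rewrite ler_pdivrMl // mulr1 -[leRHS]mulr_natr mul1r -[X in X%:R](card_ord n.+1) -sumr_const.
by apply: ler_sum => k _; exact: frequency_le1.
Qed.

Lemma mean_frequency_le n u :
  mean_frequency n u <= K ^+ 2 * expR (- (size u)%:R * P) * g L u.
Proof.
case: n => [|n].
  by rewrite /mean_frequency big_ord0 mulr0 !mulr_ge0 ?expR_ge0 ?exprn_ge0 // ltW.
rewrite /mean_frequency ler_pdivrMl // mulr_natl -[X in _ *+ X](card_ord n.+1) -sumr_const.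
by apply: ler_sum => k _; exact: frequency_le.
Qed.

Let small (f : nat -> R) : (forall n, `|n%:R * f n| <= 1) -> f @ \oo --> (0 : R).
Proof.
move=> h; apply/cvgr0Pnorm_le => e e0; near=> n.
have n0 : (0 : R) < n%:R by rewrite ltr0n; near: n; exact: nbhs_infty_gt.
rewrite -(ler_pM2l n0); have := h n; rewrite normrM ger0_norm ?(ltW n0) //.
move/le_trans; apply; rewrite -ler_pdivrMr // div1r.
by near: n; exact: nbhs_infty_ger.
Unshelve. all: by end_near. Qed.

(** At most one place [k] lets a word of length [s] end at [n]: this is where
    [frequency] jumps to 0 and fails to be consistent. *)
Let sum_hit s n : \sum_(k < n) ((k + s == n)%N)%:R <= (1 : R).
Proof.
rewrite -natr_sum -[1]/(1%:R) ler_nat.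
rewrite (_ : (\sum_(k < n) _)%N = #|[pred k : 'I_n | (k + s == n)%N]|).
  apply/card_le1_eqP => i j /eqP ei /eqP ej; apply/val_inj/eqP.
  by rewrite -(eqn_add2r s) ei ej.
by rewrite -sum1_card [RHS]big_mkcond /=; apply: eq_bigr => i _; rewrite inE; case: eqP.
Qed.

Let mean_rcons u :
  (fun n => \sum_(a : A) mean_frequency n (u ++ [:: a]) - mean_frequency n u) @ \oo --> (0 : R).
Proof.
apply: small => n; have [->|n0] := posnP n; first by rewrite mul0r normr0.
rewrite /mean_frequency -mulr_sumr -mulrBr mulVKf ?pnatr_eq0 -?lt0n //.
rewrite exchange_big -sumrB /=.
apply: le_trans (ler_norm_sum _ _ _) _; apply: le_trans (sum_hit (size u) n).
apply: ler_sum => k _; case: (ltngtP (k + size u)%N n) => kun /=.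
- by rewrite frequency_rcons // subrr normr0.
- rewrite big1 => [|a _]; rewrite /frequency ?size_cat /= ifF ?subrr ?normr0 //; lia.
- rewrite big1 => [|a _]; last by rewrite /frequency size_cat /= ifF //; lia.
  by rewrite sub0r normrN ger0_norm ?frequency_ge0 ?frequency_le1.
Qed.

Let mean_cons u :
  (fun n => \sum_(a : A) mean_frequency n (a :: u) - mean_frequency n u) @ \oo --> (0 : R).
Proof.
apply: small => n; have [->|n0] := posnP n; first by rewrite mul0r normr0.
rewrite /mean_frequency -mulr_sumr -mulrBr mulVKf ?pnatr_eq0 -?lt0n //.
rewrite exchange_big -sumrB /=; under eq_bigr do rewrite frequency_cons.
rewrite -(big_mkord xpredT (fun k => frequency n k.+1 u - frequency n k u)).
rewrite telescope_sumr // ler_norml.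
have := frequency_ge0 n n u; have := frequency_le1 n n u.
have := frequency_ge0 n 0 u; have := frequency_le1 n 0 u; lra.
Qed.

Let mean_nil n : (0 < n)%N -> mean_frequency n [::] = 1.
Proof.
move=> n0; rewrite /mean_frequency (eq_bigr (fun=> 1)) => [|k _].
  by rewrite sumr_const card_ord mulVf // pnatr_eq0 -lt0n.
rewrite /frequency addn0 (ltnW (ltn_ord k)) subn0 -wsum_cat subnKC ?divff //.
  by rewrite gt_eqF.
exact/ltnW/ltn_ord.
Qed.

(** Places [k] that leave room for the gaps are all but boundedly many. *)
Let mean_glue u v t (c : R) j n : 0 < c ->
  (forall i j l, c * g L u * g L v * expR ((i + j + l)%:R * P) <=
    wsum (i + t) (fun a => wsum (t + (j + t)) (fun b => wsum (t + l) (fun d =>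
      g L (a ++ u ++ b ++ v ++ d))))) ->
  let J := (t + (j + t))%N in let s := (size u + J + size v)%N in
  let c' := c / K * expR (- (4 * t)%:R * P) *
    (expR (- (size u)%:R * P) * g L u) * (expR (- (size v)%:R * P) * g L v) in
  (0 < n)%N ->
  c' - c' * (s + 2 * t)%:R * n%:R^-1 <=
    wsum J (fun b => mean_frequency n (u ++ b ++ v)).
Proof.
move=> c0 glue J s c' n0.
have c'0 : 0 <= c'.
  by rewrite /c' !mulr_ge0 ?expR_ge0 ?invr_ge0 ?(ltW c0) ?(ltW K_gt0).
rewrite /mean_frequency wsumZ wsum_sum.
have nn : (0 : R) < n%:R by rewrite ltr0n.
rewrite ler_pdivlMl //.
have -> : n%:R * (c' - c' * (s + 2 * t)%:R * n%:R^-1) = c' * (n%:R - (s + 2 * t)%:R).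
  by field; rewrite gt_eqF.
have good (k : nat) : (t <= k)%N -> (k + s + t <= n)%N ->
    c' <= wsum J (fun b => frequency n k (u ++ b ++ v)).
  move=> tk kn.
  pose i := (k - t)%N; pose l := (n - k - s - t)%N.
  have kE : k = (i + t)%N by rewrite /i; lia.
  have lE : (n - k - s)%N = (t + l)%N by rewrite /l; lia.
  rewrite (@eq_wsum _ _ _ _ (fun b => wsum k (fun a => wsum (t + l) (fun d =>
      g L (a ++ u ++ b ++ v ++ d))) / wsum n (g L))); last first.
    move=> b bJ; rewrite /frequency !size_cat bJ.
    have -> : (size u + (J + size v) = s)%N by rewrite /s addnA.
    rewrite ifT; last by lia.
    rewrite lE; congr (_ / _); apply: eq_wsum => a _; apply: eq_wsum => d _.
    by rewrite -!catA.
  rewrite wsumZr ler_pdivlMr ?Lam0 // exchange_wsum kE.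
  apply: le_trans (glue i j l).
  apply: (@le_trans _ _ (c' * (K * expR (n%:R * P)))).
    by rewrite ler_wpM2l.
  have -> : n%:R = (i + j + l)%:R + (4 * t)%:R + (size u)%:R + (size v)%:R :> R.
    by rewrite -!natrD; congr (_%:R); rewrite /l /i /s /J in kn *; lia.
  rewrite le_eqVlt; apply/orP; left; apply/eqP.
  rewrite /c' !mulrDl !expRD !mulNr !expRN; field.
  by rewrite !gt_eqF ?expR_gt0.
have F0 (k : nat) : 0 <= wsum J (fun b => frequency n k (u ++ b ++ v)).
  by apply: wsum_ge0 => b; exact: frequency_ge0.
have [ns|ns] := leqP (s + 2 * t) n; last first.
  apply: (@le_trans _ _ 0); last by apply: sumr_ge0 => k _; exact: F0.
  by rewrite mulr_ge0_le0 // subr_le0 ler_nat ltnW.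
rewrite -(big_mkord xpredT (fun k => wsum J (fun b => frequency n k (u ++ b ++ v)))).
rewrite (@big_cat_nat _ _ _ t) //=; last by lia.
rewrite (@big_cat_nat _ _ _ (n - s - t) t n) //=; [|lia|lia].
apply: (@le_trans _ _ (\sum_(t <= k < n - s - t) c')).
  rewrite sumr_const_nat -[leRHS]mulr_natr ler_wpM2l //.
  rewrite -natrB // ler_nat; lia.
apply: (@le_trans _ _ (\sum_(t <= k < n - s - t) wsum J (fun b => frequency n k (u ++ b ++ v)))).
  by apply: ler_sum_nat => k /andP[tk kn]; apply: good => //; lia.
rewrite addrCA lerDl addr_ge0 ?sumr_ge0 //.
Qed.

(** The Gibbs measure is a limit of the mean frequencies. In the last clause the
    premise is the conclusion of [glue_two]; in a word of length [n] the four
    gaps of length [t] cost the factor [expR (- (4 * t)%:R * P)]. *)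
Lemma Gibbs_measure : exists mu : probability (borel_shift A) R,
  [/\ invariant_probability X mu,
      forall u, cylinder_mass mu u <= K ^+ 2 * expR (- (size u)%:R * P) * g L u
    & forall u v t (c : R), 0 < c ->
      (forall i j l, c * g L u * g L v * expR ((i + j + l)%:R * P) <=
        wsum (i + t) (fun a => wsum (t + (j + t)) (fun b => wsum (t + l) (fun d =>
          g L (a ++ u ++ b ++ v ++ d))))) ->
      forall j, c / K * expR (- (4 * t)%:R * P) *
          (expR (- (size u)%:R * P) * g L u) * (expR (- (size v)%:R * P) * g L v)
        <= wsum (t + (j + t)) (fun b => cylinder_mass mu (u ++ b ++ v))].
Proof.
have [U [UF ooU]] := @ultraFilterLemma nat \oo _.
have PU : ProperFilter U by exact: ultra_proper.
have [|||||mu [mu_inv mlim]] := @limit_state R A X subshiftX U mean_frequency UF ooU.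
- exact: mean_frequency_bounds.
- by near=> n; apply: mean_nil; near: n; exact: nbhs_infty_gt.
- exact: mean_rcons.
- exact: mean_cons.
- move=> u nLu; apply: filterE => n; apply/eqP; rewrite eq_le.
  have /andP[-> _] := mean_frequency_bounds n u; rewrite andbT.
  by have := mean_frequency_le n u; rewrite (weight0 _ _ nLu) mulr0.
exists mu; split=> // [u|u v t c c0 glue j].
  by apply: (cvgr_to_le (mlim u)); apply: filterE => n; exact: mean_frequency_le.
set c' := (X in X <= _); set J := (t + (j + t))%N; set s := (size u + J + size v)%N.
have lim1 : (fun n => wsum J (fun b => mean_frequency n (u ++ b ++ v)) : R) @ U -->
    wsum J (fun b => cylinder_mass mu (u ++ b ++ v)).
  by apply: cvg_big; [exact: add_continuous|move=> b _; exact: mlim].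
have lim2 : (fun n => c' - c' * (s + 2 * t)%:R * n%:R^-1 : R) @ \oo --> c' - c' * (s + 2 * t)%:R * 0.
  apply: cvgB; first exact: cvg_cst.
  by apply: cvgMr; exact: invn_cvg0.
rewrite mulr0 subr0 in lim2.
apply: (ler_cvg_to (cvg_trans (cvg_app _ ooU) lim2) lim1).
apply: ooU; near=> n; apply: mean_glue => //.
by near: n; exact: nbhs_infty_gt.
Unshelve. all: by end_near. Qed.

End GibbsMeasure.

(** * Integrals of continuous functions *)

Section Integrals.
Variables (R : realType) (A : alphabetType) (X : set (fullshift A)).
Hypothesis closedX : closed X.
Implicit Types (f : fullshift A -> R).

Let mX : measurable (X : set (borel_shift A)).
Proof. exact: closed_measurable_shift. Qed.

(** The preimage of an open interval is the trace on [X] of a countable union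
    of clopen sets. *)
Lemma within_continuous_measurable f : {within X, continuous f} ->
  measurable_fun (X : set (borel_shift A)) (f : borel_shift A -> R).
Proof.
move=> fc; apply: (@measurability _ _ (borel_shift A) R X f _ (measurable_realfun.RGenOpens.measurableE R)).
move=> _ [_ [a [b ->]] <-].
pose V n := [set x : fullshift A | forall y, X y -> mkseq y n = mkseq x n -> `]a, b[%classic (f y)].
have -> : X `&` f @^-1` `]a, b[%classic = X `&` \bigcup_n V n.
  apply/seteqP; split=> x [Xx].
    move=> fx; split=> //.
    have ox : nbhs (f x) `]a, b[%classic by apply: open_nbhs_nbhs; split => //; exact: interval_open.
    have /subspace_continuousP/(_ x Xx)/(_ _ ox) h := fc.
    have [n hn] := nbhs_cyl h; exists n => // y Xy yx; exact: hn.
  by move=> [n _ Vx]; split=> //; exact: Vx.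
apply: measurableI => //; apply: bigcup_measurable => n _.
by apply: (@determined_measurable A n) => x y xy h z Xz zy; apply: h; rewrite // xy.
Qed.

Variable mu : {measure set (borel_shift A) -> \bar R}.
Hypothesis muX : mu X = 1%E.

Let c w : R := fine (mu (cyl w `&` X)).

Let muXfin : (mu X < +oo)%E.
Proof. by rewrite muX ltry. Qed.

Let cE w : mu (cyl w `&` X) = (c w)%:E.
Proof.
rewrite /c fineK // ge0_fin_numE //; apply: le_lt_trans muXfin.
by apply: le_measure; rewrite ?inE //; exact: measurableI.
Qed.

Let step n (G : seq A -> R) (x : borel_shift A) : R := G (mkseq x n).

Let stepE n G x : step n G x = \sum_(w : n.-tuple A) G w * \1_(cyl w) x.
Proof.
have sn : size (mkseq x n) == n by rewrite size_mkseq.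
rewrite (bigD1 (Tuple sn)) //= big1 ?addr0 => [|w wx].
  by rewrite indicE mem_set ?mulr1 //; exact: cyl_mkseq.
rewrite indicE memNset ?mulr0 // => xw; case/eqP: wx; apply/val_inj => /=.
by rewrite -xw size_tuple.
Qed.

Let indic_integrable w : mu.-integrable X (EFin \o (\1_(cyl w) : borel_shift A -> R)).
Proof.
apply: measurable_bounded_integrable => //.
exists 1; split; first exact: num_real.
move=> M /ltW M1 x _; apply: le_trans M1.
by rewrite /= indicE; case: (_ \in _); rewrite /= ?normr1 ?normr0.
Qed.

Let step_integrable n G : mu.-integrable X (EFin \o step n G).
Proof.
apply: (@eq_integrable _ _ _ mu X mX (fun x => \sum_(w : n.-tuple A) (G w * \1_(cyl w) x)%:E)%E).
  by move=> x _; rewrite /= stepE sumEFin.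
apply: integrable_sum => // w _.
under eq_fun do rewrite EFinM.
by apply: integrableZl => //; exact: indic_integrable.
Qed.

Let integral_step n G :
  (\int[mu]_(x in X) (step n G x)%:E)%E = (wsum n (fun w => G w * c w))%:E.
Proof.
rewrite (eq_integral (fun x : borel_shift A => \sum_(w : n.-tuple A) (G w * \1_(cyl w) x)%:E)%E); last first.
  by move=> x _; rewrite stepE sumEFin.
rewrite integral_sum //; last first.
  move=> w; under eq_fun do rewrite EFinM.
  by apply: integrableZl => //; exact: indic_integrable.
rewrite -sumEFin; apply: eq_bigr => w _.
under eq_integral do rewrite EFinM.
rewrite integralZl //; last exact: indic_integrable.
by rewrite integral_indic // cE EFinM.
Qed.

(** Integrals enter the proof only through the integrals of step functions, which
    are sums over words. *)
Lemma integral_step_bounds n (lo hi : seq A -> R) (f : borel_shift A -> R) :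
  measurable_fun (X : set (borel_shift A)) f ->
  (forall x, X x -> lo (mkseq x n) <= f x <= hi (mkseq x n)) ->
  mu.-integrable (X : set (borel_shift A)) (EFin \o f) /\
  wsum n (fun w => lo w * c w) <= fine (\int[mu]_(x in X) (f x)%:E)%E <=
    wsum n (fun w => hi w * c w).
Proof.
move=> mf bf.
have intf : mu.-integrable (X : set (borel_shift A)) (EFin \o f).
  apply: measurable_bounded_integrable => //.
  exists (wsum n (fun w => `|lo w| + `|hi w|)); split; first exact: num_real.
  move=> M hM x Xx; apply: le_trans (ltW hM).
  have := @le_term_wsum _ _ n (fun w => `|lo w| + `|hi w|) (mkseq x n).
  rewrite size_mkseq => /(_ (fun w => addr_ge0 (normr_ge0 _) (normr_ge0 _)) erefl).
  apply: le_trans; have /andP[h1 h2] := bf x Xx.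
  have := ler_norm (hi (mkseq x n)); have := ler_norm (- lo (mkseq x n)).
  have := normr_ge0 (hi (mkseq x n)); have := normr_ge0 (lo (mkseq x n)).
  rewrite normrN ler_norml => *; apply/andP; split; lra.
split => //.
have fin : (\int[mu]_(x in X) (f x)%:E)%E \is a fin_num by exact: integrable_fin_num.
rewrite -!lee_fin fineK // -!integral_step; apply/andP; split.
  apply: le_integral => //; first exact: step_integrable.
  by move=> x /set_mem Xx; rewrite lee_fin; have /andP[] := bf x Xx.
apply: le_integral => //; first exact: step_integrable.
by move=> x /set_mem Xx; rewrite lee_fin; have /andP[] := bf x Xx.
Qed.

End Integrals.

(** * Entropy *)

Section Itineraries.
Variables (R : realType) (A : alphabetType) (mu : probability (borel_shift A) R).
Hypothesis mu_inv : forall B : set (borel_shift A), measurable B ->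
  mu (@sigma A @^-1` B) = mu B.
Local Notation s := (@sigma A).

Variables (J : finType) (xi : borel_shift A -> J).
Hypothesis mxi : forall j, measurable (xi @^-1` [set j]).

Definition itinerary n (x : borel_shift A) : seq J :=
  mkseq (fun i => xi (iter i s x)) n.

(** For the partition into letters these are the cylinders ([cell_letter]). *)
Definition cell (w : seq J) : set (borel_shift A) :=
  [set x | itinerary (size w) x = w].

Definition cell_mass w : R := fine (mu (cell w)).
Local Notation p := cell_mass.

Definition itinerary_entropy n : R := - wsum n (fun w => p w * ln (p w)).
Local Notation H := itinerary_entropy.

Lemma itineraryD n m x : itinerary (n + m) x = itinerary n x ++ itinerary m (iter n s x).
Proof.
apply: (@eq_from_nth _ (xi x)) => [|i]; first by rewrite size_cat !size_mkseq.
rewrite size_mkseq => inm; rewrite nth_cat size_mkseq nth_mkseq //.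
case: ltnP => ni; first by rewrite nth_mkseq.
by rewrite nth_mkseq ?ltn_subLR // -iterD subnK.
Qed.

Lemma size_itinerary n x : size (itinerary n x) = n.
Proof. by rewrite size_mkseq. Qed.

Lemma cell_cat u v : cell (u ++ v) = cell u `&` iter (size u) s @^-1` cell v.
Proof.
apply/seteqP; split=> x; rewrite /cell /= size_cat itineraryD.
  by move/eqP; rewrite eqseq_cat ?size_itinerary // => /andP[/eqP ? /eqP ?].
by move=> [-> ->].
Qed.

Lemma measurable_preimage_iter k (B : set (borel_shift A)) : measurable B ->
  measurable (iter k s @^-1` B : set (borel_shift A)).
Proof.
by move=> mB; have := measurable_iter_sigma k measurableT mB; rewrite setTI.
Qed.

Lemma measurable_cell w : measurable (cell w).
Proof.
elim: w => [|j w IH].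
  by rewrite (_ : cell [::] = setT) //; apply/seteqP; split.
rewrite -cat1s cell_cat; apply: measurableI; last exact: measurable_preimage_iter.
rewrite (_ : cell [:: j] = xi @^-1` [set j]) //.
apply/seteqP; split=> x; rewrite /cell /itinerary /=; first by case.
by move=> <-.
Qed.
Hint Resolve measurable_cell : core.

Lemma measure_cell_fibers n (B : set (borel_shift A)) : measurable B ->
  fine (mu B) = wsum n (fun w => fine (mu (B `&` cell w))).
Proof.
move=> mB; pose zeta x : n.-tuple J := [tuple of itinerary n x].
have zetaE (w : n.-tuple J) : zeta @^-1` [set w] = cell w.
  apply/seteqP; split=> x; rewrite /cell /= size_tuple; first by move=> <-.
  by move=> xw; apply/val_inj.
rewrite (@measure_fibers _ _ mu _ zeta) //; last by move=> w; rewrite zetaE.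
by apply: eq_bigr => w _; rewrite zetaE.
Qed.

Lemma cell_disjoint u v x : size u = size v -> cell u x -> cell v x -> u = v.
Proof. by move=> uv xu xv; rewrite -xu uv; exact: xv. Qed.

Lemma cell_mass_ge0 w : 0 <= p w.
Proof. exact: fine_ge0. Qed.
Hint Resolve cell_mass_ge0 : core.

Lemma cell_mass_le1 w : p w <= 1.
Proof. by rewrite -lee_fin fineK ?fin_num_measure // probability_le1. Qed.

Lemma wsum_cell_mass n : wsum n p = 1.
Proof.
transitivity (fine (mu setT)); last by rewrite probability_setT.
rewrite (measure_cell_fibers n) //; apply: eq_wsum => w _.
by rewrite setTI.
Qed.

Lemma cell_mass_right u n : wsum n (fun v => p (u ++ v)) = p u.
Proof.
rewrite [RHS](measure_cell_fibers (size u + n)) // wsum_cat.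
rewrite (wsum_split _ (erefl (size u))) [X in _ + X]big1 ?addr0 => [|w _].
  apply: eq_wsum => v _; congr (fine (mu _)); rewrite setIC; symmetry.
  by apply/setIidl; rewrite cell_cat => x [].
case: eqP => // wu; apply: big1 => v _.
rewrite (_ : _ `&` _ = set0) ?measure0 //; apply/seteqP; split=> // x [xu].
rewrite cell_cat => -[xw _]; apply: wu; apply: (@cell_disjoint _ _ x) => //.
by rewrite size_tuple.
Qed.

Lemma cell_mass_left v n : wsum n (fun u => p (u ++ v)) = p v.
Proof.
have <- : fine (mu (iter n s @^-1` cell v)) = p v by rewrite invariant_iter.
rewrite (measure_cell_fibers n) //; last exact: measurable_preimage_iter.
by apply: eq_wsum => u un; rewrite /p cell_cat un setIC.
Qed.

Lemma entropy_ge0 n : 0 <= H n.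
Proof.
rewrite /H -wsumN; apply: wsum_ge0 => w.
by rewrite -mulrN mulr_ge0 // oppr_ge0 ln_le0 // cell_mass_le1.
Qed.

(** Gibbs inequality against the product of the two marginals. *)
Lemma entropyD n m : H (n + m) <= H n + H m.
Proof.
pose q w := p (take n w) * p (drop n w).
have qE u v : size u = n -> q (u ++ v) = p u * p v.
  by move=> un; rewrite /q take_size_cat // drop_size_cat.
have pl u v : size u = n -> p (u ++ v) <= p u.
  move=> _; rewrite -(cell_mass_right u (size v)).
  exact: (@le_term_wsum _ _ _ (fun v => p (u ++ v))).
have pr u v : size u = n -> p (u ++ v) <= p v.
  move=> un; rewrite -(cell_mass_left v n).
  exact: (@le_term_wsum _ _ _ (fun u => p (u ++ v))).
have h : wsum (n + m) (fun w => p w * ln (q w)) <= wsum (n + m) (fun w => p w * ln (p w)).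
  apply: (@Gibbs_inequality _ _ (fun w : (n + m).-tuple J => p w) (fun w => q w)).
  - by [].
  - by move=> w; rewrite mulr_ge0.
  - move=> w pw.
    have wE : tval w = take n w ++ drop n w by rewrite cat_take_drop.
    have tn : size (take n w) = n by rewrite size_takel // size_tuple leq_addr.
    by rewrite mulr_gt0 // (lt_le_trans pw) // {1}wE; [exact: pl|exact: pr].
  - change (wsum (n + m) q <= wsum (n + m) p).
    rewrite wsum_cell_mass wsum_cat (@eq_wsum _ _ _ _ p) ?wsum_cell_mass // => u un.
    rewrite (@eq_wsum _ _ _ _ (fun v => p u * p v)) => [|v _]; last exact: qE.
    by rewrite wsumZ wsum_cell_mass mulr1.
rewrite /H -opprD lerN2; apply: le_trans h.
rewrite le_eqVlt; apply/orP; left; apply/eqP; apply/esym.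
rewrite wsum_cat.
rewrite [LHS](@eq_wsum _ _ _ _ (fun u => wsum m (fun v =>
    p (u ++ v) * ln (p u) + p (u ++ v) * ln (p v)))) => [|u un]; last first.
  apply: eq_wsum => v _; rewrite qE // -mulrDr.
  have := cell_mass_ge0 (u ++ v); rewrite le_eqVlt => /predU1P[<-|uv0].
    by rewrite !mul0r.
  rewrite lnM // posrE; [exact: lt_le_trans uv0 (pl _ _ un)|exact: lt_le_trans uv0 (pr _ _ un)].
under eq_wsum do rewrite wsumD.
rewrite wsumD; congr (_ + _).
  by apply: eq_wsum => u _; rewrite wsumZr cell_mass_right.
rewrite exchange_wsum; apply: eq_wsum => v _.
by rewrite wsumZr cell_mass_left.
Qed.

Lemma entropy_limit : exists2 h : R, (fun n => n%:R^-1 * H n : R) @ \oo --> h &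
  forall n, h * n%:R <= H n.
Proof.
apply: (@Fekete R H 0); first exact: entropyD.
by move=> n; rewrite mul0r entropy_ge0.
Qed.

End Itineraries.

Section Entropy.
Variables (R : realType) (A : alphabetType) (mu : probability (borel_shift A) R).
Hypothesis mu_inv : forall B : set (borel_shift A), measurable B ->
  mu (@sigma A @^-1` B) = mu B.
Local Notation s := (@sigma A).

Lemma partition_entropyE k (xi : borel_shift A -> 'I_k) n :
  partition_entropy mu xi n = itinerary_entropy mu xi n.
Proof.
rewrite /partition_entropy /itinerary_entropy /wsum; congr (- _).
apply: eq_bigr => w _; rewrite /cell_mass.
suff -> : join_cell xi w = cell xi w by [].
apply/seteqP; split=> x; rewrite /join_cell /cell /= size_tuple.
  move=> h; apply: (@eq_from_nth _ (xi x)); rewrite size_mkseq ?size_tuple // => i ni.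
  by rewrite nth_mkseq // (h (Ordinal ni)) (tnth_nth (xi x)).
move=> h i; rewrite (tnth_nth (xi x)) -h nth_mkseq //.
Qed.

Lemma entropy_rateE k (xi : borel_shift A -> 'I_k) (h : R) :
  (fun n => n%:R^-1 * itinerary_entropy mu xi n : R) @ \oo --> h ->
  entropy_rate mu xi = h.
Proof.
move=> lh; rewrite /entropy_rate; apply: cvg_lim => //.
by under eq_fun do rewrite partition_entropyE.
Qed.

Definition letter (x : borel_shift A) : A := x 0%N.

Lemma cell_letter w : cell letter w = cyl w.
Proof.
apply/seteqP; split=> x; rewrite /cell /cyl /= => <-; last first.
  by rewrite size_mkseq; apply: eq_mkseq => i; rewrite /letter iter_sigmaE addn0.
rewrite size_itinerary; apply: eq_mkseq => i.
by rewrite /letter iter_sigmaE addn0.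
Qed.

Lemma measurable_letter a : measurable (letter @^-1` [set a]).
Proof.
suff -> : letter @^-1` [set a] = cyl [:: a] by exact: measurable_cyl.
apply/seteqP; split=> x; rewrite /cyl /letter /mkseq /=; last by case.
by move=> ->.
Qed.

Local Notation m := (cylinder_mass mu).

Definition block_entropy n : R := - wsum n (fun w => m w * ln (m w)).

Lemma block_entropyE : block_entropy = itinerary_entropy mu letter.
Proof.
apply/funext => n; congr (- _); apply: eq_wsum => w _.
by rewrite /cell_mass cell_letter.
Qed.

(** The entropy of the shift is defined with partitions indexed by ['I_k]. *)
Lemma entropy_enum_rank n :
  itinerary_entropy mu (fun x => enum_rank (letter x)) n = block_entropy n.
Proof.
congr (- _); rewrite /wsum (reindex (fun w : n.-tuple A => map_tuple enum_rank w)) /=.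
  apply: eq_bigr => w _; suff -> : cell_mass mu (fun x => enum_rank (letter x)) (map enum_rank w) = m w by [].
  rewrite /cell_mass /cylinder_mass -cell_letter; congr (fine (mu _)).
  apply/seteqP; split=> x; rewrite /cell /= size_map => h.
    apply: (inj_map (@enum_rank_inj A)); rewrite -h /itinerary /mkseq -map_comp.
    by apply: eq_map.
  by rewrite -h size_itinerary /itinerary /mkseq -map_comp.
exists (fun w => map_tuple enum_val w) => w _; apply/val_inj; rewrite /= -map_comp.
  by rewrite (eq_map (@enum_rankK A)) map_id.
by rewrite (eq_map (@enum_valK A)) map_id.
Qed.

Section Generator.
Variables (J : finType) (xi : borel_shift A -> J).
Hypothesis mxi : forall j, measurable (xi @^-1` [set j]).
Variables (N : nat) (f : seq A -> J).

Definition misfit : set (borel_shift A) := [set x | xi x <> f (mkseq x N)].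

Lemma measurable_misfit : measurable misfit.
Proof.
have -> : misfit = \bigcup_(j in [set: J])
    (xi @^-1` [set j] `&` [set x | f (mkseq x N) <> j]).
  apply/seteqP; split=> [x xf|x [j _ [/= xj h]]]; last by move=> e; apply: h; rewrite -e.
  by exists (xi x) => //; split => // e; apply: xf.
apply: fin_bigcup_measurable; first exact: finite_finset.
move=> j _; apply: measurableI; first exact: mxi.
by apply: (@determined_measurable A N) => x y /= ->.
Qed.

(** [d] is the probability with which a letter is redrawn in the comparison law
    of [entropy_perturb]; [a] and [b] bound the cost in [- ln] of a letter and of
    a misfit. *)
Variables (d : R).
Hypothesis d01 : 0 < d < 1.

Let a : R := - ln (1 - d).
Let b : R := ln (#|J|%:R / d).

Let J0 : (0 < #|J|)%N.
Proof. by apply/card_gt0P; exists (xi point). Qed.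

(** The transition probability from [i] to [j]: stay with probability [1 - d],
    otherwise jump to a uniformly random place. *)
Let kappa (j i : J) : R := (if j == i then 1 - d else 0) + d / #|J|%:R.

Let dJ : 0 < d / #|J|%:R.
Proof. by case/andP: d01 => d0 _; rewrite divr_gt0 // ltr0n J0. Qed.

Let kappa_gt0 j i : 0 < kappa j i.
Proof.
have /andP[_ d1] := d01.
by rewrite /kappa ltr_wpDl //; case: ifP => // _; rewrite subr_ge0 ltW.
Qed.

Let kappa_sum i : \sum_j kappa j i = 1.
Proof.
rewrite big_split /= -big_mkcond /= big_pred1_eq sumr_const -[X in _ + X]mulr_natr.
by rewrite divfK ?subrK // pnatr_eq0 -lt0n J0.
Qed.

Let a_ge0 : 0 <= a.
Proof.
by have /andP[d0 d1] := d01; rewrite oppr_ge0 ln_le0 // gerBl ltW.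
Qed.

Let ln_kappa j i : - (a + b * (j != i)%:R) <= ln (kappa j i).
Proof.
have /andP[d0 d1] := d01; rewrite /kappa; case: eqP => _ /=.
  rewrite mulr0 addr0 /a opprK ler_ln ?posrE ?subr_gt0 //.
    by rewrite lerDl ltW.
  by rewrite ltr_wpDl // subr_ge0 ltW.
have -> : b = - ln (d / #|J|%:R).
  by rewrite /b -lnV ?posrE // invf_div.
by have := a_ge0; rewrite mulr1 add0r; lra.
Qed.

Let word_kappa (w : seq J) (v : seq A) : R :=
  \prod_(i < size w) kappa (nth (xi point) w i) (f (take N (drop i v))).

Let word_kappa_gt0 w v : 0 < word_kappa w v.
Proof. by apply: prodr_gt0. Qed.

Let wsum_kappa n (c : nat -> J) :
  wsum n (fun w => \prod_(i < n) kappa (nth (xi point) w i) (c i)) = 1.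
Proof.
elim: n c => [|n IH] c; first by rewrite wsum0 big_ord0.
rewrite wsumS -[RHS](kappa_sum (c 0%N)); apply: eq_bigr => j _.
under eq_wsum do rewrite big_ord_recl /=.
rewrite wsumZ -[RHS]mulr1; congr (_ * _).
exact: (IH (fun i => c i.+1)).
Qed.

Let P w v : R := fine (mu (cell xi w `&` cyl v)).

Let P_ge0 w v : 0 <= P w v.
Proof. exact: fine_ge0. Qed.

Let mcell w : measurable (cell xi w).
Proof. exact: measurable_cell. Qed.

Let P_left n v : wsum n (fun w => P w v) = m v.
Proof.
rewrite /P (eq_wsum (H := fun w => fine (mu (cyl v `&` cell xi w)))).
  by rewrite -(measure_cell_fibers mu mxi).
by move=> w _; rewrite setIC.
Qed.

Let P_right n w : wsum n (fun v => P w v) = cell_mass mu xi w.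
Proof. by rewrite -measure_cyl_fibers. Qed.

Let P_le_m w v : P w v <= m v.
Proof.
rewrite -(P_left (size w) v).
exact: (@le_term_wsum _ _ _ (fun w => P w v)).
Qed.

Let P_le_p w v : P w v <= cell_mass mu xi w.
Proof. by rewrite -(P_right (size v) w); exact: (@le_term_wsum _ _ _ (P w)). Qed.

Let P_misfit n (i : 'I_n) :
  wsum n (fun w => wsum (n + N) (fun v =>
    P w v * (nth (xi point) w i != f (take N (drop i v)))%:R)) = fine (mu misfit).
Proof.
have mB := measurable_misfit.
have mBi : measurable (iter i s @^-1` misfit : set (borel_shift A)).
  exact: measurable_preimage_iter.
rewrite -(invariant_iter mu_inv i mB) (measure_cell_fibers mu mxi n) //.
apply: eq_wsum => w wn; rewrite (measure_cyl_fibers _ (n + N)); last exact: measurableI.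
apply: eq_wsum => v vn.
have fit x : cell xi w x -> cyl v x ->
    xi (iter i s x) = nth (xi point) w i /\ mkseq (iter i s x) N = take N (drop i v).
  move=> xw xv; split.
    by rewrite -xw nth_mkseq // wn.
  rewrite -xv vn; have -> : (n + N = i + (N + (n - i)))%N by have := ltn_ord i; lia.
  by rewrite mkseq_cat drop_size_cat ?size_mkseq // mkseq_cat take_size_cat ?size_mkseq.
case: eqP => [e|ne]; rewrite /= ?mulr0 ?mulr1.
  rewrite (_ : _ `&` _ = set0) ?measure0 //; apply/seteqP; split=> // x [[xB xw] xv].
  by have [h1 h2] := fit x xw xv; apply: xB; rewrite h1 h2.
congr (fine (mu _)); apply/seteqP; split=> x; last by move=> [[_ xw] xv].
move=> [xw xv]; split=> //; split=> //=; have [h1 h2] := fit x xw xv.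
by rewrite /misfit /= h1 h2.
Qed.

(** Gibbs inequality for the joint law of the [xi]-itinerary and the word,
    against the law in which the itinerary is the image of the word under [f],
    with each letter redrawn uniformly with probability [d]. *)
Lemma entropy_perturb n : itinerary_entropy mu xi n <=
  block_entropy (n + N) + n%:R * (a + b * fine (mu misfit)).
Proof.
pose Q w v := m v * word_kappa w v.
have gibbs : wsum n (fun w => wsum (n + N) (fun v => P w v * ln (Q w v))) <=
    wsum n (fun w => wsum (n + N) (fun v => P w v * ln (P w v))).
  rewrite /wsum !pair_bigA /=.
  apply: (@Gibbs_inequality _ _ (fun e : n.-tuple J * (n + N).-tuple A => P e.1 e.2)
    (fun e => Q e.1 e.2)).
  - by [].
  - by move=> e; rewrite mulr_ge0 ?cylinder_mass_ge0 // ltW.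
  - by move=> e Pe; rewrite mulr_gt0 // (lt_le_trans Pe).
  - rewrite -(pair_bigA _ (fun (w : n.-tuple J) (v : (n + N).-tuple A) => Q w v)).
    rewrite -(pair_bigA _ (fun (w : n.-tuple J) (v : (n + N).-tuple A) => P w v)) /=.
    change (wsum n (fun w => wsum (n + N) (Q w)) <= wsum n (fun w => wsum (n + N) (P w))).
    rewrite [leRHS](@eq_wsum _ _ _ _ (cell_mass mu xi)); last by move=> w _.
    rewrite (wsum_cell_mass mu mxi) exchange_wsum -(wsum_cylinder_mass mu (n + N)).
    apply: le_wsum => v _; rewrite wsumZ -[leRHS]mulr1 ler_wpM2l ?cylinder_mass_ge0 //.
    rewrite -(wsum_kappa n (fun i => f (take N (drop i v)))).
    by apply: le_wsum => w wn; rewrite /word_kappa wn.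
have mono : wsum n (fun w => wsum (n + N) (fun v => P w v * ln (P w v))) <=
    - itinerary_entropy mu xi n.
  rewrite opprK; apply: le_wsum => w _; rewrite -{1}(P_right (n + N) w) -wsumZr.
  apply: le_wsum => v _; have := P_ge0 w v; rewrite le_eqVlt => /predU1P[<-|Pwv].
    by rewrite !mul0r.
  have pw := lt_le_trans Pwv (P_le_p w v).
  by rewrite ler_wpM2l // ler_ln ?posrE.
have low : - block_entropy (n + N) - n%:R * (a + b * fine (mu misfit)) <=
    wsum n (fun w => wsum (n + N) (fun v => P w v * ln (Q w v))).
  rewrite opprK.
  have -> : wsum (n + N) (fun v => m v * ln (m v)) =
      wsum n (fun w => wsum (n + N) (fun v => P w v * ln (m v))).
    rewrite exchange_wsum; apply: eq_wsum => v _.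
    by rewrite wsumZr P_left.
  have -> : n%:R * (a + b * fine (mu misfit)) = wsum n (fun w => wsum (n + N) (fun v =>
      \sum_(i < n) P w v * (a + b * (nth (xi point) w i != f (take N (drop i v)))%:R))).
    under eq_wsum do rewrite wsum_sum.
    rewrite wsum_sum (eq_bigr (fun=> a + b * fine (mu misfit))) => [|i _].
      by rewrite sumr_const card_ord mulr_natl.
    under eq_wsum do under eq_wsum do rewrite mulrDr mulrCA.
    under eq_wsum do rewrite wsumD wsumZ wsumZr P_right.
    by rewrite wsumD wsumZ wsumZr (wsum_cell_mass mu mxi) mul1r P_misfit.
  rewrite -wsumN -wsumD; apply: le_wsum => w wn; rewrite -wsumN -wsumD.
  apply: le_wsum => v _; have := P_ge0 w v; rewrite le_eqVlt => /predU1P[<-|Pwv].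
    by rewrite !mul0r big1 ?subr0 // => i _; rewrite mul0r.
  have mv := lt_le_trans Pwv (P_le_m w v).
  rewrite -mulr_sumr -mulrBr ler_wpM2l // /Q lnM ?posrE //.
  rewrite lerD2l /word_kappa wn.
  have -> : \prod_(i < n) kappa (nth (xi point) w i) (f (take N (drop i v))) =
     expR (\sum_(i < n) ln (kappa (nth (xi point) w i) (f (take N (drop i v))))).
    rewrite (big_morph _ (@expRD R) (@expR0 R)); apply: eq_bigr => i _.
    by rewrite lnK // posrE.
  rewrite expRK -sumrN; apply: ler_sum => i _; exact: ln_kappa.
by have := le_trans low (le_trans gibbs mono); lra.
Qed.

End Generator.

Lemma measure_cover_le (J : finType) (B : set (borel_shift A)) (D : J -> set (borel_shift A)) :
  measurable B -> (forall j, measurable (D j)) ->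
  (forall x, B x -> exists j, D j x) -> fine (mu B) <= \sum_j fine (mu (D j)).
Proof.
move=> mB mD BD; pose U := \big[setU/set0]_(j : J) D j.
have [mU leU] : measurable U /\ fine (mu U) <= \sum_j fine (mu (D j)).
  apply: (big_ind2 (fun S r => measurable S /\ fine (mu S) <= r)) => [|S r T q [mS Sr] [mT Tq]|j _].
  - by rewrite measure0.
  - split; first exact: measurableU.
    by apply: le_trans (lerD Sr Tq); exact: measure_sub_setU (measurableU _ _ mS mT) mS mT _.
  - by split.
apply: le_trans leU; rewrite fine_le ?fin_num_measure //.
apply: le_measure; rewrite ?inE // => x /BD[j Dx].
by rewrite /U (bigD1 j) //=; left.
Qed.

(** Approximate the fibres of [xi] by clopen sets, all determined by [N] letters,
    and let [f] pick a fibre whose approximation contains the point. *)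
Lemma fit_exists (J : finType) (xi : borel_shift A -> J) (e : R) :
  (forall j, measurable (xi @^-1` [set j])) -> 0 < e ->
  exists N f, fine (mu (misfit xi N f)) <= e.
Proof.
move=> mxi e0.
have J0 : (0 < #|J|)%N by apply/card_gt0P; exists (xi point).
have e'0 : 0 < e / #|J|%:R by rewrite divr_gt0 // ltr0n.
have mufin : (mu setT < +oo)%E by rewrite probability_setT ltry.
have ex j : exists nC : nat * set (fullshift A), determined nC.1 nC.2 /\
    (mu (xi @^-1` [set j] `+` nC.2) < (e / #|J|%:R)%:E)%E.
  by have [n [C [Cn h]]] := clopen_approximation mufin (mxi j) e'0; exists (n, C).
pose CC j := projT1 (cid (ex j)).
have CCn j : determined (CC j).1 (CC j).2 by case: (projT2 (cid (ex j))).
have CCe j : (mu (xi @^-1` [set j] `+` (CC j).2) < (e / #|J|%:R)%:E)%E.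
  by case: (projT2 (cid (ex j))).
pose N := (\max_j (CC j).1)%N.
pose f w := odflt (xi point) [pick j | `[< (CC j).2 (ext w) >]].
exists N, f.
have CN j x : (CC j).2 x <-> (CC j).2 (ext (mkseq x N)).
  by apply: determined_ext; apply: determinedW (CCn j); exact: leq_bigmax.
have mC j : measurable (xi @^-1` [set j] `+` (CC j).2 : set (borel_shift A)).
  have m1 := determined_measurable (CCn j).
  by apply: measurableU; apply: measurableD.
apply: le_trans (measure_cover_le (D := fun j => xi @^-1` [set j] `+` (CC j).2) _ _ _) _.
- exact: measurable_misfit.
- exact: mC.
- move=> x; rewrite /misfit /= /f; case: pickP => [j /asboolP Cx /= xj|none _].
    by exists j; right; split => //; exact/(proj2 (CN j x)).
  exists (xi x); left; split => // /CN Cx.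
  by have := none (xi x); rewrite asboolT.
- apply: (@le_trans _ _ (\sum_(j : J) e / #|J|%:R)); last first.
    by rewrite sumr_const -[leLHS]mulr_natr divfK // pnatr_eq0 -lt0n.
  apply: ler_sum => j _; rewrite -lee_fin fineK ?fin_num_measure //; exact: ltW.
Qed.

(** The Kolmogorov--Sinai theorem for the partition into letters: any other
    finite partition is nearly a function of finitely many letters, and then
    [entropy_perturb] bounds its entropy rate by that of the letters, up to an
    arbitrarily small [e]. *)
Lemma entropy_generator : exists2 h : R, entropy mu = h%:E &
  (fun n => n%:R^-1 * block_entropy n : R) @ \oo --> h /\
  forall n, h * n%:R <= block_entropy n.
Proof.
have [h hlim hlow] := entropy_limit mu_inv measurable_letter.
rewrite -block_entropyE in hlim hlow.
exists h => //; apply/eqP; rewrite eq_le; apply/andP; split; last first.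
  apply: ereal_sup_ubound; exists #|A|, (fun x => enum_rank (letter x)); split.
    move=> j; rewrite (_ : _ @^-1` _ = letter @^-1` [set enum_val j]).
      exact: measurable_letter.
    apply/seteqP; split=> x /=; first by move=> <-; rewrite enum_rankK.
    by move=> ->; rewrite enum_valK.
  congr (_%:E); apply/esym/entropy_rateE.
  by under eq_fun do rewrite entropy_enum_rank.
apply: ge_ereal_sup => _ [k [xi [mxi ->]]]; rewrite lee_fin.
have [h' lim' low'] := entropy_limit mu_inv mxi.
rewrite (entropy_rateE lim'); apply/ler_addgt0Pl => e e0.
have e2 : 0 < e / 2 by rewrite divr_gt0.
(* Such that the cost [- ln (1 - d)] per letter is [e / 2]. *)
pose d := 1 - expR (- (e / 2)).
have d01 : 0 < d < 1.
  by rewrite /d subr_gt0 expR_lt1 oppr_lt0 e2 /= gtrBl expR_gt0.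
pose b := ln (#|'I_k|%:R / d).
have b0 : 0 < `|b| + 1 by rewrite ltr_wpDl.
have [N [f fit]] := fit_exists mxi (divr_gt0 e2 b0).
have cost : - ln (1 - d) + b * fine (mu (misfit xi N f)) <= e.
  have -> : - ln (1 - d) = e / 2 by rewrite /d subKr expRK opprK.
  have fit0 : 0 <= fine (mu (misfit xi N f)) by exact: fine_ge0.
  have : b * fine (mu (misfit xi N f)) <= (`|b| + 1) * (e / 2 / (`|b| + 1)).
    apply: (@le_trans _ _ ((`|b| + 1) * fine (mu (misfit xi N f)))).
      by rewrite ler_wpM2r // (le_trans (ler_norm _)) // lerDl.
    by rewrite ler_wpM2l // ltW.
  by rewrite [(`|b| + 1) * _]mulrC divfK ?gt_eqF //; lra.
have main n : h' * n%:R <= block_entropy n + block_entropy N + n%:R * e.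
  apply: (le_trans (low' n)); apply: (le_trans (entropy_perturb mxi N f d01 n)).
  apply: lerD; last by rewrite ler_wpM2l.
  by rewrite block_entropyE; exact: (entropyD mu_inv measurable_letter).
have limR : (fun n => n%:R^-1 * block_entropy n + block_entropy N * n%:R^-1 : R) @ \oo --> h + block_entropy N * 0.
  by apply: cvgD => //; apply: cvgMr; exact: invn_cvg0.
rewrite mulr0 addr0 in limR; rewrite -lerBlDl.
apply: (cvgr_to_ge limR); near=> n.
have n0 : (0 : R) < n%:R by rewrite ltr0n; near: n; exact: nbhs_infty_gt.
rewrite [block_entropy N * _]mulrC -mulrDr -(ler_pM2l n0) mulVKf ?gt_eqF //.
by have := main n; rewrite mulrBr [n%:R * h']mulrC; lra.
Unshelve. all: by end_near. Qed.

End Entropy.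

(** * The variational principle *)

Section VariationalPrinciple.
Variables (R : realType) (A : alphabetType) (X : set (fullshift A)).
Variables (phi : fullshift A -> R) (B : R).
Hypothesis subshiftX : subshift X.
Hypothesis phi_continuous : {within X, continuous phi}.
Hypothesis phiB : forall x, X x -> `|phi x| <= B.
Implicit Types (x y : fullshift A) (u v w : seq A).

Local Notation L := (language X).
Local Notation S := (birkhoff phi).
Local Notation Phi := (word_sup X phi).
Local Notation g := (weight X phi).
Local Notation P := (pressure X phi).
Local Notation Lam := (fun n => wsum n (g L)).
Local Notation s := (@sigma A).

Let clX : closed X.
Proof. by case: subshiftX. Qed.

(** Two points with a common prefix of length [n] have iterates that stay
    uniformly close, but for the last [K] ones, with [K] independent of [n]. *)
Lemma word_sup_variation (e : R) : 0 < e -> exists N, forall n x, (N <= n)%N -> X x ->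
  Phi (mkseq x n) <= S n x + n%:R * e.
Proof.
move=> e0; have e2 : 0 < e / 2 by rewrite divr_gt0.
have [K hK] := unif_continuous clX phi_continuous e2.
have B0 := B_ge0 subshiftX phiB.
have [N] := filter_ex (nbhs_infty_gtr (4 * B * K%:R / e)).
rewrite /= ltr_pdivrMr // => hN; exists N => n x Nn Xx.
have Lx := language_mkseq subshiftX n Xx.
apply: (word_sup_le subshiftX phiB) => // y Xy; rewrite /cyl /= size_mkseq => yx.
rewrite -lerBlDl /birkhoff -sumrB.
apply: (@le_trans _ _ (\sum_(k < n) (e / 2 + 2 * B * (n - K <= k)%N%:R))).
  apply: ler_sum => k _.
  have Xyk := X_iter subshiftX k Xy; have Xxk := X_iter subshiftX k Xx.
  case: leqP => kK.
    have := phiB Xyk; have := phiB Xxk; rewrite !ler_norml => /andP[? ?] /andP[? ?].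
    by rewrite mulr1; lra.
  rewrite mulr0 addr0; apply: le_trans (ler_norm _) _; apply: hK => //.
  have kn : (k + K <= n)%N by lia.
  have := mkseq_sub kn yx; rewrite !mkseq_cat => /eqP.
  by rewrite eqseq_cat ?size_mkseq // => /andP[_ /eqP].
rewrite big_split /= sumr_const card_ord -mulr_sumr.
have cnt : \sum_(k < n) ((n - K <= k)%N%:R : R) <= K%:R.
  rewrite -natr_sum ler_nat.
  rewrite -(big_mkord xpredT (fun k => ((n - K <= k)%N : nat))).
  rewrite (@big_cat_nat _ _ _ (n - K)) ?leq_subr //=.
  rewrite big_nat big1 ?add0n => [|i /andP[_ ik]]; last by rewrite leqNgt ik.
  rewrite big_nat (eq_bigr (fun=> 1%N)) => [|i /andP[-> _]] //.
  by rewrite -big_nat sum_nat_const_nat muln1; lia.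
have nN : N%:R <= n%:R :> R by rewrite ler_nat.
rewrite -[_ *+ n]mulr_natl.
have h1 : 2 * B * \sum_(k < n) ((n - K <= k)%N%:R : R) <= 2 * B * K%:R.
  by rewrite ler_wpM2l // mulr_ge0.
have h2 : N%:R * e <= n%:R * e by rewrite ler_wpM2r // ltW.
lra.
Qed.

Section State.
Variable mu : probability (borel_shift A) R.
Hypothesis mu_inv : invariant_probability X mu.
Local Notation m := (cylinder_mass mu).

Let muX : mu X = 1%E. Proof. by case: mu_inv. Qed.

Let mu_sigma : forall C : set (borel_shift A), measurable C -> mu (s @^-1` C) = mu C.
Proof. by case: mu_inv. Qed.

Let mX : measurable (X : set (borel_shift A)).
Proof. exact: measurable_subshift. Qed.

Lemma massX w : fine (mu (cyl w `&` X)) = m w.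
Proof.
congr fine; have mC : measurable (~` X : set (borel_shift A)) by exact: measurableC.
have zero : mu (~` X) = 0%E by rewrite probability_setC ?muX ?subee.
rewrite [RHS](_ : _ = mu ((cyl w `&` X) `|` (cyl w `&` ~` X))); last first.
  by congr (mu _); rewrite -setIUr setUCr setIT.
rewrite measureU; [|exact: measurableI|exact: measurableI|by rewrite setIACA setICr setI0].
rewrite [X in _ + X](_ : _ = 0%E) ?adde0 //.
apply/eqP; rewrite eq_le measure_ge0 andbT -zero.
by apply: le_measure; rewrite ?inE //; exact: measurableI.
Qed.

Lemma mass_left v n : wsum n (fun u => m (u ++ v)) = m v.
Proof.
have := cell_mass_left mu_sigma (@measurable_letter A) v n.
by rewrite /cell_mass cell_letter; under eq_wsum do rewrite cell_letter.
Qed.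

Lemma mass_language w : ~ L w -> m w = 0.
Proof.
move=> nLw; rewrite -massX (_ : _ `&` _ = set0) ?measure0 //.
apply/seteqP; split=> // x [xw Xx]; apply: nLw; apply/languageP => //.
by exists x.
Qed.

Definition energy : R := fine (\int[mu]_(x in X) (phi x)%:E)%E.

Lemma measurable_phi_iter k :
  measurable_fun (X : set (borel_shift A)) (fun x : borel_shift A => phi (iter k s x)).
Proof.
apply: (@measurable_comp _ _ _ _ _ _ (X : set (borel_shift A)) phi
  (X : set (borel_shift A)) (iter k s : borel_shift A -> borel_shift A)) => //.
- by move=> _ [x Xx <-]; exact: X_iter.
- exact: within_continuous_measurable.
- apply: measurable_funTS; exact: measurable_iter_sigma.
Qed.

Lemma integral_phi_bounds k : mu.-integrable (X : set (borel_shift A))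
    (fun x => (phi (iter k s x))%:E).
Proof.
have [||h _] := @integral_step_bounds R A X clX mu muX 0 (fun=> - B) (fun=> B)
  (fun x => phi (iter k s x)).
- exact: measurable_phi_iter.
- by move=> x Xx; rewrite -ler_norml; apply: phiB; exact: X_iter.
- exact: h.
Qed.

(** Both integrals are, up to [e / 2], the integral of the same step function,
    because [mu] is invariant on cylinders. *)
Lemma energy_iter k : fine (\int[mu]_(x in X) (phi (iter k s x))%:E)%E = energy.
Proof.
apply/eqP; rewrite -subr_eq0 -normr_le0; apply/ler_addgt0Pl => e e0; rewrite addr0.
have e2 : 0 < e / 2 by rewrite divr_gt0.
have [N [a aP]] := step_approximation clX phi_continuous e2.
have bnd j : wsum N (fun u => a u * m u) - e / 2 <=
    fine (\int[mu]_(x in X) (phi (iter j s x))%:E)%E <= wsum N (fun u => a u * m u) + e / 2.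
  have [||_] := @integral_step_bounds R A X clX mu muX (j + N)
    (fun w => a (drop j w) - e / 2) (fun w => a (drop j w) + e / 2)
    (fun x => phi (iter j s x)).
  - exact: measurable_phi_iter.
  - move=> x Xx; rewrite mkseq_cat drop_size_cat ?size_mkseq //.
    have := aP _ (X_iter subshiftX j Xx); rewrite ler_norml => /andP[? ?].
    by apply/andP; split; lra.
  have E (c : R) : wsum (j + N) (fun w => (a (drop j w) + c) * fine (mu (cyl w `&` X))) =
      wsum N (fun u => a u * m u) + c.
    rewrite wsum_cat exchange_wsum -[c in RHS]mul1r -(wsum_cylinder_mass mu N) -wsumZr -wsumD.
    apply: eq_wsum => v _; rewrite (@eq_wsum _ _ _ _ (fun u => (a v + c) * m (u ++ v))).
      by rewrite wsumZ mass_left mulrDl [c * _]mulrC.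
    by move=> u uj; rewrite massX drop_size_cat.
  by rewrite !E.
have /andP[h1 h2] := bnd k; have /andP[h3 h4] := bnd 0%N.
rewrite /energy ler_norml; apply/andP; split; rewrite /= in h3 h4 *; lra.
Qed.

Lemma integral_birkhoff n : fine (\int[mu]_(x in X) (S n x)%:E)%E = n%:R * energy.
Proof.
rewrite (eq_integral (fun x : borel_shift A => \sum_(k < n) (phi (iter k s x))%:E)%E); last first.
  by move=> x _; rewrite /birkhoff sumEFin.
rewrite integral_sum //; last by move=> k; exact: integral_phi_bounds.
have fin k : (\int[mu]_(x in X) (phi (iter k s x))%:E)%E \is a fin_num.
  by apply: integrable_fin_num => //; exact: integral_phi_bounds.
under eq_bigr => k _ do rewrite -(fineK (fin k)) energy_iter.
by rewrite sumEFin /= sumr_const card_ord mulr_natl.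
Qed.

Lemma measurable_birkhoff n : measurable_fun (X : set (borel_shift A)) (S n : borel_shift A -> R).
Proof. by apply: measurable_sum => k; exact: measurable_phi_iter. Qed.

Lemma energy_le n : n%:R * energy <= wsum n (fun w => Phi w * m w).
Proof.
have [||_] := @integral_step_bounds R A X clX mu muX n (fun=> - (n%:R * B)) Phi (S n).
- exact: measurable_birkhoff.
- move=> x Xx; have := birkhoff_bound subshiftX phiB n Xx; rewrite ler_norml => /andP[-> _] /=.
  have := @le_word_sup _ _ _ _ _ subshiftX phiB (mkseq x n) x Xx (cyl_mkseq x n).
  by rewrite size_mkseq.
rewrite integral_birkhoff => /andP[_].
by under eq_wsum do rewrite massX.
Qed.

Lemma energy_ge (e : R) : 0 < e -> exists N, forall n, (N <= n)%N ->
  wsum n (fun w => Phi w * m w) <= n%:R * energy + n%:R * e.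
Proof.
move=> /word_sup_variation[N hN]; exists N => n Nn.
have [||_] := @integral_step_bounds R A X clX mu muX n (fun w => Phi w - n%:R * e)
  (fun=> n%:R * B) (S n).
- exact: measurable_birkhoff.
- move=> x Xx; have := birkhoff_bound subshiftX phiB n Xx; rewrite ler_norml => /andP[_ ->].
  by rewrite andbT lerBlDr; exact: hN.
rewrite integral_birkhoff => /andP[+ _].
under eq_wsum do rewrite massX mulrDl.
by rewrite wsumD wsumZ wsum_cylinder_mass mulr1; lra.
Qed.

(** Gibbs inequality; as [mu] charges words of the language only, [q] may vanish
    on the others. *)
Lemma block_entropy_le n (q : seq A -> R) :
  (forall w, L w -> 0 < q w) -> (forall w, 0 <= q w) -> wsum n q <= 1 ->
  block_entropy mu n <= - wsum n (fun w => m w * ln (q w)).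
Proof.
move=> qL q0 q1; rewrite /block_entropy lerN2.
apply: (@Gibbs_inequality _ _ (fun w : n.-tuple A => m w) (fun w : n.-tuple A => q w)) => //.
- by move=> w; exact: cylinder_mass_ge0.
- move=> w mw; apply: qL; apply: contrapT => /mass_language e.
  by rewrite e ltxx in mw.
- by change (wsum n q <= wsum n m); rewrite wsum_cylinder_mass.
Qed.

Lemma free_energyE (h : R) : entropy mu = h%:E -> free_energy X phi mu = (h + energy)%:E.
Proof.
move=> hE; rewrite /free_energy hE EFinD /energy fineK //.
apply: integrable_fin_num => //; exact: (integral_phi_bounds 0).
Qed.

Lemma ln_weight w : L w -> ln (g L w) = Phi w.
Proof. by move=> Lw; rewrite weightE // expRK. Qed.

Lemma eq_mass n (F H : seq A -> R) : (forall w, L w -> size w = n -> F w = H w) ->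
  wsum n (fun w => m w * F w) = wsum n (fun w => m w * H w).
Proof.
move=> FH; apply: eq_wsum => w wn; have [Lw|nLw] := pselect (L w); first by rewrite FH.
by rewrite mass_language // !mul0r.
Qed.

(** Gibbs inequality against the law with weights proportional to [g L]. *)
Lemma block_entropy_energy_le n :
  block_entropy mu n + wsum n (fun w => Phi w * m w) <= ln (Lam n).
Proof.
have Lam0 := Lam_gt0 subshiftX phiB n.
have := @block_entropy_le n (fun w => g L w / Lam n).
rewrite (@eq_mass _ _ (fun w => Phi w - ln (Lam n))); last first.
  by move=> w Lw _; rewrite ln_div ?posrE ?ln_weight // weightE ?expR_gt0.
have -> : wsum n (fun w => m w * (Phi w - ln (Lam n))) = wsum n (fun w => Phi w * m w) - ln (Lam n).
  rewrite (@eq_wsum _ _ _ _ (fun w => Phi w * m w + m w * - ln (Lam n))) => [|w _]; last first.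
    by rewrite mulrDr [m w * Phi w]mulrC.
  by rewrite wsumD wsumZr wsum_cylinder_mass mul1r.
have q0 w : 0 <= g L w / Lam n by rewrite divr_ge0 ?weight_ge0 // ltW.
have qL w : L w -> 0 < g L w / Lam n by move=> Lw; rewrite divr_gt0 // weightE // expR_gt0.
have q1 : wsum n (fun w => g L w / Lam n) <= 1 by rewrite wsumZr divff ?gt_eqF.
by move=> /(_ qL q0 q1); lra.
Qed.

Lemma free_energy_le : (free_energy X phi mu <= P%:E)%E.
Proof.
have [h hE [_ hlow]] := entropy_generator mu_sigma.
rewrite (free_energyE hE) lee_fin.
have [plim _] := pressure_limit subshiftX phiB.
apply: (cvgr_to_ge plim); near=> n.
have n0 : (0 : R) < n%:R by rewrite ltr0n; near: n; exact: nbhs_infty_gt.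
rewrite mulrC ler_pdivlMr //; apply: le_trans (block_entropy_energy_le n).
by have := hlow n; have := energy_le n; lra.
Unshelve. all: by end_near. Qed.

(** Equality in the variational principle leaves a trace at every finite [n], as
    the entropy is an infimum over [n]. *)
Lemma pressure_le_block n : free_energy X phi mu = P%:E ->
  n%:R * P <= block_entropy mu n + wsum n (fun w => Phi w * m w).
Proof.
have [h hE [_ hlow]] := entropy_generator mu_sigma.
rewrite (free_energyE hE) => -[<-].
by have := hlow n; have := energy_le n; lra.
Qed.

(** A measure with the upper Gibbs bound is an equilibrium state: the bound
    says that the information of a word is at least [n P - Phi w], up to a
    constant. *)
Lemma free_energy_Gibbs (K : R) : 0 < K ->
  (forall w, m w <= K * expR (- (size w)%:R * P) * g L w) ->
  free_energy X phi mu = P%:E.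
Proof.
move=> K0 mK; apply/eqP; rewrite eq_le free_energy_le /=.
have [h hE [hlim _]] := entropy_generator mu_sigma.
rewrite (free_energyE hE) lee_fin; apply/ler_addgt0Pl => e e0.
have [N hN] := energy_ge e0.
have low n : n%:R * P - ln K - wsum n (fun w => Phi w * m w) <= block_entropy mu n.
  rewrite lerNr opprB; apply: (@le_trans _ _ (wsum n (fun w => m w *
      (ln K - n%:R * P + Phi w)))).
    apply: le_wsum => w wn; have := cylinder_mass_ge0 mu w.
    rewrite le_eqVlt => /predU1P[<-|mw]; first by rewrite !mul0r.
    have Lw : L w by apply: contrapT => /mass_language e'; rewrite e' ltxx in mw.
    rewrite (ler_wpM2l (ltW mw)) //.
    have -> : ln K - n%:R * P + Phi w = ln (K * expR (- (size w)%:R * P) * g L w).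
      by rewrite !lnM ?posrE ?mulr_gt0 ?expR_gt0 ?weightE ?expR_gt0 // !expRK wn mulNr.
    rewrite ler_ln ?posrE // ?mulr_gt0 ?expR_gt0 // weightE // expR_gt0 //.
  under eq_wsum do rewrite mulrDr [X in _ + X]mulrC.
  by rewrite wsumD wsumZr wsum_cylinder_mass; lra.
have limL : (fun n => P - energy - e - ln K * n%:R^-1 : R) @ \oo --> P - energy - e - ln K * 0.
  by apply: cvgB; [exact: cvg_cst|apply: cvgMr; exact: invn_cvg0].
rewrite mulr0 subr0 in limL.
suff : P - energy - e <= h by lra.
apply: (ler_cvg_to limL hlim); near=> n.
have n0 : (0 : R) < n%:R by rewrite ltr0n; near: n; exact: nbhs_infty_gt.
rewrite -(ler_pM2l n0) mulVKf ?gt_eqF // mulrBr mulrCA mulfV ?gt_eqF // mulr1.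
have Nn : (N <= n)%N by near: n; exact: nbhs_infty_ge.
by have := low n; have := hN n Nn; rewrite !mulrBr; lra.
Unshelve. all: by end_near. Qed.

End State.

End VariationalPrinciple.

(** * Invariant measures dominated by a mixing one *)

Section SignedDifference.
Variables (R : realType) (A : alphabetType).
Variables mu nu : probability (borel_shift A) R.
Implicit Types (c : R) (E F Q : set (borel_shift A)).

(** The signed measure [nu - c mu], with real values. *)
Definition excess c E : R := fine (nu E) - c * fine (mu E).

Lemma excessU c E F : measurable E -> measurable F -> E `&` F = set0 ->
  excess c (E `|` F) = excess c E + excess c F.
Proof.
move=> mE mF EF; rewrite /excess !measureU // !fineD ?fin_num_measure //.
by rewrite mulrDr; lra.
Qed.

Lemma excessI c E F : measurable E -> measurable F ->
  excess c E = excess c (E `&` F) + excess c (E `\` F).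
Proof.
move=> mE mF; rewrite -excessU ?setUIDK //; first exact: measurableI.
  exact: measurableD.
by rewrite setDE setIACA setICr setI0.
Qed.

(** The negative part of a Hahn decomposition has the least excess. *)
Lemma least_excess c : exists2 Q : set (borel_shift A), measurable Q &
  forall E, measurable E -> excess c Q <= excess c E.
Proof.
pose s := cadd (charge_of_finite_measure nu) (cscale (- c) (charge_of_finite_measure mu)).
have [T [Q [[mT Tpos] [mQ Qneg] TQ1 TQ0]]] := Hahn_decomposition s.
have sE E : measurable E -> s E = (excess c E)%:E.
  move=> mE; change ((nu E + (- c)%:E * mu E)%E = (excess c E)%:E); rewrite /excess.
  by rewrite EFinB EFinM !fineK ?fin_num_measure // EFinN mulNe.
exists Q => // E mE.
have mEQ : measurable (E `&` Q) by exact: measurableI.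
have mED : measurable (E `\` Q) by exact: measurableD.
have mQD : measurable (Q `\` E) by exact: measurableD.
rewrite (excessI c mE mQ) (excessI c mQ mE) [Q `&` E]setIC lerD2l.
apply: (@le_trans _ _ 0).
  by rewrite -lee_fin -sE //; apply: Qneg => // x [].
rewrite -lee_fin -sE //; apply: Tpos => // x [Ex nQx].
by have : [set: borel_shift A] x by []; rewrite -TQ1 => -[].
Qed.

Lemma excess_sub_least c Q E : measurable Q -> measurable E ->
  (forall F, measurable F -> excess c Q <= excess c F) -> E `<=` Q -> excess c E <= 0.
Proof.
move=> mQ mE Qmin EQ; have := Qmin (Q `\` E) (measurableD mQ mE).
by rewrite (excessI c mQ mE) (setIidr EQ); lra.
Qed.

Lemma excess_setC c E : measurable E -> excess c (~` E) = 1 - c - excess c E.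
Proof.
move=> mE; rewrite /excess !probability_setC // !fineB ?fin_num_measure //=; lra.
Qed.

Hypothesis mu_sigma : forall E, measurable E -> mu (@sigma A @^-1` E) = mu E.
Hypothesis nu_sigma : forall E, measurable E -> nu (@sigma A @^-1` E) = nu E.
Hypothesis mu_mixing : forall E F, measurable E -> measurable F ->
  (0 < mu E)%E -> (0 < mu F)%E ->
  exists k, (0 < mu (E `&` iter k (@sigma A) @^-1` F))%E.
Hypothesis nu_dominated : forall E, measurable E -> mu E = 0%E -> nu E = 0%E.

(** Were the density of [nu] nonconstant, some set on which it is at least
    [c > 1] would meet an iterated preimage of a set on which it is at most
    [1]; preimages of the latter are of the same kind, as [nu] and [mu] are
    invariant. *)
Lemma dominated_invariant_eq E : measurable E -> nu E = mu E.
Proof.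
suff h F : measurable F -> fine (nu F) <= fine (mu F).
  move=> mE; apply/eqP; rewrite -(fineK (fin_num_measure nu _ mE)) -(fineK (fin_num_measure mu _ mE)).
  rewrite eqe eq_le h //=.
  have := h _ (measurableC mE); rewrite !probability_setC // !fineB ?fin_num_measure //=; lra.
move=> mF; rewrite leNgt; apply/negP => lt_mn.
(* As [mu F <= 1], the excess of [F] is still positive for this [c > 1]. *)
pose d := fine (nu F) - fine (mu F); pose c := 1 + d / 2.
have d0 : 0 < d by rewrite subr_gt0.
have muF1 : fine (mu F) <= 1.
  by rewrite -lee_fin fineK ?fin_num_measure // probability_le1.
have muF0 : 0 <= fine (mu F) by exact: fine_ge0.
have [N mN Nmin] := least_excess c; have [Q mQ Qmin] := least_excess 1.
have mNC := measurableC mN; have mFC := measurableC mF.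
(* On [~` N] the measure [nu] is at least [c mu], on [Q] it is at most [mu]. *)
have posN : 0 < excess c (~` N).
  rewrite excess_setC //; have := Nmin _ mFC; rewrite excess_setC //.
  have : 0 < excess c F by rewrite /excess /c -/d; rewrite /d in d0 *; nra.
  by lra.
have neg_mu (H : set (borel_shift A)) : measurable H -> (mu H <= 0)%E -> fine (mu H) = 0.
  by move=> mH ?; have /eqP -> : mu H == 0%E by rewrite eq_le measure_ge0 andbT.
have muN : (0 < mu (~` N))%E.
  rewrite ltNge; apply/negP => muN0; have e0 := neg_mu _ mNC muN0.
  have e1 : fine (nu (~` N)) = 0.
    by rewrite nu_dominated //; rewrite -(fineK (fin_num_measure mu _ mNC)) e0.
  by move: posN; rewrite /excess e0 e1; lra.
have muQ : (0 < mu Q)%E.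
  rewrite ltNge; apply/negP => muQ0; have e0 := neg_mu _ mQ muQ0.
  have := Qmin _ mFC; rewrite excess_setC // /excess e0.
  have : 0 <= fine (nu Q) by exact: fine_ge0.
  by rewrite -/d; move: d0; rewrite /d; lra.
have [k] := mu_mixing mNC mQ muN muQ.
set Qk : set (borel_shift A) := _ @^-1` Q; have mQk : measurable Qk.
  by have := measurable_iter_sigma k measurableT mQ; rewrite setTI.
have exQk : excess 1 Qk = excess 1 Q.
  by rewrite /excess /Qk !invariant_iter.
have mI : measurable (~` N `&` Qk) by exact: measurableI.
rewrite -(fineK (fin_num_measure mu _ mI)) lte_fin => muI.
have le1 : excess 1 (~` N `&` Qk) <= 0.
  by apply: (excess_sub_least mQk) => // H mH; rewrite exQk; exact: Qmin.
have gec : 0 <= excess c (~` N `&` Qk).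
  have := Nmin (N `|` (~` N `&` Qk)) (measurableU _ _ mN mI).
  by rewrite excessU ?lerDl // setIA setICr set0I.
move: le1 gec; rewrite /excess /c; nra.
Qed.

End SignedDifference.

(** * Mixing *)

Section Mixing.
Variables (R : realType) (A : alphabetType) (mu : probability (borel_shift A) R).
Implicit Types (u v w : seq A) (U V : set (fullshift A)) (E F : set (borel_shift A)).
Local Notation m := (cylinder_mass mu).
Local Notation s := (@sigma A).

Lemma measure_two_words n k U V : determined n U -> determined n V ->
  fine (mu (U `&` iter (n + k) s @^-1` V)) =
  wsum n (fun u => wsum n (fun v =>
    if `[< U (ext u) /\ V (ext v) >] then wsum k (fun b => m (u ++ b ++ v)) else 0)).
Proof.
move=> Un Vn; rewrite (@measure_determined _ _ _ (n + (k + n))); last first.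
  apply: determinedI; first exact: determinedW (leq_addr _ _) Un.
  by rewrite addnA; exact: determined_preimage.
rewrite wsum_cat; apply: eq_wsum => u un.
rewrite wsum_cat exchange_wsum; apply: eq_wsum => v vn.
have det (C : set (fullshift A)) x y : determined n C -> mkseq x n = mkseq y n -> C x <-> C y.
  by move=> Cn xy; split; apply: Cn.
have E b : size b = k -> (U `&` iter (n + k) s @^-1` V) (ext (u ++ b ++ v)) <->
    U (ext u) /\ V (ext v).
  move=> bk; have := @mkseq_ext _ (u ++ b ++ v).
  rewrite !size_cat un bk vn catA addnA !mkseq_cat => /eqP.
  rewrite !eqseq_cat ?size_cat ?size_mkseq ?un ?bk // => /andP[/andP[/eqP xu _] /eqP xv].
  rewrite (@det U (ext u) (ext ((u ++ b) ++ v))) //; last by rewrite mkseq_ext_n ?xu.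
  by rewrite (@det V (ext v) (iter (n + k) s (ext ((u ++ b) ++ v)))) // mkseq_ext_n ?xv.
case: asboolP => h; last first.
  by apply: big1 => b _; rewrite asboolF // => /(E _ (size_tuple b)).
by apply: eq_wsum => b bk; rewrite asboolT //; apply/(E b bk).
Qed.

Hypothesis mu_sigma : forall E, measurable E -> mu (s @^-1` E) = mu E.
Variable GM : nat -> set (seq A).
Hypothesis GM_thin : forall e : R, 0 < e -> exists M, forall n,
  wsum n (fun w => if `[< GM M w >] then 0 else m w) <= e.
Hypothesis GM_pair : forall M, exists k (c : R), 0 < c /\ forall u v,
  GM M u -> GM M v -> c * m u * m v <= wsum k (fun b => m (u ++ b ++ v)).

(** Approximate both sets by unions of cylinders and discard the words outside
    a large [GM M]; the gluing inequality, summed over the remaining pairs of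
    words, bounds the overlap from below by a constant that does not depend on
    the quality of the approximation. *)
Lemma mixing E F : measurable E -> measurable F -> (0 < mu E)%E -> (0 < mu F)%E ->
  exists k, (0 < mu (E `&` iter k s @^-1` F))%E.
Proof.
move=> mE mF; rewrite -(fineK (fin_num_measure mu _ mE)) -(fineK (fin_num_measure mu _ mF)).
rewrite !lte_fin; set a := fine (mu E); set b := fine (mu F) => a0 b0.
pose d := Num.min a b / 4.
have d0 : 0 < d by rewrite divr_gt0 // lt_min a0.
have da : 4 * d <= a by rewrite /d mulrC divfK // ge_min lexx.
have db : 4 * d <= b by rewrite /d mulrC divfK // ge_min lexx orbT.
have [M hM] := GM_thin d0; have [k [c [c0 hc]]] := GM_pair M.
(* Good words make up a mass [2 d] of each approximation, so the approximations
   overlap in a mass [4 c d d]; errors of [e] at both ends leave some of it. *)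
pose e := Num.min d (c * d * d).
have e0 : 0 < e by rewrite lt_min d0 /= mulr_gt0 // mulr_gt0.
have ed : e <= d by rewrite ge_min lexx.
have ec : e <= c * d * d by rewrite ge_min lexx orbT.
have mufin : (mu setT < +oo)%E by rewrite probability_setT ltry.
have [n1 [U [Un1 EU]]] := clopen_approximation mufin mE e0.
have [n2 [V [Vn2 FV]]] := clopen_approximation mufin mF e0.
pose n := (n1 + n2)%N.
have Un : determined n U by apply: determinedW Un1; exact: leq_addr.
have Vn : determined n V by apply: determinedW Vn2; exact: leq_addl.
have mU := determined_measurable Un; have mV := determined_measurable Vn.
have mY (C D : set (borel_shift A)) : measurable C -> measurable D -> measurable (C `+` D).
  by move=> mC mD; apply: measurableU; exact: measurableD.
have mEU : measurable (E `+` U) by exact: mY.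
have mFV : measurable (F `+` V) by exact: mY.
have toR (C : set (borel_shift A)) : measurable C -> (mu C < e%:E)%E -> fine (mu C) < e.
  by move=> mC Ce; rewrite -lte_fin fineK ?fin_num_measure.
move: (toR _ mEU EU) (toR _ mFV FV) => {}EU {}FV {toR}.
have subY (C D : set (borel_shift A)) : C `<=` D `|` (C `+` D).
  by move=> x Cx; have [Dx|nDx] := pselect (D x); [left|right; left].
pose good C := wsum n (fun u => if `[< C (ext u) /\ GM M u >] then m u else 0).
have goodP C (D : set (borel_shift A)) : determined n C -> measurable D ->
    fine (mu (D `+` C)) < e -> 4 * d <= fine (mu D) -> 2 * d <= good C.
  move=> Cn mD DC hD; have mC := determined_measurable Cn.
  have := @measure_sub_setU _ _ mu _ _ _ mD mC (mY _ _ mD mC) (@subY D C).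
  rewrite (measure_determined _ Cn).
  have : wsum n (fun w => if `[< C (ext w) >] then m w else 0) <=
      good C + wsum n (fun w => if `[< GM M w >] then 0 else m w).
    rewrite /good -wsumD; apply: le_wsum => w _; have := cylinder_mass_ge0 mu w.
    by rewrite asbool_and; case: asboolP => _; case: asboolP => _ /=; lra.
  by have := hM n; lra.
have goodU := goodP U E Un mE EU da; have goodV := goodP V F Vn mF FV db.
exists (n + k)%N.
have miter (C : set (borel_shift A)) : measurable C -> measurable (iter (n + k) s @^-1` C : set (borel_shift A)).
  by move=> mC; have := measurable_iter_sigma (n + k) measurableT mC; rewrite setTI.
have mI : measurable (E `&` iter (n + k) s @^-1` F) by apply: measurableI => //; exact: miter.
rewrite -(fineK (fin_num_measure mu _ mI)) lte_fin.
have mFV' := miter _ mFV.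
have overlap : 4 * (c * d * d) <= fine (mu (U `&` iter (n + k) s @^-1` V)).
  apply: (@le_trans _ _ (c * good U * good V)).
    have -> : 4 * (c * d * d) = c * (2 * d) * (2 * d) by ring.
    have d2 : 0 <= 2 * d by rewrite mulr_ge0 // ltW.
    by apply: ler_pM => //; [rewrite mulr_ge0 // ltW|rewrite (ler_wpM2l (ltW c0))].
  rewrite measure_two_words // /good -[c * wsum n _]wsumZ -wsumZr; apply: le_wsum => u un.
  rewrite -wsumZ; apply: le_wsum => v vn.
  have b_ge0 : 0 <= wsum k (fun b => m (u ++ b ++ v)) by apply: wsum_ge0 => ?; exact: cylinder_mass_ge0.
  case: (pselect (U (ext u) /\ GM M u)) => [Uu|nUu]; last first.
    by rewrite (asboolF nUu) mulr0 mul0r; case: ifP.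
  case: (pselect (V (ext v) /\ GM M v)) => [Vv|nVv]; last first.
    by rewrite (asboolF nVv) mulr0; case: ifP.
  by rewrite (asboolT Uu) (asboolT Vv) asboolT; [apply: hc; [case: Uu|case: Vv]|case: Uu; case: Vv].
have mUV : measurable (U `&` iter (n + k) s @^-1` V : set (borel_shift A)).
  by apply: measurableI => //; exact: miter.
have := @measure_sub_setU _ _ mu _ _ _ mUV mI (measurableU _ _ mEU mFV').
have := @measure_sub_setU _ _ mu _ _ _ (measurableU _ _ mEU mFV') mEU mFV' (fun=> id).
rewrite [mu (iter (n + k) s @^-1` _)]invariant_iter //.
have sub : U `&` iter (n + k) s @^-1` V `<=` (E `&` iter (n + k) s @^-1` F) `|`
    ((E `+` U) `|` iter (n + k) s @^-1` (F `+` V)).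
  move=> x [Ux Vx]; have [Ex|nEx] := pselect (E x); last by right; left; right.
  have [Fx|nFx] := pselect (F (iter (n + k) s x)); first by left.
  by right; right; right.
by move=> h1 /(_ sub); lra.
Qed.

End Mixing.

(** * Absolute continuity of equilibrium states *)

Section EquilibriumDominated.
Variables (R : realType) (A : alphabetType) (X : set (fullshift A)).
Variables (phi : fullshift A -> R) (B K : R).
Hypothesis subshiftX : subshift X.
Hypothesis phi_continuous : {within X, continuous phi}.
Hypothesis phiB : forall x, X x -> `|phi x| <= B.
Implicit Types (u v w : seq A) (D : set (fullshift A)) (E : set (borel_shift A)).

Local Notation L := (language X).
Local Notation Phi := (word_sup X phi).
Local Notation g := (weight X phi).
Local Notation P := (pressure X phi).
Local Notation Lam := (fun n => wsum n (g L)).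

Hypothesis K_gt0 : 0 < K.
Hypothesis Lam_le : forall n, Lam n <= K * expR (n%:R * P).

Variable nu : probability (borel_shift A) R.
Hypothesis nu_inv : invariant_probability X nu.
Hypothesis nu_max : free_energy X phi nu = P%:E.

Let K_ge1 : 1 <= K.
Proof.
rewrite -(ler_pM2r (expR_gt0 (0%:R * P))) mul1r; apply: le_trans (Lam_le 0).
exact: (expR_pressure_le subshiftX phiB).
Qed.

(** An equilibrium state cannot give much mass to a set of words of small total
    weight: splitting the words according to [D] would leave it an entropy
    below the one that [nu_max] demands. *)
Lemma equilibrium_mass_le n D (r : R) : determined n D -> 0 < r ->
  wsum n (fun w => if `[< D (ext w) >] then g L w else 0) <= r * expR (n%:R * P) ->
  0 <= ln 2 + ln K + fine (nu D) * ln r.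
Proof.
move=> Dn r0 hD; pose a w : R := if `[< D (ext w) >] then r else K.
have a0 w : 0 < a w by rewrite /a; case: ifP.
pose q w := (a w)^-1 * g L w * (expR (- (n%:R * P)) / 2).
have e0 : 0 < expR (- (n%:R * P)) / 2 by rewrite divr_gt0 ?expR_gt0.
have q0 w : 0 <= q w by rewrite !mulr_ge0 ?weight_ge0 ?invr_ge0 // ?(ltW (a0 _)) ?expR_ge0.
have qL w : L w -> 0 < q w.
  move=> Lw; have gw : 0 < g L w by rewrite weightE ?expR_gt0.
  by rewrite /q mulr_gt0 // mulr_gt0 // invr_gt0.
have q1 : wsum n q <= 1.
  rewrite wsumZr.
  have : wsum n (fun w => (a w)^-1 * g L w) <= 2 * expR (n%:R * P).
    apply: (@le_trans _ _ (r^-1 * wsum n (fun w => if `[< D (ext w) >] then g L w else 0)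
        + K^-1 * Lam n)).
      rewrite -!wsumZ -wsumD; apply: le_wsum => w _; have := weight_ge0 X phi L w.
      have ? : 0 < K^-1 by rewrite invr_gt0.
      by rewrite /a; case: asboolP => _ gw; rewrite ?mulr0 ?add0r // lerDl mulr_ge0 // ltW.
    have h1 : r^-1 * wsum n (fun w => if `[< D (ext w) >] then g L w else 0) <= expR (n%:R * P).
      by rewrite mulrC ler_pdivrMr // mulrC.
    have h2 : K^-1 * Lam n <= expR (n%:R * P) by rewrite mulrC ler_pdivrMr // mulrC.
    by lra.
  move=> h; apply: (@le_trans _ _ (2 * expR (n%:R * P) * (expR (- (n%:R * P)) / 2))).
    by rewrite ler_wpM2r // ltW.
  have -> : 2 * expR (n%:R * P) * (expR (- (n%:R * P)) / 2) = expR (n%:R * P) * expR (- (n%:R * P)).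
    by field.
  by rewrite -expRD subrr expR0.
have := block_entropy_le subshiftX nu_inv qL q0 q1.
have := pressure_le_block subshiftX phi_continuous phiB nu_inv n nu_max.
set m := cylinder_mass nu.
have -> : wsum n (fun w => m w * ln (q w)) = - wsum n (fun w => m w * ln (a w)) +
    wsum n (fun w => Phi w * m w) - n%:R * P - ln 2.
  rewrite (eq_mass subshiftX nu_inv (H := fun w => - ln (a w) + Phi w + (- (n%:R * P) - ln 2))).
    rewrite (@eq_wsum _ _ _ _ (fun w => - (m w * ln (a w)) + Phi w * m w +
      (- (n%:R * P) - ln 2) * m w)) => [|w _]; last by rewrite /m; ring.
    by rewrite !wsumD wsumN wsumZ /m wsum_cylinder_mass; lra.
  move=> w Lw _; have gw : 0 < g L w by rewrite weightE ?expR_gt0.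
  have aw : 0 < (a w)^-1 by rewrite invr_gt0.
  rewrite /q lnM ?posrE ?(mulr_gt0 aw) // ln_div ?posrE ?expR_gt0 // expRK.
  rewrite [ln (_ * _)]lnM ?posrE // ln_weight //.
  by rewrite lnV ?posrE ?a0.
have lnK : 0 <= ln K by exact: ln_ge0.
have : wsum n (fun w => m w * ln (a w)) <= fine (nu D) * ln r + ln K.
  rewrite (measure_determined _ Dn) -wsumZr -[ln K in leRHS]mul1r.
  rewrite -(wsum_cylinder_mass nu n) -wsumZr -wsumD; apply: le_wsum => w _.
  have := cylinder_mass_ge0 nu w; rewrite -/m /a => mw.
  by case: asboolP => _; rewrite ?mul0r ?add0r // lerDl mulr_ge0.
by lra.
Qed.

Variables (mu : probability (borel_shift A) R) (GM : nat -> set (seq A)).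
Hypothesis GM_lower : forall M, exists c : R, 0 < c /\ forall u, GM M u ->
  c * (expR (- (size u)%:R * P) * g L u) <= cylinder_mass mu u.
Hypothesis GM_tail : forall e : R, 0 < e -> exists M, forall n,
  wsum n (g (L `\` GM M)) <= e * expR (n%:R * P).

(** On words of [GM M] the weight is bounded by the mass that [mu] gives them, and
    the other words have small total weight, so a clopen set of small [mu]-mass
    satisfies the premise of [equilibrium_mass_le] with a small [r]. *)
Lemma equilibrium_small_mass (e : R) : 0 < e -> exists2 d : R, 0 < d &
  forall n D, determined n D -> fine (mu D) <= d -> fine (nu D) <= e.
Proof.
move=> e0; pose l := ln 2 + ln K.
have lnK : 0 <= ln K by exact: ln_ge0.
have l0 : 0 < l by rewrite ltr_wpDr // ln_gt0 // ltr1n.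
(* With this [r], [equilibrium_mass_le] reads [l * (1 - nu D / e) >= 0]; half of
   [r] is spent on the words outside [GM M]. *)
pose r := expR (- (l / e)); have r0 : 0 < r by exact: expR_gt0.
have r2 : 0 < r / 2 by rewrite divr_gt0.
have [M hM] := GM_tail r2; have [c [c0 hc]] := GM_lower M.
exists (c * (r / 2)) => [|n D Dn muD]; first by rewrite mulr_gt0.
have : 0 <= l + fine (nu D) * ln r.
  apply: (equilibrium_mass_le Dn r0).
  apply: (@le_trans _ _ (c^-1 * expR (n%:R * P) * fine (mu D) + r / 2 * expR (n%:R * P))).
    apply: le_trans (lerD (lexx _) (hM n)); rewrite (measure_determined _ Dn) -wsumZ -wsumD.
    apply: le_wsum => w wn; case: asboolP => _; last by rewrite mulr0 add0r weight_ge0.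
    have [Lw|nLw] := pselect (L w); last first.
      rewrite (weight0 _ _ nLw) addr_ge0 ?weight_ge0 // !mulr_ge0 ?expR_ge0 ?cylinder_mass_ge0 //.
      by rewrite invr_ge0 ltW.
    have [Gw|nGw] := pselect (GM M w); last first.
      rewrite [X in _ <= _ + X]weightE // (weightE _ _ Lw) lerDr !mulr_ge0 ?expR_ge0 ?cylinder_mass_ge0 //.
      by rewrite invr_ge0 ltW.
    apply: ler_wpDr; first exact: weight_ge0.
    have := hc _ Gw; rewrite wn mulrA -ler_pdivlMl ?mulr_gt0 ?expR_gt0 //.
    by rewrite invfM mulNr expRN invrK.
  have -> : r * expR (n%:R * P) = c^-1 * expR (n%:R * P) * (c * (r / 2)) + r / 2 * expR (n%:R * P).
    by field; rewrite gt_eqF.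
  by rewrite lerD2r ler_wpM2l // mulr_ge0 ?expR_ge0 // invr_ge0 ltW.
rewrite /r expRK mulrN mulrA subr_ge0 [fine _ * _]mulrC ler_pdivrMr // ler_pM2l //.
Qed.

(** Approximation with respect to [mu + nu] turns null sets into clopen sets of
    small mass for both. *)
Lemma equilibrium_dominated E : measurable E -> mu E = 0%E -> nu E = 0%E.
Proof.
move=> mE muE; apply/eqP; rewrite eq_le measure_ge0 andbT.
rewrite -(fineK (fin_num_measure nu _ mE)) lee_fin; apply/ler_addgt0Pl => e e0; rewrite addr0.
have e2 : 0 < e / 2 by rewrite divr_gt0.
have [d d0 hd] := equilibrium_small_mass e2.
pose s := measure_add mu nu.
have sfin : (s setT < +oo)%E.
  have -> : s setT = (1 + 1)%E.
    by rewrite /s measure_addE; congr (_ + _)%E; exact: probability_setT.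
  by rewrite -EFinD ltry.
have de0 : 0 < Num.min d (e / 2) by rewrite lt_min d0.
have [n [D [Dn]]] := clopen_approximation sfin mE de0.
have mD := determined_measurable Dn.
have mED : measurable (E `+` D : set (borel_shift A)) by apply: measurableU; exact: measurableD.
have muE' : mu (E `+` D) = (fine (mu (E `+` D)))%:E by rewrite fineK ?fin_num_measure.
have nuE' : nu (E `+` D) = (fine (nu (E `+` D)))%:E by rewrite fineK ?fin_num_measure.
move=> h0; have {h0} : (measure_add mu nu (E `+` D) < (Num.min d (e / 2))%:E)%E := h0.
rewrite measure_addE [X in (X + _)%E]muE' [X in (_ + X)%E]nuE' -EFinD lte_fin lt_min => /andP[h1 h2].
have muED : 0 <= fine (mu (E `+` D)) by exact: fine_ge0.
have nuED : 0 <= fine (nu (E `+` D)) by exact: fine_ge0.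
have muD : fine (mu D) <= d.
  have := @measure_sub_setU _ _ mu D E (E `+` D) mD mE mED.
  rewrite muE /= add0r => h; apply: le_trans (h _) _; last by lra.
  by move=> x Dx; have [Ex|nEx] := pselect (E x); [left|right; right].
have := hd _ _ Dn muD.
have := @measure_sub_setU _ _ nu E D (E `+` D) mE mD mED.
have sub : E `<=` D `|` (E `+` D).
  by move=> x Ex; have [Dx|nDx] := pselect (D x); [left|right; left].
by move=> /(_ sub); lra.
Qed.

End EquilibriumDominated.

(** * The Gibbs measure is the unique equilibrium state *)

Section WeakGibbs.
Variables (R : realType) (A : alphabetType) (X : set (fullshift A)).
Variables (phi : fullshift A -> R) (B : R) (Cp G Cs : set (seq A)).
Hypothesis subshiftX : subshift X.
Hypothesis phi_continuous : {within X, continuous phi}.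
Hypothesis phiB : forall x, X x -> `|phi x| <= B.
Hypothesis CpL : Cp `<=` language X.
Hypothesis GL : G `<=` language X.
Hypothesis CsL : Cs `<=` language X.
Hypothesis decomposition : concat3 X Cp G Cs = language X.
Hypothesis specification : forall M, S_specification X (enlarge X Cp G Cs M).
Hypothesis bowen : Bowen_property X phi G.
Hypothesis summable : (\sum_(1 <= n <oo)
  (Lambda X phi (Cp `|` Cs) n * expR (- n%:R * pressure X phi))%:E < +oo)%E.
Implicit Types (u v w : seq A).

Local Notation L := (language X).
Local Notation GM := (enlarge X Cp G Cs).
Local Notation Phi := (word_sup X phi).
Local Notation g := (weight X phi).
Local Notation P := (pressure X phi).
Local Notation rate u := (expR (- (size u)%:R * P) * g L u).

Lemma equilibrium_stateP mu : invariant_probability X mu ->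
  free_energy X phi mu = P%:E -> equilibrium_state X phi mu.
Proof.
move=> mu_inv mu_max.
have supE : ereal_sup [set free_energy X phi nu | nu in invariant_probability X] = P%:E.
  apply/eqP; rewrite eq_le; apply/andP; split.
    apply: ge_ereal_sup => _ [nu nu_inv <-].
    exact: (free_energy_le subshiftX phi_continuous phiB nu_inv).
  by apply: ereal_sup_ubound; exists mu.
by split => //; rewrite supE.
Qed.

Lemma weak_Gibbs_of_bounds (mu : probability (borel_shift A) R) (K' : R) :
  invariant_probability X mu -> 0 < K' ->
  (forall u, cylinder_mass mu u <= K' * rate u) ->
  (forall M, exists c : R, 0 < c /\ forall u, GM M u -> c * rate u <= cylinder_mass mu u) ->
  weak_Gibbs X phi GM mu.
Proof.
move=> mu_inv K0 upper lower; exists K', (fun M => projT1 (cid (lower M))).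
split => // [M|M n w [Gw wn]]; first by case: (cid (lower M)) => c [].
case: (cid (lower M)) => c [c0 hc] /=.
have Lw := enlarge_language Gw.
have -> : fine (mu (cylinder X w)) = cylinder_mass mu w.
  by rewrite -(massX subshiftX mu_inv w) setIC.
have rE : expR (- n%:R * P + Phi w) = rate w by rewrite weightE // expRD wn.
rewrite rE; have r0 : 0 < rate w by rewrite -rE expR_gt0.
by rewrite ler_pdivlMr // ler_pdivrMr // hc //=.
Qed.

(** The lower Gibbs bound is the gluing inequality with an empty second word; the
    upper one turns the gluing inequality between weights into one between masses,
    which is the premise of [mixing]. *)
Lemma unique_Gibbs_state : exists mu : probability (borel_shift A) R,
  [/\ invariant_probability X mu, free_energy X phi mu = P%:E, weak_Gibbs X phi GM mu &
    forall nu : probability (borel_shift A) R, invariant_probability X nu ->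
      free_energy X phi nu = P%:E ->
      forall E : set (borel_shift A), measurable E -> nu E = mu E].
Proof.
have [K K0 hK] := Lambda_le subshiftX phiB CpL GL CsL decomposition specification bowen summable.
have [mu [mu_inv upper lower2]] := Gibbs_measure subshiftX phiB K0 hK.
have {}upper u : cylinder_mass mu u <= K ^+ 2 * rate u by rewrite mulrA; exact: upper.
have pair M : exists k (c : R), 0 < c /\ forall u v, GM M u -> GM M v ->
    c * rate u * rate v <= wsum k (fun b => cylinder_mass mu (u ++ b ++ v)).
  have [t [c [c0 hc]]] :=
    glue_two subshiftX phiB CpL GL CsL decomposition specification bowen summable M.
  exists (t + (0 + t))%N, (c / K * expR (- (4 * t)%:R * P)).
  split=> [|u v Gu Gv]; first by rewrite mulr_gt0 ?expR_gt0 // divr_gt0.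
  by apply: (lower2 _ _ _ _ c0) => i j l; exact: hc.
have lower M : exists c : R, 0 < c /\ forall u, GM M u -> c * rate u <= cylinder_mass mu u.
  have [k [c [c0 hc]]] := pair M; exists c; split => // u Gu.
  have := hc u [::] Gu (enlarge_nil subshiftX GL decomposition M).
  rewrite [rate [::]](_ : _ = 1); last first.
    rewrite weightE; last exact: language_nil.
    by rewrite (word_sup_nil subshiftX phiB) oppr0 mul0r expR0 mulr1.
  rewrite mulr1 -(cylinder_mass_cat mu u k).
  by under eq_wsum do rewrite cats0.
have K2 : 0 < K ^+ 2 by rewrite exprn_gt0.
have tail := Lambda_enlargeC_le subshiftX phiB CpL GL CsL decomposition specification bowen summable.
have mu_max : free_energy X phi mu = P%:E.
  apply: (free_energy_Gibbs subshiftX phi_continuous phiB mu_inv K2) => w.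
  by rewrite -mulrA.
exists mu; split => // [|nu nu_inv nu_max E mE]; first exact: weak_Gibbs_of_bounds upper lower.
have mu_sigma : forall E : set (borel_shift A), measurable E -> mu (@sigma A @^-1` E) = mu E by case: mu_inv.
have nu_sigma : forall E : set (borel_shift A), measurable E -> nu (@sigma A @^-1` E) = nu E by case: nu_inv.
apply: dominated_invariant_eq => // [E1 E2 mE1 mE2|E1 mE1].
  apply: (@mixing _ _ mu mu_sigma GM) => // [e e0|M].
    have eK : 0 < e / K ^+ 2 by rewrite divr_gt0.
    have [M hM] := tail _ eK; exists M => n.
    apply: (@le_trans _ _ (K ^+ 2 * expR (- n%:R * P) * wsum n (g (L `\` GM M)))).
      rewrite -wsumZ; apply: le_wsum => w wn; case: asboolP => Gw.
        by rewrite mulr_ge0 ?weight_ge0 // mulr_ge0 ?expR_ge0 // ltW.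
      have [Lw|nLw] := pselect (L w); last first.
        by rewrite (mass_language subshiftX mu_inv nLw) mulr_ge0 ?weight_ge0 // mulr_ge0 ?expR_ge0 // ltW.
      have := upper w; rewrite wn mulrA (weightE _ _ Lw) => h.
      by rewrite weightE.
    apply: (le_trans (ler_wpM2l _ (hM n))); first by rewrite mulr_ge0 ?expR_ge0 // ltW.
    have -> : K ^+ 2 * expR (- n%:R * P) * (e / K ^+ 2 * expR (n%:R * P)) =
        e * (expR (- n%:R * P) * expR (n%:R * P)) by field; rewrite gt_eqF.
    by rewrite -expRD mulNr addNr expR0 mulr1.
  have [k [c [c0 hc]]] := pair M; exists k, (c / (K ^+ 2 * K ^+ 2)).
  split=> [|u v Gu Gv]; first by rewrite divr_gt0 // mulr_gt0.
  apply: le_trans (hc u v Gu Gv).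
  have -> : c * rate u * rate v =
      c / (K ^+ 2 * K ^+ 2) * (K ^+ 2 * rate u) * (K ^+ 2 * rate v).
    by field; rewrite gt_eqF.
  have cK : 0 <= c / (K ^+ 2 * K ^+ 2) by rewrite divr_ge0 ?mulr_ge0 // ltW.
  apply: ler_pM; [|exact: cylinder_mass_ge0|exact: ler_wpM2l|exact: upper].
  by apply: mulr_ge0 => //; exact: cylinder_mass_ge0.
exact: (equilibrium_dominated subshiftX phi_continuous phiB K0 hK nu_inv nu_max lower tail).
Qed.

End WeakGibbs.

(** * Periodic points *)

Section Loops.
Variable A : alphabetType.
Implicit Types (x : fullshift A) (w : seq A).
Local Notation s := (@sigma A).

(** The periodic point with period [w]; constant if [w] is empty. *)
Definition loop w : fullshift A := fun i => nth point w (i %% size w).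

Lemma mkseq_loop w : mkseq (loop w) (size w) = w.
Proof.
apply: (@eq_from_nth _ point); rewrite size_mkseq // => i iw.
by rewrite nth_mkseq // /loop modn_small.
Qed.

Lemma iter_loop w : iter (size w) s (loop w) = loop w.
Proof. by apply/funext => i; rewrite iter_sigmaE /loop modnDl. Qed.

Lemma loop_mkseq n x : (0 < n)%N -> iter n s x = x -> loop (mkseq x n) = x.
Proof.
move=> n0 xn; apply/funext => i; rewrite /loop size_mkseq nth_mkseq ?ltn_pmod //.
have per q r : x (q * n + r)%N = x r.
  by elim: q => [|q IH] //; rewrite mulSn -addnA -iter_sigmaE xn.
by rewrite {2}(divn_eq i n) per.
Qed.

Lemma loop_rot w : loop (rot 1 w) = s (loop w).
Proof.
case: w => [|a w]; first by apply/funext => i; rewrite /loop /sigma !nth_nil.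
apply/funext => i; rewrite /loop /sigma rot1_cons size_rcons nth_rcons /=.
rewrite -[in RHS]addn1 -modnDml; have : (i %% (size w).+1 < (size w).+1)%N by rewrite ltn_pmod.
rewrite ltnS leq_eqVlt => /predU1P[->|iw]; first by rewrite ltnn eqxx addn1 modnn.
by rewrite iw addn1 [in RHS]modn_small.
Qed.

End Loops.

Section PeriodicWeights.
Variables (R : realType) (A : alphabetType) (X : set (fullshift A)).
Variables (phi : fullshift A -> R) (B : R).
Hypothesis subshiftX : subshift X.
Hypothesis phiB : forall x, X x -> `|phi x| <= B.
Implicit Types (x y : fullshift A) (u v w : seq A).

Local Notation L := (language X).
Local Notation S := (birkhoff phi).
Local Notation Phi := (word_sup X phi).
Local Notation g := (weight X phi).
Local Notation P := (pressure X phi).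
Local Notation s := (@sigma A).

(** Points of [Per X n] correspond to words of length [n] whose [loop] lies in
    [X]; the weight makes sums over [Per X n] sums over all words. *)
Definition loop_weight w : R :=
  if `[< X (loop w) >] then expR (S (size w) (loop w)) else 0.

Local Notation h := loop_weight.

Lemma loop_weight_ge0 w : 0 <= h w.
Proof. by rewrite /h; case: ifP. Qed.
Hint Resolve loop_weight_ge0 : core.

Lemma loop_weight_le w : h w <= g L w.
Proof.
rewrite /h; case: asboolP => [Xw|_]; last exact: weight_ge0.
rewrite weightE; last by apply/languageP => //; exists (loop w); split => //; exact: mkseq_loop.
by rewrite ler_expR; apply: (le_word_sup subshiftX phiB) => //; exact: mkseq_loop.
Qed.

Lemma loop_weight_rot w : h (rot 1 w) = h w.
Proof.
case: w => // a w; rewrite /h loop_rot size_rot; set z := a :: w; set n := size z.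
have zn : iter n s (loop z) = loop z by exact: iter_loop.
have -> : `[< X (s (loop z)) >] = `[< X (loop z) >].
  apply: asbool_equiv_eq; split=> [Xz|Xz]; last exact: (X_iter subshiftX 1).
  by rewrite -zn -[n]/(size w).+1 iterSr; exact: X_iter.
congr (if _ then expR _ else _).
have := birkhoffD phi n 1 (loop z); rewrite addnC birkhoffD zn /=; lra.
Qed.

Lemma loop_weight_cat u v : h (u ++ v) <= g L u * g L v.
Proof. exact: le_trans (loop_weight_le _) (weight_cat subshiftX phiB _ _). Qed.

Lemma loop_weight_language u v : ~ L u -> h (u ++ v) = 0.
Proof.
move=> nLu; apply/eqP; rewrite eq_le loop_weight_ge0 andbT.
by apply: le_trans (loop_weight_cat u v) _; rewrite (weight0 _ _ nLu) mul0r.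
Qed.

Lemma loop_weight_mkseq n x : (0 < n)%N -> X x -> iter n s x = x ->
  h (mkseq x n) = expR (S n x).
Proof. by move=> n0 Xx xn; rewrite /h loop_mkseq // asboolT // size_mkseq. Qed.

Local Notation Z := (fun n => wsum n h).

(** Every word [w] of [H] starts the period of a periodic point of [X], with [t]
    more symbols; the Birkhoff sum of that point is within [V + t B] of the
    supremum over [w]. *)
Lemma loop_sum_ge (H : set (seq A)) (V : R) : H `<=` L -> variation_le X phi H V ->
  (forall n, expR (n%:R * P) / 2 <= wsum n (g H)) -> Per_specification X H ->
  exists t (c : R), 0 < c /\ forall n, (t < n)%N -> c * expR (n%:R * P) <= Z n.
Proof.
move=> HL HV HP [t spec].
exists t, (expR (- (V + t%:R * B) - t%:R * P) / 2); split; first by rewrite divr_gt0 ?expR_gt0.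
move=> n tn; pose l := (n - t)%N; have nE : n = (l + t)%N by rewrite /l subnK // ltnW.
have n0 : (0 < n)%N by exact: leq_ltn_trans tn.
have one w : size w = l -> g H w <= expR (V + t%:R * B) * wsum t (fun v => h (w ++ v)).
  move=> wl; have [Hw|nHw] := pselect (H w); last first.
    by rewrite (weight0 _ _ nHw) mulr_ge0 ?expR_ge0 // wsum_ge0.
  have [//|vs [[vs0 _ _]]] := spec w [::] Hw.
  move/size0nil : vs0 => ->; rewrite /Defs.glue /= cats0 wl -nE => -[y [[Xy yw] yn]].
  rewrite wl in yw.
  have yE : mkseq y n = w ++ mkseq (iter l s y) t by rewrite nE mkseq_cat yw.
  have st : size (mkseq (iter l s y) t) = t by rewrite size_mkseq.
  apply: (@le_trans _ _ (expR (V + t%:R * B) * h (mkseq y n))); last first.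
    rewrite yE ler_wpM2l ?expR_ge0 //.
    exact: (le_term_wsum (F := fun v => h (w ++ v)) (fun v => loop_weight_ge0 _) st).
  rewrite loop_weight_mkseq // weightE // -expRD ler_expR.
  have := variation_le_sup subshiftX phiB HL HV Hw Xy; rewrite /cyl /= wl => /(_ yw).
  have := birkhoff_bound subshiftX phiB t (X_iter subshiftX l Xy).
  rewrite ler_norml => /andP[+ _].
  by rewrite [in S n y]nE birkhoffD; lra.
have := HP l; set a := wsum l (g H) => hl.
have : a <= expR (V + t%:R * B) * Z n.
  by rewrite nE wsum_cat -wsumZ; apply: le_wsum => w wl; exact: one.
move=> hZ; have := le_trans hl hZ; rewrite mulrC -ler_pdivrMl ?expR_gt0 // -expRN.
move=> hn; rewrite [leLHS](_ : _ = expR (- (V + t%:R * B)) * (2^-1 * expR (l%:R * P))) //.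
rewrite mulrAC -expRD mulrC mulrCA -expRD; congr (_ * expR _).
by rewrite nE natrD; ring.
Qed.

End PeriodicWeights.

(** The step function does not depend on the measure, so that convergence of
    cylinder masses implies convergence of integrals. *)
Lemma integral_step_approx (R : realType) (A : alphabetType) (X : set (fullshift A))
    (f : fullshift A -> R) (e : R) : closed X -> {within X, continuous f} -> 0 < e ->
  exists n (a : seq A -> R), forall mu : {measure set (borel_shift A) -> \bar R},
    mu X = 1%E -> mu.-integrable (X : set (borel_shift A)) (EFin \o f) /\
    `|fine (\int[mu]_(x in X) (f x)%:E)%E - wsum n (fun w => a w * fine (mu (cyl w `&` X)))| <= e.
Proof.
move=> clX fc e0; have [n [a aP]] := step_approximation clX fc e0.
have mX : measurable (X : set (borel_shift A)) by exact: closed_measurable_shift.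
exists n, a => mu muX; set c := fun w => fine (mu (cyl w `&` X)).
have c1 : wsum n c = 1.
  have [||_] := @integral_step_bounds _ _ _ clX mu muX n (fun=> 1) (fun=> 1) (fun=> 1).
  - exact: measurable_cst.
  - by move=> x _; rewrite lexx.
  rewrite integral_cst // mul1e [X in fine X]muX /=.
  rewrite (@eq_wsum _ _ _ _ c) => [|w _]; last by rewrite mul1r.
  by move=> h; apply/eqP; rewrite eq_le.
have [||fi] := @integral_step_bounds _ _ _ clX mu muX n (fun u => a u - e) (fun u => a u + e) f.
- exact: within_continuous_measurable.
- by move=> x /aP; rewrite ler_norml => /andP[? ?]; apply/andP; split; lra.
have E r : wsum n (fun w => (a w + r) * fine (mu (cyl w `&` X))) = wsum n (fun w => a w * c w) + r.
  by rewrite -[r in RHS]mulr1 -c1 -wsumZ -wsumD; apply: eq_wsum => w _; rewrite mulrDl.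
rewrite !E => /andP[h1 h2]; split => //; rewrite ler_norml; apply/andP; split; lra.
Qed.

Lemma big_Per (A : alphabetType) (X : set (fullshift A)) (T : Type) (idx : T)
    (op : Monoid.com_law idx) n (F : fullshift A -> T) : (0 < n)%N ->
  \big[op/idx]_(x \in Per X n) F x =
  \big[op/idx]_(w : n.-tuple A | `[< X (loop w) >]) F (loop w).
Proof.
move=> n0.
have bij : set_bij [set w : n.-tuple A | X (loop w)] (Per X n) (fun w => loop w).
  split=> [w Xw|w1 w2 _ _ w12|x [Xx xn]].
  - by split => //; rewrite -[X in iter X _](size_tuple w) iter_loop.
  - by apply: val_inj; rewrite -[val w1]mkseq_loop -[val w2]mkseq_loop /= !size_tuple w12.
  - by exists [tuple of mkseq x n]; rewrite /= loop_mkseq.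
pose D := [pred w : n.-tuple A | `[< X (loop w) >]].
rewrite (reindex_fsbig _ _ _ _ bij) (fsbigE (enum D)) ?enum_uniq //.
- by rewrite big_enum_cond; apply: eq_bigl => w; exact: andbb.
- by move=> w; rewrite /= mem_enum => /asboolP.
- by move=> w Xw; rewrite mem_enum => /negP[]; apply/asboolP.
Qed.

Section PeriodicLimit.
Variables (R : realType) (A : alphabetType) (X : set (fullshift A)).
Variables (phi : fullshift A -> R) (B K c : R) (t : nat).
Hypothesis subshiftX : subshift X.
Hypothesis phi_continuous : {within X, continuous phi}.
Hypothesis phiB : forall x, X x -> `|phi x| <= B.
Implicit Types (x y : fullshift A) (u v w : seq A).

Local Notation L := (language X).
Local Notation S := (birkhoff phi).
Local Notation g := (weight X phi).
Local Notation P := (pressure X phi).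
Local Notation h := (loop_weight X phi).
Local Notation Z := (fun n => wsum n h).

Hypothesis K_gt0 : 0 < K.
Hypothesis Lam_le : forall n, wsum n (g L) <= K * expR (n%:R * P).
Hypothesis c_gt0 : 0 < c.
Hypothesis Z_ge : forall n, (t < n)%N -> c * expR (n%:R * P) <= Z n.

Let Z_gt0 n : (t < n)%N -> 0 < Z n.
Proof. by move=> /Z_ge; apply: lt_le_trans; rewrite mulr_gt0 ?expR_gt0. Qed.

(** What [periodic_measure X phi n] gives to the cylinder of [u], for large [n]. *)
Definition loop_mass n u : R :=
  if (size u <= n)%N then wsum (n - size u) (fun v => h (u ++ v)) / Z n else 0.

Lemma loop_mass01 n u : 0 <= loop_mass n u <= 1.
Proof.
rewrite /loop_mass; case: ifP => [un|_]; last by rewrite lexx ler01.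
have Z0 : 0 <= Z n by apply: wsum_ge0 => w; exact: loop_weight_ge0.
have s0 : 0 <= wsum (n - size u) (fun v => h (u ++ v)) by apply: wsum_ge0 => w; exact: loop_weight_ge0.
rewrite divr_ge0 //=; move: Z0; rewrite le_eqVlt => /predU1P[<-|Zpos]; first by rewrite invr0 mulr0.
rewrite ler_pdivrMr // mul1r -[n in leRHS](subnKC un) wsum_cat.
apply: (le_term_wsum (F := fun z => wsum (n - size u) (fun v => h (z ++ v)))) => // z.
by apply: wsum_ge0 => v; exact: loop_weight_ge0.
Qed.

Lemma loop_mass_nil n : (t < n)%N -> loop_mass n [::] = 1.
Proof. by move=> tn; rewrite /loop_mass /= subn0 divff // gt_eqF // Z_gt0. Qed.

Lemma loop_mass_right n u : (size u < n)%N ->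
  \sum_(a : A) loop_mass n (u ++ [:: a]) = loop_mass n u.
Proof.
move=> un; rewrite /loop_mass (ltnW un) -(subnSK un) wsumS mulr_suml.
apply: eq_bigr => a _; rewrite size_cat addn1 un; congr (_ / _).
by apply: eq_wsum => v _; rewrite -catA.
Qed.

(** Rotating the period does not change the weight. *)
Lemma loop_mass_left n u : (size u < n)%N ->
  \sum_(a : A) loop_mass n (a :: u) = loop_mass n u.
Proof.
move=> un; rewrite /loop_mass (ltnW un) -(subnSK un) -addn1 wsum_cat.
transitivity (\sum_(a : A) wsum (n - (size u).+1) (fun v => h ((a :: u) ++ v)) / Z n).
  by apply: eq_bigr => a _; rewrite /= un.
rewrite -mulr_suml -wsum_sum; congr (_ / _); apply: eq_wsum => v _; rewrite wsum1.
by apply: eq_bigr => a _; rewrite -loop_weight_rot // rot1_cons -cats1 catA.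
Qed.

Lemma loop_mass_le n u : (t < n)%N -> (size u <= n)%N ->
  loop_mass n u <= K / c * expR (- (size u)%:R * P) * g L u.
Proof.
move=> tn un; rewrite /loop_mass un ler_pdivrMr ?Z_gt0 //.
apply: (@le_trans _ _ (g L u * (K * expR ((n - size u)%:R * P)))).
  apply: (le_trans _ (ler_wpM2l (weight_ge0 X phi L u) (Lam_le _))).
  by rewrite -wsumZ; apply: le_wsum => v _; exact: (loop_weight_cat subshiftX phiB).
apply: le_trans (ler_wpM2l _ (Z_ge tn)); last first.
  by rewrite mulr_ge0 ?weight_ge0 // mulr_ge0 ?expR_ge0 // divr_ge0 // ltW.
rewrite natrB // mulrBl expRD -mulNr le_eqVlt; apply/orP; left; apply/eqP.
by field; rewrite gt_eqF.
Qed.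

Variable mu : probability (borel_shift A) R.
Hypothesis mu_inv : invariant_probability X mu.
Hypothesis mu_unique : forall nu : probability (borel_shift A) R,
  invariant_probability X nu -> free_energy X phi nu = P%:E ->
  forall E : set (borel_shift A), measurable E -> nu E = mu E.

(** Along every ultrafilter the masses converge to those of a measure with the
    upper Gibbs bound, that is to those of the unique equilibrium state. Were
    convergence to fail, some ultrafilter would contain the set of the [n] for
    which the distance to the limit exceeds [e]. *)
Lemma loop_mass_cvg u : (fun n => loop_mass n u) @ \oo --> cylinder_mass mu u.
Proof.
apply/cvgrPdist_le => e e0; apply: contrapT => bad.
pose F := within [set n | e < `|cylinder_mass mu u - loop_mass n u|] (\oo : set_system nat).
have PF : ProperFilter F.
  apply: Build_ProperFilter => F0; apply: bad.
  have {}F0 : \forall n \near \oo, e < `|cylinder_mass mu u - loop_mass n u| -> False := F0.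
  by near=> n; rewrite leNgt; apply/negP; near: n.
have [U [UF FU]] := ultraFilterLemma PF.
have PU : ProperFilter U by exact: ultra_proper.
have ooU : \oo `<=` U.
  move=> D ooD; apply: FU; rewrite /F /within /=; near=> n => _; near: n; exact: ooD.
have [||||nu [nu_inv nulim]] := @limit_state R A X subshiftX U loop_mass UF ooU loop_mass01.
- by exists t.+1 => // n /= tn; exact: loop_mass_nil.
- move=> v; apply: cvg_near_cst; exists (size v).+1 => // n /= vn.
  by rewrite loop_mass_right ?subrr.
- move=> v; apply: cvg_near_cst; exists (size v).+1 => // n /= vn.
  by rewrite loop_mass_left ?subrr.
- move=> v nLv; exists 0%N => // n _; rewrite /loop_mass; case: ifP => // _.
  rewrite [wsum _ _ in LHS]big1 ?mul0r // => z _.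
  exact: (loop_weight_language subshiftX phiB).
have nu_max : free_energy X phi nu = P%:E.
  apply: (free_energy_Gibbs subshiftX phi_continuous phiB nu_inv (K := K / c)); first exact: divr_gt0.
  move=> v; apply: (cvgr_to_le (nulim v)); apply: ooU; exists (maxn t.+1 (size v)) => // n /=.
  by rewrite geq_max => /andP[tn vn]; exact: loop_mass_le.
have numu : cylinder_mass nu u = cylinder_mass mu u.
  by congr fine; apply: (mu_unique nu_inv nu_max); exact: measurable_cyl.
have good : U [set n | `|cylinder_mass mu u - loop_mass n u| <= e].
  by have := nulim u; rewrite numu => /cvgrPdist_le/(_ e e0).
have Fbad : U [set n | e < `|cylinder_mass mu u - loop_mass n u|] by apply: FU; exact: withinT.
have [n [/= h1 h2]] := filter_ex (filterI good Fbad).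
by move: h1; rewrite leNgt h2.
Unshelve. all: by end_near. Qed.

Lemma periodic_sum n : (0 < n)%N -> \sum_(x \in Per X n) expR (S n x) = Z n.
Proof.
move=> n0; rewrite big_Per // big_mkcond; apply: eq_bigr => w _.
by rewrite /h size_tuple.
Qed.

(** The default word of [nth] is never reached. *)
Definition periodic_state n : {measure set (borel_shift A) -> \bar R} :=
  measure_function.msum (fun k => mscale
    (NngNum (divr_ge0 (loop_weight_ge0 X phi (nth (nseq_tuple n point) (enum {: n.-tuple A}) k))
       (wsum_ge0 n (loop_weight_ge0 X phi))))
    (dirac (loop (nth (nseq_tuple n point) (enum {: n.-tuple A}) k) : borel_shift A)))
  #|{: n.-tuple A}|.

Lemma periodic_stateE n E : periodic_state n E =
  (\sum_(w : n.-tuple A) (h w / Z n)%:E * (\d_(loop w : borel_shift A) E))%E.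
Proof.
rewrite -big_enum (big_nth (nseq_tuple n point)) big_mkord -cardE.
by [].
Qed.

Lemma periodic_measureE n : (t < n)%N ->
  periodic_measure X phi n = periodic_state n :> (set (borel_shift A) -> \bar R).
Proof.
move=> tn; have n0 : (0 < n)%N by exact: leq_ltn_trans tn.
apply/funext => E; rewrite periodic_stateE /periodic_measure periodic_sum // big_Per //.
rewrite big_mkcond ge0_sume_distrr => [|w _]; last first.
  by case: ifP => // _; rewrite mule_ge0 // lee_fin expR_ge0.
apply: eq_bigr => w _; rewrite /loop_weight; case: ifP => _; last by rewrite mule0 mul0r mul0e.
by rewrite muleA -EFinM [_^-1 * _]mulrC size_tuple.
Qed.

Lemma periodic_state_cyl n u : (size u <= n)%N ->
  fine (periodic_state n (cyl u `&` X)) = loop_mass n u.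
Proof.
move=> un; rewrite periodic_stateE /loop_mass un -wsumZr.
transitivity (wsum n (fun w => if take (size u) w == u then h w / Z n else 0)).
  rewrite -[RHS]/(fine (wsum n _)%:E) -sumEFin; congr fine; apply: eq_bigr => w _.
  have [Xw|nXw] := pselect (X (loop w)); last first.
    by rewrite /loop_weight (asboolF nXw) mul0r mul0e if_same.
  rewrite diracE -EFinM; congr (_%:E).
  have -> : (loop w \in cyl u `&` X) = (take (size u) w == u).
    have wE : mkseq (loop w) (size u) = take (size u) w.
      by rewrite -{2}[w : seq A]mkseq_loop mkseq_take // size_tuple.
    apply/idP/eqP => [|wu]; first by rewrite inE => -[+ _]; rewrite /cyl /= wE.
    by rewrite inE; split; rewrite // /cyl /= wE.
  by case: eqP => _; rewrite ?mulr1 ?mulr0.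
rewrite -[in LHS](subnKC un) wsum_cat (wsum_split _ (erefl (size u))).
rewrite [X in _ + X](_ : _ = 0) ?addr0; last first.
  apply: big1 => v _; case: eqP => // vu; apply: big1 => z _.
  by rewrite take_size_cat ?size_tuple //; case: eqP.
by apply: eq_wsum => v _; rewrite take_size_cat // eqxx subnKC.
Qed.

Lemma periodic_measure_cvg : weak_star_cvg X (periodic_measure X phi) mu.
Proof.
move=> f fc; have clX : closed X by case: subshiftX.
have mX := measurable_subshift subshiftX.
have muX : mu X = 1%E by case: mu_inv.
have stateX n : (t < n)%N -> periodic_state n X = 1%E.
  move=> tn; have cylX : cyl [::] `&` X = X by apply/seteqP; split=> [x []|x].
  have /esym := periodic_state_cyl (leq0n n : (size (@nil A) <= n)%N).
  rewrite cylX loop_mass_nil //; case: (periodic_state n X) => [r /= <-|/eqP|/eqP] //.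
  - by rewrite /= oner_eq0.
  - by rewrite /= oner_eq0.
have intE (nu : {measure set (borel_shift A) -> \bar R}) : nu X = 1%E ->
    nu.-integrable (X : set (borel_shift A)) (EFin \o f).
  by move=> nuX; have [n [a /(_ nu nuX)[]]] := integral_step_approx clX fc ltr01.
have limE : (\int[mu]_(x in X) (f x)%:E)%E = (fine (\int[mu]_(x in X) (f x)%:E))%:E.
  by rewrite fineK //; apply: integrable_fin_num => //; exact: intE.
rewrite limE; apply/fine_cvgP; split.
  near=> n; have tn : (t < n)%N by near: n; exact: nbhs_infty_gt.
  rewrite periodic_measureE //; apply: integrable_fin_num => //; apply: intE; exact: stateX.
apply/cvgrPdist_le => e e0; have e3 : 0 < e / 3 by rewrite divr_gt0.
have [N [a ha]] := integral_step_approx clX fc e3.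
have step_cvg : (fun n => wsum N (fun w => a w * loop_mass n w)) @ \oo -->
    wsum N (fun w => a w * cylinder_mass mu w).
  apply: cvg_big; [exact: add_continuous|move=> w _].
  by apply: cvgMr; exact: loop_mass_cvg.
near=> n; have tn : (t < n)%N by near: n; exact: nbhs_infty_gt.
have Nn : (N <= n)%N by near: n; exact: nbhs_infty_ge.
rewrite /= periodic_measureE //.
have [_] := ha _ muX; have [_] := ha _ (stateX n tn).
rewrite (@eq_wsum _ _ _ _ (fun w => a w * loop_mass n w)) => [|w wN]; last first.
  by rewrite periodic_state_cyl // wN.
rewrite [in X in _ -> X](@eq_wsum _ _ _ _ (fun w => a w * cylinder_mass mu w)) => [|w _]; last first.
  by rewrite (massX subshiftX mu_inv).
have : `|wsum N (fun w => a w * cylinder_mass mu w) - wsum N (fun w => a w * loop_mass n w)| <= e / 3.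
  by near: n; move: step_cvg => /cvgrPdist_le; apply.
rewrite !ler_norml => /andP[? ?] /andP[? ?] /andP[? ?]; apply/andP; split; lra.
Unshelve. all: by end_near. Qed.

End PeriodicLimit.

(** * Existence, uniqueness and periodic approximation *)

Theorem theorem3 (R : realType) (A : alphabetType) (X : set (fullshift A))
    (phi : fullshift A -> R) (Cp G Cs : set (seq A))
    (subshiftX : subshift X)
    (phi_continuous : {within X, continuous phi})
    (Cp_language : Cp `<=` language X)
    (G_language : G `<=` language X)
    (Cs_language : Cs `<=` language X)
    (decomposition : concat3 X Cp G Cs = language X)
    (specification : forall M, S_specification X (enlarge X Cp G Cs M))
    (bowen : Bowen_property X phi G)
    (summable : (\sum_(1 <= n <oo)
       (Lambda X phi (Cp `|` Cs) n * expR (- n%:R * pressure X phi))%:E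
       < +oo)%E) :
  exists mu : probability (borel_shift A) R,
    [/\ equilibrium_state X phi mu,
        forall nu : probability (borel_shift A) R,
          equilibrium_state X phi nu ->
          forall B : set (borel_shift A), measurable B -> nu B = mu B,
        weak_Gibbs X phi (enlarge X Cp G Cs) mu
      & (forall M, Per_specification X (enlarge X Cp G Cs M)) ->
        weak_star_cvg X (periodic_measure X phi) mu].
Proof.
have clX : closed X by case: subshiftX.
have [B phiB] := bounded_continuous clX phi_continuous.
have [mu [mu_inv mu_max gibbs unique]] := unique_Gibbs_state subshiftX phi_continuous phiB
  Cp_language G_language Cs_language decomposition specification bowen summable.
exists mu; split => //.
- exact: (equilibrium_stateP subshiftX phi_continuous phiB).
- by move=> nu [nu_inv nu_sup supE]; apply: unique => //; rewrite nu_sup.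
move=> per.
have [N _ hN] := Lambda_enlarge_ge subshiftX phiB Cp_language G_language Cs_language
  decomposition specification bowen summable 0.
have [V [_ hV]] := Bowen_enlarge Cp Cs subshiftX phiB bowen.
have [t [c [c0 hc]]] := loop_sum_ge subshiftX phiB (@enlarge_language _ X Cp G Cs N) (hV N) hN (per N).
have [K K0 hK] := Lambda_le subshiftX phiB Cp_language G_language Cs_language
  decomposition specification bowen summable.
exact: (periodic_measure_cvg subshiftX phi_continuous phiB K0 hK c0 hc mu_inv unique).
Qed.
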